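(* Let $N\ge2$, $n\ge1$, $\lambda,\gamma\in\mathbb{C}$, $\tau'\in\{1,-1\}$, $\beta=\tau'\lambda$, let $a\ne0$ be $C^\infty$ with $A(x)=\int^x\frac{dy}{a(y)}$ invertible, and let $$d_l=a(q_l)\partial_{q_l}+\sum_{k<l}v(q_l,q_k)\mathcal{P}_{kl}-\sum_{k>l}v(q_k,q_l)\mathcal{P}_{lk},\qquad v(x,y)=\frac{\beta}{e^{-2\gamma(A(x)-A(y))}-1}.$$ Let $\widetilde{\mathcal{H}}_{\Lambda^{(1)}}=\big(\sum_{i=1}^N d_i^2\big)\Lambda^{(1)}$. Then, restricted to $\mathfrak{L}^{(1)}_{\tau'}$, $$\widetilde{\mathcal{H}}_{\Lambda^{(1)}}=\sum_{i=1}^{N}\Big(a(q_i)^2\partial_{q_i}^2+a(q_i)a'(q_i)\partial_{q_i}\Big)+\sum_{1\le i<j\le N}\frac{\gamma\lambda\big(P_{ij}-\frac{\lambda}{2\gamma}\big)}{\sinh^2[\gamma(A(q_i)-A(q_j))]},$$ and this operator admits Yangian symmetry, i.e. it commutes with all coefficients (in $u^{-1}$) of all auxiliary-space matrix entries of $\mathcal{T}_0(u)\Lambda^{(1)}$, where $\mathcal{T}_0(u)=\mathcal{L}_{01}(u)\cdots\mathcal{L}_{0N}(u)$, $\mathcal{L}_{0i}(u)=\frac{u+d_i}{u+d_i-\lambda}\big(1-\frac{\lambda P_{0i}}{u+d_i}\big)$; moreover it is integrable, i.e. there are $N$ independent mutually commuting operators on $\mathfrak{L}^{(1)}_{\tau'}$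 commuting with it.
   Context: Wave functions $\phi(q_1,\dots,q_N|s_1,\dots,s_N)$, smooth in positions, spins $s_i\in\Sigma=\{-\frac{n-1}{2},\dots,\frac{n-1}{2}\}$ (spin states form $(\mathbb{C}^n)^{\otimes N}$). $\mathcal{P}_{ij}$ ($i<j$; $\mathcal{P}_{lk}:=\mathcal{P}_{kl}$) swaps positions $q_i,q_j$; $P_{ij}$ swaps spins $s_i,s_j$. The auxiliary space $0$ is an extra copy of $\mathbb{C}^n$ and $P_{0i}$ permutes it with the $i$-th spin factor. Rational expressions in $u$ and $d_i$ are formal power series in $u^{-1}$. $\Lambda^{(1)}=\frac{1}{N!}\prod_{j=2}^{N}\big(1+\tau'\sum_{i=1}^{j-1}P_{ij}\mathcal{P}_{ij}\big)$ and $\mathfrak{L}^{(1)}_{\tau'}=\Lambda^{(1)}\mathfrak{L}$ is the space of wave functions that are symmetric ($\tau'=1$) or antisymmetric ($\tau'=-1$) under simultaneous exchange of positions and spins of any two particles. *)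

(* Defs.v *)
From HB Require Import structures.
From mathcomp Require Import all_boot all_order all_algebra all_fingroup.
From mathcomp Require Import all_classical all_reals all_analysis.
From mathcomp Require Export complex.
Set Implicit Arguments. Unset Strict Implicit. Unset Printing Implicit Defensive.
Import Order.TTheory GRing.Theory Num.Theory numFieldNormedType.Exports.
Local Open Scope ring_scope.

Section Model.
Variable R : realType.

Definition cexp (z : R[i]) : R[i] :=
  Complex (expR (complex.Re z) * cos (complex.Im z))
          (expR (complex.Re z) * sin (complex.Im z)).
Definition csinh (z : R[i]) : R[i] := (cexp z - cexp (- z)) / 2.
Definition RtoC (x : R) : R[i] := Complex x 0.

Variables (N n : nat).

(* positions q = (q_1..q_N) as a row vector, spins s : 'I_N -> 'I_n
   (spin value s_i in Sigma is encoded by its index in 'I_n) *)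
Definition wf := 'rV[R]_N -> ('I_N -> 'I_n) -> R[i].

Definition upd (q : 'rV[R]_N) (i : 'I_N) (t : R) : 'rV[R]_N :=
  \row_j (if j == i then t else q 0 j).

Definition pd (i : 'I_N) (phi : wf) : wf := fun q s =>
  Complex (derive1 (fun t => complex.Re (phi (upd q i t) s)) (q 0 i))
          (derive1 (fun t => complex.Im (phi (upd q i t) s)) (q 0 i)).

Definition iter_pd (l : seq 'I_N) (phi : wf) : wf := foldr pd phi l.

Definition smooth_on (U : set 'rV[R]_N) (phi : wf) : Prop :=
  forall (l : seq 'I_N) (s : 'I_N -> 'I_n) (q : 'rV[R]_N), U q ->
    {for q, continuous (fun x : 'rV[R]_N => complex.Re (iter_pd l phi x s))} /\
    {for q, continuous (fun x : 'rV[R]_N => complex.Im (iter_pd l phi x s))} /\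
    forall i : 'I_N,
      derivable (fun t => complex.Re (iter_pd l phi (upd q i t) s)) (q 0 i) 1 /\
      derivable (fun t => complex.Im (iter_pd l phi (upd q i t) s)) (q 0 i) 1.

Definition Ppos (i j : 'I_N) (phi : wf) : wf := fun q s =>
  phi (\row_k q 0 (tperm i j k)) s.
Definition Pspin (i j : 'I_N) (phi : wf) : wf := fun q s =>
  phi q (fun k => s (tperm i j k)).

Variables (lam gam tau : R[i]) (a A : R -> R).

Definition beta : R[i] := tau * lam.

Definition vpot (x y : R) : R[i] :=
  beta / (cexp (- (2%:R) * gam * RtoC (A x - A y)) - 1).

(* regular configurations: all potentials are nonsingular *)
Definition regular (q : 'rV[R]_N) : Prop :=
  forall i j : 'I_N, i != j ->
    cexp (- (2%:R) * gam * RtoC (A (q 0 i) - A (q 0 j))) != 1.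

Definition dop (l : 'I_N) (phi : wf) : wf := fun q s =>
  RtoC (a (q 0 l)) * pd l phi q s
  + \sum_(k < N | (k < l)%N) vpot (q 0 l) (q 0 k) * Ppos k l phi q s
  - \sum_(k < N | (l < k)%N) vpot (q 0 k) (q 0 l) * Ppos l k phi q s.

Definition sym_factor (j : 'I_N) (phi : wf) : wf := fun q s =>
  phi q s + tau * \sum_(i < N | (i < j)%N) Pspin i j (Ppos i j phi) q s.

Definition Lam1 (phi : wf) : wf := fun q s =>
  (N`!%:R)^-1 *
  foldr (fun j acc => sym_factor j acc) phi [seq j : 'I_N <- enum 'I_N | (0 < j)%N] q s.

Definition eqU (phi psi : wf) : Prop :=
  forall q, regular q -> forall s, phi q s = psi q s.

Definition inL1 (phi : wf) : Prop :=
  exists psi, smooth_on regular psi /\ eqU phi (Lam1 psi).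

Definition Htilde (phi : wf) : wf := fun q s =>
  \sum_(i < N) dop i (dop i (Lam1 phi)) q s.

Definition Hexplicit (phi : wf) : wf := fun q s =>
  \sum_(i < N) (RtoC (a (q 0 i) ^+ 2) * pd i (pd i phi) q s
                + RtoC (a (q 0 i) * derive1 a (q 0 i)) * pd i phi q s)
  + \sum_(i < N) \sum_(j < N | (i < j)%N)
      gam * lam * (Pspin i j phi q s - lam / (2%:R * gam) * phi q s)
      / (csinh (gam * RtoC (A (q 0 i) - A (q 0 j)))) ^+ 2.

(* ---- auxiliary space 0: functions with an extra spin s_0 ---- *)
Definition wf0 := 'I_n -> wf.
Definition op0 := wf0 -> wf0.

Definition dop0 (i : 'I_N) : op0 := fun Phi s0 => dop i (Phi s0).
Definition P0 (i : 'I_N) : op0 := fun Phi s0 q s =>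
  Phi (s i) q (fun k => if k == i then s0 else s k).

Definition op0_id : op0 := fun Phi => Phi.
Definition op0_zero : op0 := fun _ _ _ _ => 0.
Definition op0_add (X Y : op0) : op0 := fun Phi s0 q s => X Phi s0 q s + Y Phi s0 q s.
Definition op0_scale (c : R[i]) (X : op0) : op0 := fun Phi s0 q s => c * X Phi s0 q s.
Definition op0_comp (X Y : op0) : op0 := fun Phi => X (Y Phi).

(* formal power series in u^{-1} with operator coefficients:
   F k is the coefficient of u^{-k} *)
Definition pser := nat -> op0.
Definition ps_one : pser := fun k => if k == 0%N then op0_id else op0_zero.
Definition ps_add (F G : pser) : pser := fun k => op0_add (F k) (G k).
Definition ps_scale (c : R[i]) (F : pser) : pser := fun k => op0_scale c (F k).
Definition ps_lcomp (X : op0) (F : pser) : pser := fun k => op0_comp X (F k).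
Definition ps_mul (F G : pser) : pser := fun k Phi s0 q s =>
  \sum_(j < k.+1) F j (G (k - j)%N Phi) s0 q s.

(* (u + D)^{-1} = sum_{k>=0} (-D)^k u^{-k-1} *)
Definition ps_inv_shift (D : op0) : pser := fun k =>
  if k is k'.+1 then op0_scale ((-1) ^+ k') (fun Phi => iter k' D Phi) else op0_zero.

(* L_{0i}(u) = (u+d_i)/(u+d_i-lam) (1 - lam P_{0i}/(u+d_i)),
   with (u+d_i)/(u+d_i-lam) = 1 + lam (u+d_i-lam)^{-1} *)
Definition Lax (i : 'I_N) : pser :=
  ps_mul
    (ps_add ps_one
       (ps_scale lam (ps_inv_shift (op0_add (dop0 i) (op0_scale (- lam) op0_id)))))
    (ps_add ps_one
       (ps_scale (- lam) (ps_lcomp (P0 i) (ps_inv_shift (dop0 i))))).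

Definition Tmono : pser := foldr (fun i acc => ps_mul (Lax i) acc) ps_one (enum 'I_N).

(* the (a,b) auxiliary-space matrix entry of the coefficient of u^{-k}
   of T_0(u) Lambda^(1), as an operator on wave functions *)
Definition TLam_entry (k : nat) (ai bi : 'I_n) (phi : wf) : wf :=
  Tmono k (fun s0 => if s0 == bi then Lam1 phi else (fun _ _ => 0)) ai.

Definition op_monomial (I : 'I_N -> wf -> wf) (D : nat) (al : {ffun 'I_N -> 'I_D})
    (phi : wf) : wf :=
  foldr (fun k acc => iter (al k) (I k) acc) phi (enum 'I_N).

End Model.

(* Main.v *)
Require Import Defs.
From HB Require Import structures.
From mathcomp Require Import all_boot all_order all_algebra all_fingroup.
From mathcomp Require Import all_classical all_reals all_analysis.
From mathcomp Require Import complex.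
From mathcomp Require Import ring lra zify.
Set Implicit Arguments. Unset Strict Implicit. Unset Printing Implicit Defensive.
Import Order.TTheory GRing.Theory Num.Theory numFieldNormedType.Exports.
Local Open Scope classical_set_scope.
Local Open Scope ring_scope.

(* Idea.  The potential is a function of [x_i = exp(-2 gamma A(q_i))], and the
   [d_l] are Dunkl operators: they commute with one another and satisfy
   degenerate Hecke relations with the transpositions of positions, so that
   symmetric polynomials in the [d_l] commute with all those transpositions.
   (1) In [sum d_l^2] the terms with three distinct indices cancel by the cyclic
   identity for [v], and those of a pair [l, k] add up to the [sinh^-2]
   potential once [P_ij] replaces the swap of positions, up to [tau'].
   (2) Multiplying [T_0(u)] by [prod (u + d_i - lambda)] clears denominators and
   leaves [prod (u + d_i - lambda P_0i)]; that product, hence [T_0(u)], preserves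
   the symmetry of wave functions by the Hecke relations of neighbouring indices.
   [sum d_l^2] commutes with every ingredient of [T_0(u)].
   (3) The integrals are the elementary symmetric polynomials in the [d_l].
   Let [g_i = (A(q_i) - A(0)) / delta], [delta = A(1) - A(0)].  Conjugated by
   [exp(t delta/2 sum g_i^2)], [d_i] becomes [d_i + t g_i]; the top coefficient
   in [t] of a polynomial relation between the integrals is a relation between
   elementary symmetric polynomials in the [g_i], and these are shown to be
   independent by letting [g_i = s^(b i)] as [s] goes to [0]. *)

(** Wave functions are compared only at regular configurations, whereas the algebra needs a vector
    space with true equality. Each spin component is therefore replaced by a smooth function on the
    regular set, extended by zero. Point evaluations separate these functions, so operator
    identities reduce to identities between complex numbers. The algebraic core is stated for any
    module with separating functionals; it serves both single spin components and families indexed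
    by all spins and the auxiliary one. The branch of [v] occurring in [d_l] depends on which index
    is larger, so a swap of positions conjugates the [d_l] in a simple way only for neighbouring
    indices; neighbours generate all exchanges. The conjugating phase in (3) has to be symmetric, in
    order to pass through the swaps, while its gradient must tell the particles apart, in order to
    keep the symbols independent. A sum of squares does both; a sum of the [g_i] would shift every
    [d_i] by the same constant. *)

Local Notation Re := complex.Re.
Local Notation Im := complex.Im.

(** * Complex-valued functions of real variables *)

Section ComplexDerivative.
Variable R : realType.
Implicit Types (f g : R -> R[i]) (t : R) (c : R[i]).

Lemma eq_ReIm (x y : R[i]) : Re x = Re y -> Im x = Im y -> x = y.
Proof. by case: x y => [a b] [c d] /= -> ->. Qed.

Lemma ReD (x y : R[i]) : Re (x + y) = Re x + Re y.
Proof. by case: x y => [a b] [c d]. Qed.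
Lemma ImD (x y : R[i]) : Im (x + y) = Im x + Im y.
Proof. by case: x y => [a b] [c d]. Qed.
Lemma ReM (x y : R[i]) : Re (x * y) = Re x * Re y - Im x * Im y.
Proof. by case: x y => [a b] [c d]. Qed.
Lemma ImM (x y : R[i]) : Im (x * y) = Re x * Im y + Im x * Re y.
Proof. by case: x y => [a b] [c d]. Qed.
Lemma ReV (x : R[i]) : Re x^-1 = Re x / (Re x ^+ 2 + Im x ^+ 2).
Proof. by case: x => [a b]. Qed.
Lemma ImV (x : R[i]) : Im x^-1 = - (Im x / (Re x ^+ 2 + Im x ^+ 2)).
Proof. by case: x => [a b]. Qed.

Lemma norm2_neq0 (x : R[i]) : x != 0 -> Re x ^+ 2 + Im x ^+ 2 != 0.
Proof.
apply: contra => /eqP; case: x => [a b] /= h; apply/eqP.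
have ha := sqr_ge0 a; have hb := sqr_ge0 b.
have /eqP : a ^+ 2 = 0 by lra.
have /eqP : b ^+ 2 = 0 by lra.
by rewrite !sqrf_eq0 => /eqP -> /eqP ->.
Qed.

Lemma cexpD (x y : R[i]) : cexp (x + y) = cexp x * cexp y.
Proof.
apply: eq_ReIm; rewrite ?ReM ?ImM /cexp /= ReD ImD expRD ?cosD ?sinD; ring.
Qed.

Lemma cexp0 : cexp 0 = 1 :> R[i].
Proof. by rewrite /cexp /= expR0 cos0 sin0 mulr1 mulr0. Qed.

Lemma cexp_neq0 (x : R[i]) : cexp x != 0.
Proof.
apply/eqP => h; have := cexpD x (- x); rewrite subrr cexp0 h mul0r.
by move/eqP; rewrite oner_eq0.
Qed.

Lemma cexpN (x : R[i]) : cexp (- x) = (cexp x)^-1.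
Proof.
apply: (mulfI (cexp_neq0 x)); rewrite divff ?cexp_neq0 //.
by rewrite -cexpD subrr cexp0.
Qed.

Lemma RtoC_eq0 (x : R) : (RtoC x == 0) = (x == 0).
Proof. by rewrite /RtoC eq_complex /= eqxx andbT. Qed.

Lemma RtoCM (x y : R) : RtoC (x * y) = RtoC x * RtoC y.
Proof. by apply: eq_ReIm; rewrite ?ReM ?ImM /=; ring. Qed.
Lemma RtoCD (x y : R) : RtoC (x + y) = RtoC x + RtoC y.
Proof. by apply: eq_ReIm; rewrite ?ReD ?ImD /=; ring. Qed.
Lemma RtoCV (x : R) : RtoC x^-1 = (RtoC x)^-1.
Proof.
apply: eq_ReIm; rewrite ?ReV ?ImV /= ?mul0r ?oppr0 // expr0n addr0.
by have [->|x0] := eqVneq x 0; [rewrite invr0 mul0r | field].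
Qed.
Lemma RtoCB (x y : R) : RtoC (x - y) = RtoC x - RtoC y.
Proof. by apply: eq_ReIm; rewrite /= ?subr0. Qed.

(** Real and imaginary parts are differentiated separately, as in [pd]; the relational form carries
    existence and value together. *)
Definition is_dC f t c : Prop :=
  is_derive t 1 (fun x => Re (f x)) (Re c) /\
  is_derive t 1 (fun x => Im (f x)) (Im c).

Lemma is_dC_ex f t :
  derivable (fun x => Re (f x)) t 1 -> derivable (fun x => Im (f x)) t 1 ->
  is_dC f t (Complex (derive1 (fun x => Re (f x)) t) (derive1 (fun x => Im (f x)) t)).
Proof. by move=> h1 h2; split; rewrite /= derive1E; apply: derivableP. Qed.

Lemma is_dC_val f t c : is_dC f t c ->
  Complex (derive1 (fun x => Re (f x)) t) (derive1 (fun x => Im (f x)) t) = c.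
Proof. by move=> [h1 h2]; apply: eq_ReIm; rewrite /= derive1E derive_val. Qed.

Lemma is_dC_eq f t c c' : is_dC f t c -> c = c' -> is_dC f t c'.
Proof. by move=> h <-. Qed.

Lemma is_dC_near f g t c :
  (\near t, f t = g t) -> is_dC f t c -> is_dC g t c.
Proof.
move=> fg [h1 h2]; split.
- by apply: near_eq_is_derive h1; near do congr complex.Re.
- by apply: near_eq_is_derive h2; near do congr complex.Im.
Unshelve. all: by end_near. Qed.

Lemma is_dC_cst c0 t : is_dC (fun => c0) t 0.
Proof. by split; apply: is_derive_cst. Qed.

Lemma is_dCD f g t c d : is_dC f t c -> is_dC g t d ->
  is_dC (fun x => f x + g x) t (c + d).
Proof.
move=> [f1 f2] [g1 g2]; split; rewrite ?ReD ?ImD.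
- rewrite (_ : (fun x => _) = (fun x => Re (f x)) + (fun x => Re (g x))).
    exact: is_deriveD.
  by apply/funext => x; rewrite ReD.
- rewrite (_ : (fun x => _) = (fun x => Im (f x)) + (fun x => Im (g x))).
    exact: is_deriveD.
  by apply/funext => x; rewrite ImD.
Qed.

Lemma is_derive_eqfun (h k : R -> R) t (a b : R) : is_derive t 1 h a ->
  (forall x, h x = k x) -> a = b -> is_derive t 1 k b.
Proof. by move=> H /funext <- <-. Qed.

Lemma is_dCM f g t c d : is_dC f t c -> is_dC g t d ->
  is_dC (fun x => f x * g x) t (c * g t + f t * d).
Proof.
move=> [f1 f2] [g1 g2]; split.
- apply: (is_derive_eqfun (is_deriveB (is_deriveM f1 g1) (is_deriveM f2 g2))).
  + by move=> x; rewrite ReM.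
  + by rewrite ReD !ReM /GRing.scale /=; ring.
- apply: (is_derive_eqfun (is_deriveD (is_deriveM f1 g2) (is_deriveM f2 g1))).
  + by move=> x; rewrite ImM.
  + by rewrite ImD !ImM /GRing.scale /=; ring.
Qed.

Lemma is_derive_inv (h : R -> R) t (a : R) : h t != 0 -> is_derive t 1 h a ->
  is_derive t 1 (fun x => (h x)^-1) (- a / h t ^+ 2).
Proof.
move=> h0 [h1 h2]; apply: DeriveDef; first exact: derivableV.
by rewrite deriveV // h2 /GRing.scale /= mulNr mulrC mulNr.
Qed.

(** Both parts of [1 / f] have the real denominator [Re f ^ 2 + Im f ^ 2], so the real product and
    inverse rules apply to each. *)
Lemma is_dCV f t c : f t != 0 -> is_dC f t c ->
  is_dC (fun x => (f x)^-1) t (- c / f t ^+ 2).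
Proof.
move=> f0 [f1 f2].
have n0 := norm2_neq0 f0.
have dn := is_deriveD (is_deriveM f1 f1) (is_deriveM f2 f2).
have dnV := is_derive_inv _ dn.
have e x : (((fun x => Re (f x)) * (fun x => Re (f x))) +
  ((fun x => Im (f x)) * (fun x => Im (f x)))) x = Re (f x) ^+ 2 + Im (f x) ^+ 2.
  by rewrite !expr2.
rewrite e in dnV; have {}dnV := dnV n0.
have e2 : - c / f t ^+ 2 = - c * ((f t)^-1 * (f t)^-1) by rewrite expr2 invfM.
split; rewrite e2.
- apply: (is_derive_eqfun (is_deriveM f1 dnV)).
  + by move=> x; rewrite ReV -e.
  + rewrite !e !ReM !ImM !ReV !ImV /GRing.scale /=.
    case: c {f1 f2 dn dnV e2} => [c1 c2] /=; case: (f t) n0 {f0} => [u v] /= n0.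
    by field.
- apply: (is_derive_eqfun (is_deriveN (is_deriveM f2 dnV))).
  + by move=> x; rewrite ImV -e.
  + rewrite !e !(ImM, ReM, ReV, ImV) /GRing.scale /=.
    case: c {f1 f2 dn dnV e2} => [c1 c2] /=; case: (f t) n0 {f0} => [u v] /= n0.
    by field.
Qed.

Lemma is_derive_comp1 (h k : R -> R) t (a b : R) :
  is_derive t 1 h a -> is_derive (h t) 1 k b ->
  is_derive t 1 (fun x => k (h x)) (b * a).
Proof.
move=> [h1 h2] [k1 k2]; apply: DeriveDef.
- apply/derivable1_diffP; apply: differentiable_comp; exact/derivable1_diffP.
- rewrite -derive1E (derive1_comp h1 k1) !derive1E.
  by rewrite h2 k2.
Qed.

Lemma is_dC_cexp f t c : is_dC f t c ->
  is_dC (fun x => cexp (f x)) t (c * cexp (f t)).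
Proof.
move=> [f1 f2].
have e1 := is_derive_comp1 f1 (is_derive_expR (Re (f t))).
have e2 := is_derive_comp1 f2 (is_derive_cos (Im (f t))).
have e3 := is_derive_comp1 f2 (is_derive_sin (Im (f t))).
split.
- apply: (is_derive_eqfun (is_deriveM e1 e2)); first by [].
  by rewrite ReM /GRing.scale /=; ring.
- apply: (is_derive_eqfun (is_deriveM e1 e3)); first by [].
  by rewrite ImM /GRing.scale /=; ring.
Qed.

Lemma is_dC_real (h : R -> R) t (a : R) : is_derive t 1 h a ->
  is_dC (fun x => RtoC (h x)) t (RtoC a).
Proof. by move=> h1; split => //=; apply: is_derive_cst. Qed.

End ComplexDerivative.

(** * Smooth functions of several variables on an open set; symmetry of mixed partial derivatives *)

Section Smooth.
Variables (R : realType) (N : nat) (U : set 'rV[R]_N).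
Hypothesis hU : open U.
Implicit Types (f g : 'rV[R]_N -> R[i]) (q : 'rV[R]_N) (i : 'I_N).

Lemma updE q i (t : R) j : upd q i t 0 j = if j == i then t else q 0 j.
Proof. by rewrite mxE. Qed.

Lemma upd_id q i : upd q i (q 0 i) = q.
Proof. by apply/rowP => j; rewrite updE; case: eqP => [->|]. Qed.

Lemma upd_upd q i (s t : R) : upd (upd q i s) i t = upd q i t.
Proof. by apply/rowP => j; rewrite !updE; case: eqP. Qed.

Lemma upd_comm q i j (s t : R) : i != j ->
  upd (upd q i s) j t = upd (upd q j t) i s.
Proof.
move=> ij; apply/rowP => k; rewrite !updE.
by case: eqP => [->|//]; rewrite eq_sym (negPf ij).
Qed.

Lemma nbhs_box q (W : set 'rV[R]_N) : nbhs q W ->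
  exists2 e : R, 0 < e & forall q', (forall k, `|q 0 k - q' 0 k| < e) -> W q'.
Proof.
move=> /nbhs_ballP[e /= e0 sub]; exists e => // q' h; apply: sub.
by split => // a b; rewrite !ord1; exact: h.
Qed.

Lemma near_upd q i (W : set 'rV[R]_N) : nbhs q W ->
  \forall t \near q 0 i, W (upd q i t).
Proof.
move=> /nbhs_box[e e0 sub]; apply/nbhs_ballP; exists e => // t /= ht.
apply: sub => k; rewrite updE; case: eqP => [->//|_].
by rewrite subrr normr0.
Qed.

Lemma nbhsU q : U q -> nbhs q U.
Proof. by move=> Uq; apply: open_nbhs_nbhs. Qed.

Definition pds i f : 'rV[R]_N -> R[i] := fun q =>
  Complex (derive1 (fun t => Re (f (upd q i t))) (q 0 i))
          (derive1 (fun t => Im (f (upd q i t))) (q 0 i)).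

Definition pdC i f q c := is_dC (fun t => f (upd q i t)) (q 0 i) c.

Definition contC f q :=
  {for q, continuous (fun x => Re (f x))} /\ {for q, continuous (fun x => Im (f x))}.

(** Counterpart of [smooth_on] for a single spin component; [smooth_onP] relates the two. *)
Definition smooth1 f : Prop := forall (l : seq 'I_N) q, U q ->
  contC (foldr pds f l) q /\ forall i, exists c, pdC i (foldr pds f l) q c.

Lemma pds_val i f q c : pdC i f q c -> pds i f q = c.
Proof. exact: is_dC_val. Qed.

Lemma pdC_near i f g q c : (\near q, f q = g q) -> pdC i f q c -> pdC i g q c.
Proof. by move=> /near_upd h; apply: is_dC_near; apply: h. Qed.

Lemma near_eqU f g q : U q -> (forall x, U x -> f x = g x) ->
  \near q, f q = g q.
Proof. by move=> Uq e; apply: filterS (nbhsU Uq) => x; exact: e. Qed.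

Lemma cont_near (f g : 'rV[R]_N -> R) q : (\near q, f q = g q) ->
  {for q, continuous f} -> {for q, continuous g}.
Proof.
move=> e; rewrite /prop_for /= /continuous_at -(nbhs_singleton e).
move=> h; apply: (cvg_trans _ h); apply: (@near_eq_cvg _ _ (nbhs q)); exact: e.
Qed.

Lemma contC_near f g q : (\near q, f q = g q) -> contC f q -> contC g q.
Proof.
move=> e [h1 h2]; split.
- by apply: cont_near h1; near do congr complex.Re.
- by apply: cont_near h2; near do congr complex.Im.
Unshelve. all: by end_near. Qed.

Lemma pdsP f i q : smooth1 f -> U q -> pdC i f q (pds i f q).
Proof.
by move=> /(_ [::]) h /h[_ /(_ i)[c hc]]; rewrite (pds_val hc).
Qed.

Lemma foldr_pds_eq f g (l : seq 'I_N) : (forall q, U q -> f q = g q) ->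
  forall q, U q -> foldr pds f l q = foldr pds g l q.
Proof.
move=> e; elim: l => [//|i l IH] q Uq /=.
rewrite /pds; have h := near_upd i (near_eqU Uq IH).
congr Complex; rewrite !derive1E; apply: near_eq_derive; near=> t.
- by congr complex.Re; near: t.
- by congr complex.Im; near: t.
Unshelve. all: by end_near. Qed.

Lemma smooth1_eq f g : (forall q, U q -> f q = g q) -> smooth1 f -> smooth1 g.
Proof.
move=> e sf l q Uq; have [h1 h2] := sf l q Uq.
have ne := near_eqU Uq (foldr_pds_eq l e); split; first exact: contC_near h1.
by move=> i; have [c hc] := h2 i; exists c; exact: pdC_near hc.
Qed.

Lemma smooth1_pds i f : smooth1 f -> smooth1 (pds i f).
Proof.
by move=> h l; have := h (rcons l i); rewrite foldr_rcons.
Qed.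

Lemma contC_cst c q : contC (fun => c) q.
Proof. by split; apply: cst_continuous. Qed.

Lemma contCD f g q : contC f q -> contC g q -> contC (fun x => f x + g x) q.
Proof.
move=> [f1 f2] [g1 g2]; split.
- rewrite (_ : (fun x => _) = (fun x => Re (f x) + Re (g x))).
    exact: continuousD.
  by apply/funext => x; rewrite ReD.
- rewrite (_ : (fun x => _) = (fun x => Im (f x) + Im (g x))).
    exact: continuousD.
  by apply/funext => x; rewrite ImD.
Qed.

Lemma contCM f g q : contC f q -> contC g q -> contC (fun x => f x * g x) q.
Proof.
move=> [f1 f2] [g1 g2]; split.
- rewrite (_ : (fun x => _) = (fun x => Re (f x) * Re (g x) - Im (f x) * Im (g x))).
    by apply: continuousB; apply: continuousM.
  by apply/funext => x; rewrite ReM.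
- rewrite (_ : (fun x => _) = (fun x => Re (f x) * Im (g x) + Im (f x) * Re (g x))).
    by apply: continuousD; apply: continuousM.
  by apply/funext => x; rewrite ImM.
Qed.

Lemma contCV f q : f q != 0 -> contC f q -> contC (fun x => (f x)^-1) q.
Proof.
move=> /norm2_neq0 n0 [f1 f2].
have n : {for q, continuous (fun x => (Re (f x) ^+ 2 + Im (f x) ^+ 2)^-1)}.
  apply: continuousV => //.
  by apply: continuousD; apply: continuousM.
split.
- rewrite (_ : (fun x => _) = (fun x => Re (f x) / (Re (f x) ^+ 2 + Im (f x) ^+ 2))).
    exact: continuousM.
  by apply/funext => x; rewrite ReV.
- rewrite (_ : (fun x => _) = (fun x => - (Im (f x) / (Re (f x) ^+ 2 + Im (f x) ^+ 2)))).
    by apply: continuousN; exact: continuousM.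
  by apply/funext => x; rewrite ImV.
Qed.

Lemma contC_cexp f q : contC f q -> contC (fun x => cexp (f x)) q.
Proof.
move=> [f1 f2]; split; apply: continuousM.
- by apply: (@continuous_comp _ _ _ (fun x => Re (f x)) expR) => //; exact: continuous_expR.
- by apply: (@continuous_comp _ _ _ (fun x => Im (f x)) cos) => //; exact: continuous_cos.
- by apply: (@continuous_comp _ _ _ (fun x => Re (f x)) expR) => //; exact: continuous_expR.
- by apply: (@continuous_comp _ _ _ (fun x => Im (f x)) sin) => //; exact: continuous_sin.
Qed.

Lemma contC_real (h : R -> R) i q : derivable h (q 0 i) 1 ->
  contC (fun x => RtoC (h (x 0 i))) q.
Proof.
move=> dh; split; last by apply: cst_continuous.
apply: (@continuous_comp _ _ _ (fun x : 'rV[R]_N => x 0 i) h); first exact: coord_continuous.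
apply: differentiable_continuous; exact/derivable1_diffP.
Qed.

Definition box (e : R) q q' := forall k, `|q 0 k - q' 0 k| < e.

Lemma mvt_closed (f df : R -> R) (u v : R) : u < v ->
  (forall x : R, u <= x <= v -> is_derive x (1 : R) f (df x)) ->
  exists2 c, u < c < v & f v - f u = df c * (v - u).
Proof.
move=> uv hd.
have [||c] := @MVT R f df u v uv.
- by move=> x; rewrite in_itv /= => /andP[h1 h2]; apply: hd; rewrite !ltW.
- apply: derivable_within_continuous => x; rewrite in_itv /= => h.
  by have [] := hd x h.
- by rewrite in_itv /= => h1 h2; exists c.
Qed.

(** The mean value theorem is used twice: in direction [i] for the increment of [g] along [j], then
    in direction [j] for [gi]. *)
Lemma mixed_difference (g gi gij : 'rV[R]_N -> R) q i j (e h : R) : i != j ->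
  0 < h < e ->
  (forall q', box e q q' -> is_derive (q' 0 i) (1 : R) (fun t => g (upd q' i t)) (gi q')) ->
  (forall q', box e q q' -> is_derive (q' 0 j) (1 : R) (fun t => gi (upd q' j t)) (gij q')) ->
  exists2 q', box e q q' &
  g (upd (upd q i (q 0 i + h)) j (q 0 j + h)) - g (upd q i (q 0 i + h))
   - (g (upd q j (q 0 j + h)) - g q) = gij q' * h * h.
Proof.
move=> ij /andP[h0 he] hi hj.
pose P x y := upd (upd q i x) j y.
have ji : (i == j) = false by apply/negbTE.
have Pi x y : P x y 0 i = x by rewrite !updE ji eqxx.
have Pj x y : P x y 0 j = y by rewrite updE eqxx.
have Pbox x y : q 0 i <= x <= q 0 i + h -> q 0 j <= y <= q 0 j + h -> box e q (P x y).
  move=> hx hy k; rewrite !updE; case: eqP => [->|_].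
    by rewrite ltr_norml; apply/andP; split; lra.
  case: eqP => [->|_]; last by rewrite subrr normr0; lra.
  by rewrite ltr_norml; apply/andP; split; lra.
have di x y : q 0 i <= x <= q 0 i + h -> q 0 j <= y <= q 0 j + h ->
   is_derive x (1 : R) (fun t => g (P t y)) (gi (P x y)).
  move=> hx hy; have := hi _ (Pbox x y hx hy); rewrite Pi.
  by under eq_fun do rewrite /P (upd_comm _ _ _ ij) upd_upd -(upd_comm _ _ _ ij).
have dj x y : q 0 i <= x <= q 0 i + h -> q 0 j <= y <= q 0 j + h ->
   is_derive y (1 : R) (fun t => gi (P x t)) (gij (P x y)).
  move=> hx hy; have := hj _ (Pbox x y hx hy); rewrite Pj.
  by under eq_fun do rewrite /P upd_upd.
have [|x hx|c /andP[c1 c2]] := @mvt_closed (fun x => g (P x (q 0 j + h)) - g (P x (q 0 j)))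
  (fun x => gi (P x (q 0 j + h)) - gi (P x (q 0 j))) (q 0 i) (q 0 i + h).
- lra.
- by apply: (is_deriveB (di _ _ hx _) (di _ _ hx _)); lra.
have hc : q 0 i <= c <= q 0 i + h by lra.
have [|y hy|d /andP[d1 d2]] := @mvt_closed (fun y => gi (P c y))
  (fun y => gij (P c y)) (q 0 j) (q 0 j + h).
- lra.
- exact: dj.
move=> e2 e1; exists (P c d); first by apply: Pbox; lra.
have Pq x : P x (q 0 j) = upd q i x.
  by rewrite /P (upd_comm _ _ _ ij) upd_id.
have Pq2 y : P (q 0 i) y = upd q j y by rewrite /P upd_id.
move: e1; rewrite e2 !Pq Pq2 upd_id !(addrC _ h) !addrK => <-.
by rewrite /P !(addrC h); ring.
Qed.

(** The second difference over a small square is the same in either order of the directions, so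
    [gij] and [gji] take a common value at two points arbitrarily close to [q]; continuity brings
    both points to [q]. *)
Lemma clairaut (g gi gj gij gji : 'rV[R]_N -> R) q i j : i != j -> U q ->
  (forall q', U q' -> is_derive (q' 0 i) (1 : R) (fun t => g (upd q' i t)) (gi q')) ->
  (forall q', U q' -> is_derive (q' 0 j) (1 : R) (fun t => gi (upd q' j t)) (gij q')) ->
  (forall q', U q' -> is_derive (q' 0 j) (1 : R) (fun t => g (upd q' j t)) (gj q')) ->
  (forall q', U q' -> is_derive (q' 0 i) (1 : R) (fun t => gj (upd q' i t)) (gji q')) ->
  {for q, continuous gij} -> {for q, continuous gji} -> gij q = gji q.
Proof.
move=> ij Uq h1 h2 h3 h4 c1 c2; apply/eqP; rewrite -subr_eq0 -normr_eq0.
(* Half of the supposed gap: two values this close to [gij q] and [gji q] cannot be equal. *)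
apply: contraT => ne; pose d := `|gij q - gji q| / 2.
have d0 : 0 < d by rewrite divr_gt0 // lt_def ne normr_ge0.
have n1 : \forall x \near q, `|gij q - gij x| < d by move/cvgrPdist_lt: c1; apply.
have n2 : \forall x \near q, `|gji q - gji x| < d by move/cvgrPdist_lt: c2; apply.
have [e e0 he] := nbhs_box (filterI (nbhsU Uq) (filterI n1 n2)).
have hh : 0 < e / 2 < e by apply/andP; split; lra.
have [||x b1 v1] := @mixed_difference g gi gij q i j e (e / 2) ij hh.
- by move=> q' /he[/h1].
- by move=> q' /he[/h2].
have ji : j != i by rewrite eq_sym.
have [||y b2 v2] := @mixed_difference g gj gji q j i e (e / 2) ji hh.
- by move=> q' /he[/h3].
- by move=> q' /he[/h4].
have eqx : gij x = gji y.
  move: v2; rewrite (upd_comm _ _ _ ji) => v2.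
  have : gij x * (e / 2) * (e / 2) = gji y * (e / 2) * (e / 2).
    by rewrite -v1 -v2; ring.
  have e2 : e / 2 != 0 by lra.
  by move/(mulIf e2)/(mulIf e2).
have [_ [p1 _]] := he _ b1; have [_ [_ p2]] := he _ b2.
have : `|gij q - gji q| <= `|gij q - gij x| + `|gji q - gji y|.
  rewrite (_ : gij q - gji q = (gij q - gij x) - (gji q - gji y)); last by rewrite eqx; ring.
  exact: ler_normB.
rewrite /d in p1 p2; lra.
Qed.

Lemma pds_comm i j f q : smooth1 f -> U q -> pds i (pds j f) q = pds j (pds i f) q.
Proof.
have [->//|ij] := eqVneq i j; move=> sf Uq.
have dj q' : U q' -> pdC j f q' (pds j f q') by apply: pdsP.
have di q' : U q' -> pdC i f q' (pds i f q') by apply: pdsP.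
have dij q' : U q' -> pdC i (pds j f) q' (pds i (pds j f) q').
  by apply: pdsP; exact: smooth1_pds.
have dji q' : U q' -> pdC j (pds i f) q' (pds j (pds i f) q').
  by apply: pdsP; exact: smooth1_pds.
have [c1 c2] : contC (pds i (pds j f)) q := (sf [:: i; j] q Uq).1.
have [c3 c4] : contC (pds j (pds i f)) q := (sf [:: j; i] q Uq).1.
have ji : j != i by rewrite eq_sym.
apply: eq_ReIm.
- exact: (@clairaut (fun q => Re (f q)) (fun q => Re (pds j f q)) (fun q => Re (pds i f q))
    (fun q => Re (pds i (pds j f) q)) (fun q => Re (pds j (pds i f) q)) q j i ji Uq
    (fun q' Uq' => (dj q' Uq').1) (fun q' Uq' => (dij q' Uq').1)
    (fun q' Uq' => (di q' Uq').1) (fun q' Uq' => (dji q' Uq').1) c1 c3).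
- exact: (@clairaut (fun q => Im (f q)) (fun q => Im (pds j f q)) (fun q => Im (pds i f q))
    (fun q => Im (pds i (pds j f) q)) (fun q => Im (pds j (pds i f) q)) q j i ji Uq
    (fun q' Uq' => (dj q' Uq').2) (fun q' Uq' => (dij q' Uq').2)
    (fun q' Uq' => (di q' Uq').2) (fun q' Uq' => (dji q' Uq').2) c2 c4).
Qed.

Definition swq i j q : 'rV[R]_N := \row_k q 0 (tperm i j k).

Lemma swqE i j q k : swq i j q 0 k = q 0 (tperm i j k).
Proof. by rewrite mxE. Qed.

Lemma swq_upd i j q k (t : R) : swq i j (upd q k t) = upd (swq i j q) (tperm i j k) t.
Proof.
apply/rowP => m; rewrite !(swqE, updE) -(inj_eq (@perm_inj _ (tperm i j))).
by rewrite tpermK.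
Qed.

Lemma pdC_swq i j k f q c : pdC (tperm i j k) f (swq i j q) c ->
  pdC k (fun q => f (swq i j q)) q c.
Proof.
rewrite /pdC swqE tpermK; under [X in is_dC X]eq_fun do rewrite -swq_upd.
exact.
Qed.

Lemma swq_continuous i j : continuous (swq i j).
Proof.
move=> q W /nbhs_box[e e0 h]; apply/nbhs_ballP; exists e => // q' [_ hq'].
by apply: h => k; rewrite !swqE; exact: hq'.
Qed.

Lemma pds_swq i j k f :
  pds k (fun q => f (swq i j q)) = fun q => pds (tperm i j k) f (swq i j q).
Proof.
apply/funext => q; rewrite /pds swqE tpermK.
have E : (fun t => f (swq i j (upd q k t))) =
         (fun t => f (upd (swq i j q) (tperm i j k) t)).
  by apply/funext => t; rewrite swq_upd.
exact: (congr1 (fun c : R -> R[i] => Complex (derive1 (fun t => Re (c t)) (q 0 k))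
  (derive1 (fun t => Im (c t)) (q 0 k))) E).
Qed.

Lemma foldr_pds_swq i j f (l : seq 'I_N) :
  foldr pds (fun q => f (swq i j q)) l =
  fun q => foldr pds f (map (tperm i j) l) (swq i j q).
Proof.
by elim: l => [//|k l IH] /=; rewrite IH pds_swq.
Qed.

Lemma smooth1_swq i j f : (forall q, U q -> U (swq i j q)) -> smooth1 f ->
  smooth1 (fun q => f (swq i j q)).
Proof.
move=> hs sf l q Uq; rewrite foldr_pds_swq.
have [[h1 h2] h3] := sf (map (tperm i j) l) _ (hs q Uq); split.
  split.
  - exact: (continuous_comp (@swq_continuous i j q) h1).
  - exact: (continuous_comp (@swq_continuous i j q) h2).
move=> k; have [c hc] := h3 (tperm i j k); exists c; exact: pdC_swq.
Qed.

(** * A class of functions built from [a], [A], exponentials and quotients *)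

Definition cinf (h : R -> R) :=
  forall (k : nat) (x : R), derivable (iter k (fun f : R -> R => derive1 f) h) x (1 : R).

Variables (a A : R -> R).
Hypothesis (ha : cinf a) (a0 : forall x, a x != 0).
Hypothesis hA : forall x : R, is_derive x (1 : R) A ((a x)^-1).

(* A class closed under partial derivatives by construction; its members are
   therefore smooth. *)
Inductive gen : ('rV[R]_N -> R[i]) -> Prop :=
| gen_smooth f : smooth1 f -> gen f
| gen_cst c : gen (fun => c)
| gen_real h i : cinf h -> gen (fun q => RtoC (h (q 0 i)))
| gen_A i : gen (fun q => RtoC (A (q 0 i)))
| genD f g : gen f -> gen g -> gen (fun q => f q + g q)
| genM f g : gen f -> gen g -> gen (fun q => f q * g q)
| gen_cexp f : gen f -> gen (fun q => cexp (f q))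
| genV f : (forall q, U q -> f q != 0) -> gen f -> gen (fun q => (f q)^-1).

Lemma gen_contC f q : gen f -> U q -> contC f q.
Proof.
move=> gf Uq; elim: gf => {f}.
- by move=> f /(_ [::] q Uq)[].
- by move=> c; apply: contC_cst.
- by move=> h i ch; apply: contC_real; exact: (ch 0%N).
- by move=> i; apply: contC_real; exact: ex_derive.
- by move=> f g _ hf _ hg; apply: contCD.
- by move=> f g _ hf _ hg; apply: contCM.
- by move=> f _ hf; apply: contC_cexp.
- by move=> f f0 _ hf; apply: contCV => //; exact: f0.
Qed.

Lemma pdC_real (h dh : R -> R) i j q : (forall x : R, is_derive x (1 : R) h (dh x)) ->
  pdC i (fun q => RtoC (h (q 0 j))) q (if j == i then RtoC (dh (q 0 j)) else 0).
Proof.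
move=> hd; rewrite /pdC; case: eqP => [->|/eqP ne].
- by under eq_fun do rewrite updE eqxx; apply: is_dC_real; exact: hd.
- by under eq_fun do rewrite updE (negPf ne); exact: is_dC_cst.
Qed.

(** Each constructor has a differentiation rule whose result is again built from constructors. The
    rule for quotients holds only on [U], where denominators do not vanish. *)
Lemma gen_pd f i : gen f -> exists2 g, gen g & forall q, U q -> pdC i f q (g q).
Proof.
elim => {f}.
- move=> f sf; exists (pds i f); first by apply: gen_smooth; exact: smooth1_pds.
  by move=> q Uq; exact: pdsP.
- by move=> c; exists (fun => 0); [exact: gen_cst | move=> q _; exact: is_dC_cst].
- move=> h j ch; exists (fun q => if j == i then RtoC (derive1 h (q 0 j)) else 0).
    case: eqP => _; last exact: gen_cst.
    by apply: gen_real => k; have := ch k.+1; rewrite iterSr.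
  move=> q _; apply: pdC_real => x; rewrite derive1E; apply: derivableP; exact: (ch 0%N).
- move=> j; exists (fun q => if j == i then RtoC (a (q 0 j))^-1 else 0).
    case: eqP => _; last exact: gen_cst.
    (* The derivative [1 / a] of [A] is a quotient in the class because [a] has no zero. *)
    rewrite (_ : (fun q => _) = (fun q : 'rV[R]_N => (RtoC (a (q 0 j)))^-1)).
      by apply: genV; [move=> q _; rewrite RtoC_eq0 | exact: gen_real].
    by apply/funext => q; rewrite RtoCV.
  by move=> q _; apply: (pdC_real (dh := fun x => (a x)^-1)).
- move=> f g _ [f' gf hf] _ [g' gg hg]; exists (fun q => f' q + g' q); first exact: genD.
  by move=> q Uq; apply: is_dCD; [exact: hf | exact: hg].
- move=> f g gf0 [f' gf hf] gg0 [g' gg hg]; exists (fun q => f' q * g q + f q * g' q).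
    by apply: genD; apply: genM.
  move=> q Uq; have := is_dCM (hf q Uq) (hg q Uq); rewrite !upd_id; exact.
- move=> f gf0 [f' gf hf]; exists (fun q => f' q * cexp (f q)).
    by apply: genM => //; exact: gen_cexp.
  by move=> q Uq; have := is_dC_cexp (hf q Uq); rewrite upd_id; exact.
- move=> f f0 gf0 [f' gf hf]; exists (fun q => (-1 * f' q) * ((f q)^-1 * (f q)^-1)).
    apply: genM; first by apply: genM => //; exact: gen_cst.
    by apply: genM; exact: genV.
  move=> q Uq; have := is_dCV _ (hf q Uq); rewrite upd_id => /(_ (f0 q Uq)).
  by move/is_dC_eq; apply; rewrite expr2 invfM mulN1r.
Qed.

(** By [gen_pd], every iterated derivative agrees on [U] with a member of the class, hence is
    continuous and differentiable there. *)
Lemma gen_smooth1 f : gen f -> smooth1 f.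
Proof.
move=> gf l q Uq.
have [g gg e] : exists2 g, gen g & forall q, U q -> g q = foldr pds f l q.
  elim: l => [|i l [g gg e]]; first by exists f.
  have [g' gg' e'] := gen_pd i gg; exists g' => // x Ux /=.
  have /= <- := @foldr_pds_eq _ _ [:: i] e _ Ux; apply/esym; exact/pds_val/e'.
have ne := near_eqU Uq e.
split; first by apply: contC_near ne (gen_contC gg Uq).
move=> i; have [g' _ hg'] := gen_pd i gg.
by exists (g' q); apply: pdC_near ne (hg' q Uq).
Qed.

End Smooth.

Section SmoothClosure.
Variables (R : realType) (N : nat) (U : set 'rV[R]_N).
Hypothesis hU : open U.
Implicit Types (f g : 'rV[R]_N -> R[i]).

Lemma cinf_cst (c : R) : cinf (fun=> c).
Proof.
move=> k x; suff [d ->] : exists d, iter k (fun f : R -> R => derive1 f) (fun=> c) = cst d.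
  exact: derivable_cst.
elim: k => [|k [d IH]]; first by exists c.
by exists 0; apply/funext => y; rewrite iterS IH derive1_cst.
Qed.

(** The trivial pair [a = 1], [A = id] yields closure under sums and products independently of the
    model. *)
Let gen_smooth1' f : gen U id f -> smooth1 U f.
Proof.
have h0 (x : R) : (fun=> 1 : R) x != 0 by exact: oner_neq0.
have h1 (x : R) : is_derive x (1 : R) id ((fun=> 1 : R) x)^-1.
  by rewrite invr1; exact: is_derive_id.
exact: (gen_smooth1 hU (@cinf_cst 1) h0 h1).
Qed.

Lemma smooth1D f g : smooth1 U f -> smooth1 U g -> smooth1 U (fun q => f q + g q).
Proof. by move=> sf sg; apply/gen_smooth1'/genD; exact: gen_smooth. Qed.
Lemma smooth1M f g : smooth1 U f -> smooth1 U g -> smooth1 U (fun q => f q * g q).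
Proof. by move=> sf sg; apply/gen_smooth1'/genM; exact: gen_smooth. Qed.
Lemma smooth1_cst c : smooth1 U (fun => c).
Proof. exact/gen_smooth1'/gen_cst. Qed.

End SmoothClosure.

(** * Dunkl operators and Lax products on a module *)

Section Separated.
Variables (K : numDomainType) (F : lmodType K) (I : Type) (ev : I -> {additive F -> K}).
Hypothesis evZ : forall i c x, ev i (c *: x) = c * ev i x.
Hypothesis ev_inj : forall x y, (forall i, ev i x = ev i y) -> x = y.

(** The functionals [ev i] separate points, so a linear identity in [F] becomes a commutative
    identity in [K]. *)
Ltac by_ev := apply: ev_inj => ?; rewrite !(raddfD, raddfN, raddfB, evZ) /=; ring.

(** With the map as an explicit argument, a rewrite can be aimed at one operator among several. *)
Lemma linD (f : {linear F -> F}) x y : f (x + y) = f x + f y.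
Proof. exact: linearD. Qed.
Lemma linB (f : {linear F -> F}) x y : f (x - y) = f x - f y.
Proof. exact: linearB. Qed.
Lemma linN (f : {linear F -> F}) x : f (- x) = - f x.
Proof. exact: linearN. Qed.
Lemma linZ (f : {linear F -> F}) c x : f (c *: x) = c *: f x.
Proof. exact: linearZ. Qed.
Let lin (f : {linear F -> F}) := (linD f, linB f, linN f, linZ f).

(** * Commutativity and sum of squares of abstract Dunkl operators *)

Section Dunkl.
Variables (N : nat) (D : 'I_N -> {linear F -> F}) (Y : 'I_N -> 'I_N -> {linear F -> F}).

(** [Y l k] models potential times swap, with the sign that depends on the order of [l] and [k]
    included; this makes [Y] antisymmetric in its indices. *)
Definition dunkl l x := D l x + \sum_(k | k != l) Y l k x.

Lemma dunkl_is_linear l : linear (dunkl l).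
Proof.
move=> c x y; rewrite /dunkl linearP scalerDr.
have -> : \sum_(k | k != l) Y l k (c *: x + y) =
    c *: (\sum_(k | k != l) Y l k x) + \sum_(k | k != l) Y l k y.
  by rewrite scaler_sumr -big_split; apply: eq_bigr => k _; rewrite linearP.
by rewrite addrACA.
Qed.

HB.instance Definition _ l := GRing.isLinear.Build K F F _ (dunkl l) (dunkl_is_linear l).

Hypothesis DD : forall l m x, D l (D m x) = D m (D l x).
Hypothesis Yanti : forall l m x, l != m -> Y m l x = - Y l m x.
Hypothesis DYfar : forall l m k x, l != m -> l != k -> m != k ->
  D l (Y m k x) = Y m k (D l x).
Hypothesis DYnear : forall l m x, l != m ->
  D l (Y l m x) + D m (Y l m x) = Y l m (D l x) + Y l m (D m x).
Hypothesis YYfar : forall l k m k' x, uniq [:: l; k; m; k'] ->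
  Y l k (Y m k' x) = Y m k' (Y l k x).
Hypothesis YYcyc : forall l k m x, uniq [:: l; k; m] ->
  Y l k (Y l m x) + Y k m (Y k l x) + Y m l (Y m k x) = 0.

(** The terms in [l] and [m] alone match by antisymmetry and [DYnear]. Each third index contributes
    six products, which cancel by two instances of the cyclic identity; products with four distinct
    indices commute. *)
Lemma dunkl_comm l m x : dunkl l (dunkl m x) = dunkl m (dunkl l x).
Proof.
have [->//|lm] := eqVneq l m.
have ml : m != l by rewrite eq_sym.
pose P k := (k != l) && (k != m).
have Pml k : (k != m) && (k != l) = P k by rewrite andbC.
have expand i j : i != j -> (forall k, (k != i) && (k != j) = P k) ->
  dunkl i (dunkl j x) =
  D i (D j x) + D i (Y j i x) + \sum_(k | P k) D i (Y j k x)
  + Y i j (D j x) + Y i j (Y j i x)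
  + \sum_(k | P k) (Y i k (D j x) + Y i j (Y j k x) + Y i k (Y j i x)
                    + \sum_(k' | P k') Y i k (Y j k' x)).
  move=> ij Pij; have ji : j != i by rewrite eq_sym.
  rewrite {1}/dunkl (bigD1 j) //= (eq_bigl _ _ Pij).
  have -> : dunkl j x = D j x + (Y j i x + \sum_(k | P k) Y j k x).
    rewrite /dunkl (bigD1 i) //=; congr (_ + (_ + _)).
    by apply: eq_bigl => k; rewrite andbC Pij.
  rewrite !raddfD /= !raddf_sum.
  have -> : \sum_(k | P k) Y i k (D j x + (Y j i x + \sum_(k' | P k') Y j k' x)) =
     \sum_(k | P k) (Y i k (D j x) + Y i k (Y j i x) + \sum_(k' | P k') Y i k (Y j k' x)).
    by apply: eq_bigr => k _; rewrite !raddfD /= raddf_sum addrA.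
  rewrite !big_split /=; by_ev.
rewrite (expand l m lm (fun => erefl)) (expand m l ml Pml).
have e1 : \sum_(k | P k) D l (Y m k x) = \sum_(k | P k) Y m k (D l x).
  by apply: eq_bigr => k /andP[h1 h2]; rewrite DYfar // eq_sym.
have e2 : \sum_(k | P k) D m (Y l k x) = \sum_(k | P k) Y l k (D m x).
  by apply: eq_bigr => k /andP[h1 h2]; rewrite DYfar // eq_sym.
have e3 : \sum_(k | P k) (Y l m (Y m k x) + Y l k (Y m l x)
                    + \sum_(k' | P k') Y l k (Y m k' x)) =
  \sum_(k | P k) (Y m l (Y l k x) + Y m k (Y l m x)
                    + \sum_(k' | P k') Y m k (Y l k' x)).
  rewrite [LHS]big_split [RHS]big_split /=.
  rewrite [X in _ = _ + X]exchange_big /= -!big_split /=; apply: eq_bigr => k Pk.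
  rewrite (bigD1 k) //= [X in _ = _ + X](bigD1 k) //= !addrA.
  congr (_ + _); last first.
    apply: eq_bigr => k' /andP[/andP[h1 h2] h3].
    case/andP: Pk => k1 k2; apply: YYfar.
    by rewrite /= !inE !negb_or lm (eq_sym l) k1 (eq_sym l) h1 k2 (eq_sym k) h3 (eq_sym m) h2.
  case/andP: Pk => kl km; have lk : l != k by rewrite eq_sym.
  have mk : m != k by rewrite eq_sym.
  (* [c1] and [c2] are the cyclic identity for the two orientations of [(l, k, m)], brought by
     antisymmetry to the same six products. *)
  have c1 : Y l k (Y l m x) = Y l m (Y m k x) - Y m k (Y l k x).
    have := YYcyc (l := l) (k := k) (m := m) x; rewrite /= !inE negb_or lk lm km => /(_ isT).
    rewrite (Yanti _ mk) (Yanti x lk) (Yanti _ lm) raddfN opprK.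
    by move/eqP; rewrite -addrA addr_eq0 opprD opprK addrC => /eqP.
  have c2 : Y l m (Y l k x) = Y m k (Y l m x) - Y l k (Y m k x).
    have := YYcyc (l := l) (k := m) (m := k) x; rewrite /= !inE negb_or lk lm mk => /(_ isT).
    rewrite (Yanti _ lk) (Yanti x mk) (Yanti x lm) !raddfN opprK.
    by move/eqP; rewrite -addrA addr_eq0 opprD opprK => /eqP.
  rewrite (Yanti (Y l k x) lm) (Yanti x lm) (raddfN (Y l k)) /= c1 c2.
  by_ev.
have e4 : Y l m (D m x) = D l (Y l m x) + D m (Y l m x) - Y l m (D l x).
  by rewrite DYnear // addrAC subrr add0r.
rewrite e1 e2.
have e5 : \sum_(k | P k)
   (Y l k (D m x) + Y l m (Y m k x) + Y l k (Y m l x)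
                    + \sum_(k' | P k') Y l k (Y m k' x)) =
    \sum_(k | P k) Y l k (D m x) + \sum_(k | P k)
   (Y l m (Y m k x) + Y l k (Y m l x)
                    + \sum_(k' | P k') Y l k (Y m k' x)).
  by rewrite -big_split /=; apply: eq_bigr => k _; rewrite !addrA.
have e6 : \sum_(k | P k)
   (Y m k (D l x) + Y m l (Y l k x) + Y m k (Y l m x)
                    + \sum_(k' | P k') Y m k (Y l k' x)) =
    \sum_(k | P k) Y m k (D l x) + \sum_(k | P k)
   (Y m l (Y l k x) + Y m k (Y l m x)
                    + \sum_(k' | P k') Y m k (Y l k' x)).
  by rewrite -big_split /=; apply: eq_bigr => k _; rewrite !addrA.
rewrite e5 e6 e3 DD e4 (Yanti x lm) (Yanti (D l x) lm) (Yanti (Y l m x) lm) !raddfN /=.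
by_ev.
Qed.

(** The products with three distinct indices sum to zero: three copies of their sum, cyclically
    relabelled, add up term by term to instances of the cyclic identity. *)
Lemma sum_dunkl2 x : \sum_l dunkl l (dunkl l x) =
  \sum_l D l (D l x) +
  \sum_l \sum_(k | k != l) (D l (Y l k x) + Y l k (D l x) + Y l k (Y l k x)).
Proof.
pose G l k m := if uniq [:: l; k; m] then Y l k (Y l m x) else 0.
have cyc l k m : G l k m + G k m l + G m l k = 0.
  rewrite /G; have -> : uniq [:: k; m; l] = uniq [:: l; k; m].
    by rewrite -(rot_uniq 1 [:: l; k; m]).
  have -> : uniq [:: m; l; k] = uniq [:: l; k; m].
    by rewrite -(rot_uniq 2 [:: l; k; m]).
  by case: ifP => [/YYcyc -> //|_]; rewrite !addr0.
have S0 : \sum_l \sum_k \sum_m G l k m = 0.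
  have e1 : \sum_l \sum_k \sum_m G l k m = \sum_l \sum_k \sum_m G k m l.
    rewrite exchange_big /= [RHS]exchange_big /=.
    under [RHS]eq_bigr do rewrite exchange_big /=.
    by rewrite exchange_big.
  have e2 : \sum_l \sum_k \sum_m G l k m = \sum_l \sum_k \sum_m G m l k.
    rewrite exchange_big /=.
    by under eq_bigr do rewrite exchange_big /=.
  have e3 : \sum_l \sum_k \sum_m G l k m + \sum_l \sum_k \sum_m G l k m
          + \sum_l \sum_k \sum_m G l k m = 0.
    rewrite {2}e1 {2}e2 -!big_split /=; apply: big1 => l _.
    rewrite -!big_split /=; apply: big1 => k _.
    by rewrite -!big_split /=; apply: big1 => m _; apply: cyc.
  (* The division by 3 takes place in [K], through the separating functionals. *)
  apply: ev_inj => i; rewrite raddf0.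
  have := congr1 (ev i) e3; rewrite !raddfD raddf0 /= => h.
  have : (ev i (\sum_l \sum_k \sum_m G l k m)) *+ 3 == 0.
    by rewrite -h; apply/eqP; ring.
  by rewrite mulrn_eq0 /= => /eqP.
transitivity (\sum_l D l (D l x) +
  \sum_l \sum_(k | k != l) (D l (Y l k x) + Y l k (D l x) + Y l k (Y l k x))
  + \sum_l \sum_k \sum_m G l k m); last by rewrite S0 addr0.
rewrite -!big_split /=; apply: eq_bigr => l _.
have -> : \sum_k \sum_m G l k m =
   \sum_(k | k != l) \sum_(m | (m != l) && (m != k)) Y l k (Y l m x).
  rewrite [RHS]big_mkcond /=; apply: eq_bigr => k _.
  case: eqP => [->|/eqP kl] /=.
    by apply: big1 => m _; rewrite /G /= inE eqxx.
  rewrite [RHS]big_mkcond /=; apply: eq_bigr => m _.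
  rewrite /G /= !inE negb_or (eq_sym l) kl (eq_sym l) (eq_sym k) andbT /=.
  by case: ifP.
rewrite {1}/dunkl [D l (dunkl l x)]raddfD raddf_sum /= -2!addrA; congr (_ + _).
have -> : \sum_(k | k != l) Y l k (dunkl l x) = \sum_(k | k != l)
   (Y l k (D l x) + (Y l k (Y l k x)
     + \sum_(m | (m != l) && (m != k)) Y l k (Y l m x))).
  apply: eq_bigr => k kl; rewrite /dunkl raddfD /=; congr (_ + _).
  by rewrite (bigD1 k) //= raddfD raddf_sum.
rewrite !big_split /=; by_ev.
Qed.

(** * Degenerate Hecke relations *)

Section Hecke.
Variables (i i' : 'I_N) (b : K) (S : {linear F -> F}).
Hypothesis ii' : i != i'.
Hypothesis SS : forall x, S (S x) = x.
Hypothesis SD : forall j x, S (D j x) = D (tperm i i' j) (S x).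
Hypothesis SY : forall j k x, j != k -> (j, k) != (i, i') -> (j, k) != (i', i) ->
  S (Y j k x) = Y (tperm i i' j) (tperm i i' k) (S x).
Hypothesis SYii' : forall x, S (Y i i' x) = Y i' i (S x) + b *: x.

(** Conjugation by [S] relabels all terms of [dunkl i] except the one for the pair [(i, i')], which
    leaves the constant [b] behind. *)
Lemma dunkl_hecke x : S (dunkl i x) = dunkl i' (S x) + b *: x.
Proof.
have i'i : i' != i by rewrite eq_sym.
rewrite /dunkl (linearD S) SD tpermL raddf_sum /= -addrA; congr (_ + _).
rewrite (bigD1 i') //= SYii' [X in _ = X + _](bigD1 i) //= addrAC; congr (_ + _ + _).
rewrite [RHS](reindex_inj (@perm_inj _ (tperm i i'))) /=.
apply: eq_big => [k|k /andP[h1 h2]].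
  by rewrite !(canF_eq (tpermK i i')) tpermL tpermR andbC.
rewrite SY ?tpermL //; first by rewrite eq_sym.
- by apply: contra h2 => /eqP[->].
- by apply: contra ii' => /eqP[->].
Qed.

Lemma dunkl_hecke' x : S (dunkl i' x) = dunkl i (S x) - b *: x.
Proof.
have := dunkl_hecke (S x) => /(congr1 S); rewrite SS (linearD S) linearZ SS /= => ->.
by rewrite addrK.
Qed.

Lemma dunkl_far j x : j != i -> j != i' -> S (dunkl j x) = dunkl j (S x).
Proof.
move=> ji ji'; have tj : tperm i i' j = j by rewrite tpermD // eq_sym.
rewrite /dunkl (linearD S) SD raddf_sum tj /=; congr (_ + _).
rewrite [RHS](reindex_inj (@perm_inj _ (tperm i i'))) /=.
apply: eq_big => [k|k kj].
  by rewrite -[in RHS]tj (inj_eq (@perm_inj _ _)).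
rewrite SY ?tj // 1?eq_sym //.
- by apply: contra ji => /eqP[->].
- by apply: contra ji' => /eqP[->].
Qed.

End Hecke.
End Dunkl.

(** * Ordered products of factors [1 + X z] *)

Section Sequences.

(* [mulz X f] is the coefficient sequence of [(1 + X z) f(z)], [z = 1/u]. *)
Definition mulz (X : F -> F) (f : nat -> F) : nat -> F :=
  fun k => f k + (if k is k'.+1 then X (f k') else 0).

Definition seq0 (x : F) : nat -> F := fun k => if k == 0%N then x else 0.

Definition mulzs (J : Type) (X : J -> F -> F) (l : seq J) (f : nat -> F) :=
  foldr (fun i g => mulz (X i) g) f l.

Lemma mulzs_cat (J : Type) (X : J -> F -> F) l1 l2 f :
  mulzs X (l1 ++ l2) f = mulzs X l1 (mulzs X l2 f).
Proof. by rewrite /mulzs foldr_cat. Qed.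

Lemma mulzs_comp (J : eqType) (X : J -> F -> F) (Z : {linear F -> F}) l (f : nat -> F) :
  (forall i x, i \in l -> X i (Z x) = Z (X i x)) ->
  mulzs X l (fun k => Z (f k)) = (fun k => Z (mulzs X l f k)).
Proof.
elim: l => [//|i l IH] h /=; rewrite IH; last first.
  by move=> j x jl; apply: h; rewrite inE jl orbT.
apply/funext => -[|k]; rewrite /mulz ?addr0 // raddfD h ?inE ?eqxx //.
Qed.

Lemma mulz_sub (X : {additive F -> F}) (f g : nat -> F) :
  mulz X (fun k => f k - g k) = (fun k => mulz X f k - mulz X g k).
Proof.
by apply/funext => -[|k]; rewrite /mulz ?addr0 // raddfB addrACA opprD.
Qed.

Lemma mulzs_sub (J : Type) (X : J -> {additive F -> F}) l (f g : nat -> F) :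
  mulzs X l (fun k => f k - g k) = (fun k => mulzs X l f k - mulzs X l g k).
Proof. by elim: l => [//|i l IH] /=; rewrite IH mulz_sub. Qed.

(** A factor [1 + X z] has constant term 1, so it kills no nonzero series; denominators may
    therefore be cancelled. *)
Lemma mulzs_eq0 (J : Type) (X : J -> {additive F -> F}) l (f : nat -> F) :
  (forall k, mulzs X l f k = 0) -> forall k, f k = 0.
Proof.
elim: l => [//|i l IH] /= h; apply: IH; elim => [|k IHk].
  by have := h 0%N; rewrite /mulz addr0.
by have := h k.+1; rewrite /mulz IHk raddf0 addr0.
Qed.

Lemma mulzs_linear (J : Type) (X : J -> {linear F -> F}) l (c : K) (x y : F) k :
  mulzs X l (seq0 (c *: x + y)) k =
  c *: mulzs X l (seq0 x) k + mulzs X l (seq0 y) k.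
Proof.
elim: l k => [|i l IH] k /=; first by rewrite /seq0; case: eqP; rewrite ?scaler0 ?addr0.
rewrite /mulz IH; case: k => [|k]; first by rewrite !addr0.
by rewrite IH linearP scalerDr addrACA.
Qed.

End Sequences.

(** Isolates the two adjacent factors of an ordered product that are affected by the exchange of [i]
    and [i']. *)
Lemma enum_ord_split N (i i' : 'I_N) : i' = i.+1 :> nat ->
  exists l1 l2, enum 'I_N = l1 ++ i :: i' :: l2 /\
   (forall j, j \in l1 ++ l2 -> (j != i) && (j != i')).
Proof.
move=> ii'.
have h (k : 'I_N) : drop k (enum 'I_N) = k :: drop k.+1 (enum 'I_N).
  by rewrite (drop_nth k) ?nth_ord_enum // size_enum_ord.
have e : enum 'I_N = take i (enum 'I_N) ++ i :: i' :: drop i'.+1 (enum 'I_N).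
  by rewrite -h ii' -h cat_take_drop.
exists (take i (enum 'I_N)), (drop i'.+1 (enum 'I_N)); split=> // j.
have := enum_uniq 'I_N; rewrite {1}e cat_uniq /= !inE !negb_or.
case/andP=> _ /andP[/andP[h1 /andP[h2 _]] /andP[/andP[_ h3] /andP[h4 _]]].
rewrite mem_cat => /orP[] hj; apply/andP; split; apply/eqP => E; move: hj; rewrite E.
- by rewrite (negPf h1).
- by rewrite (negPf h2).
- by rewrite (negPf h3).
- by rewrite (negPf h4).
Qed.

(** * Series of operators acting on series of vectors *)

Section PowerSeries.

Definition pact (G : nat -> F -> F) (g : nat -> F) : nat -> F :=
  fun k => \sum_(j < k.+1) G j (g (k - j)%N).

Definition invs (D : F -> F) (k : nat) (x : F) : F :=
  if k is k'.+1 then (-1) ^+ k' *: iter k' D x else 0.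

Lemma iter_linear (D : {linear F -> F}) k : linear (iter k D).
Proof. by elim: k => [//|k IH] c x y; rewrite !iterS IH linearP. Qed.

Lemma invs_linear (D : {linear F -> F}) k : linear (invs D k).
Proof.
case: k => [|k] c x y /=; first by rewrite scaler0 addr0.
by rewrite iter_linear scalerDr !scalerA mulrC.
Qed.

Lemma invs_comm (D Z : {linear F -> F}) k x : (forall x, D (Z x) = Z (D x)) ->
  invs D k (Z x) = Z (invs D k x).
Proof.
move=> DZ; case: k => [|k] /=; first by rewrite linear0.
rewrite linearZ /=; congr (_ *: _).
by elim: k => [//|k IH]; rewrite !iterS IH DZ.
Qed.

Lemma pact_invs0 (D : {linear F -> F}) g : pact (invs D) g 0 = 0.
Proof. by rewrite /pact big_ord_recl big_ord0 addr0. Qed.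

(** Together with [pact_invs0], this is [(1 + D z) h = z g] for [h = (u + D)^-1 g], read
    coefficientwise. *)
Lemma pact_invsS (D : {linear F -> F}) g k :
  pact (invs D) g k.+1 = g k - D (pact (invs D) g k).
Proof.
rewrite /pact big_ord_recl /= add0r big_ord_recl /= expr0 scale1r subn1; congr (_ + _).
rewrite [in RHS]big_ord_recl /= add0r raddf_sum -sumrN; apply: eq_bigr => j _ /=.
by rewrite linearZ /= exprS mulN1r scaleNr !subSS.
Qed.

Lemma pactS (G : nat -> F -> F) g k :
  pact G g k.+1 = pact G (fun m => g m.+1) k + G k.+1 (g 0%N).
Proof.
rewrite /pact big_ord_recr /= subnn; congr (_ + _).
by apply: eq_bigr => j _ /=; rewrite subSn // -ltnS.
Qed.

(** Splitting off the constant term of [g] and shifting the rest makes this an induction on [k], in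
    place of a rearrangement of a triangular double sum. *)
Lemma pact_assoc (G : nat -> {linear F -> F}) (H : nat -> F -> F) g k :
  pact (fun k x => pact G (fun m => H m x) k) g k = pact G (pact H g) k.
Proof.
elim: k g => [|k IH] g.
  by rewrite /pact !big_ord_recl !big_ord0 !addr0.
rewrite pactS IH [RHS]pactS.
have -> : (fun m => pact H g m.+1) =
   (fun m => pact H (fun m => g m.+1) m + H m.+1 (g 0%N)).
  by apply/funext => m; rewrite pactS.
have -> : pact G (fun m => pact H (fun m => g m.+1) m + H m.+1 (g 0%N)) k =
  pact G (pact H (fun m => g m.+1)) k + pact G (fun m => H m.+1 (g 0%N)) k.
  by rewrite /pact -big_split; apply: eq_bigr => j _ /=; rewrite linearD.
rewrite -addrA; congr (_ + _); rewrite pactS; congr (_ + _).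
by rewrite /pact big_ord_recl big_ord0 addr0.
Qed.

Lemma mulz_pact (X : {linear F -> F}) (G : nat -> {linear F -> F}) g :
  (forall k x, X (G k x) = G k (X x)) ->
  mulz X (pact G g) = pact G (mulz X g).
Proof.
move=> XG; apply/funext => -[|k]; rewrite /mulz.
  by rewrite addr0 /pact !big_ord_recl !big_ord0 /= !addr0.
have -> : X (pact G g k) = pact G (fun k => X (g k)) k.
  by rewrite /pact raddf_sum; apply: eq_bigr => j _ /=; rewrite XG.
rewrite !pactS addrAC /= addr0; congr (_ + _).
by rewrite /pact -big_split; apply: eq_bigr => j _ /=; rewrite linearD.
Qed.

End PowerSeries.

(** * The monodromy operator and its denominators *)

Section Yangian.
Variables (N : nat) (d P : 'I_N -> {linear F -> F}) (lam : K).
Hypothesis dC : forall i j x, d i (d j x) = d j (d i x).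
Hypothesis dP : forall i j x, d i (P j x) = P j (d i x).

Definition shiftd i x := d i x - lam *: x.
Lemma shiftd_linear i : linear (shiftd i).
Proof. by move=> c x y; rewrite /shiftd linearP; by_ev. Qed.
HB.instance Definition _ i := GRing.isLinear.Build K F F _ (shiftd i) (shiftd_linear i).

Definition laxA i x := d i x - lam *: P i x.
Lemma laxA_linear i : linear (laxA i).
Proof. by move=> c x y; rewrite /laxA !linearP; by_ev. Qed.
HB.instance Definition _ i := GRing.isLinear.Build K F F _ (laxA i) (laxA_linear i).

(** Coefficients of [(u + d_i) / (u + d_i - lam) = 1 + lam / (u + d_i - lam)]. *)
Definition laxc i k x := (if k == 0%N then x else 0) + lam *: invs (shiftd i) k x.
Lemma laxc_linear i k : linear (laxc i k).
Proof.
move=> c x y; rewrite /laxc invs_linear; case: eqP => _; by_ev.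
Qed.
HB.instance Definition _ i k := GRing.isLinear.Build K F F _ (laxc i k) (laxc_linear i k).

(** Coefficients of [1 - lam P_i / (u + d_i)]. *)
Definition laxe i k x := (if k == 0%N then x else 0) + (- lam) *: P i (invs (d i) k x).
Lemma laxe_linear i k : linear (laxe i k).
Proof.
move=> c x y; rewrite /laxe invs_linear linearP; case: eqP => _; by_ev.
Qed.
HB.instance Definition _ i k := GRing.isLinear.Build K F F _ (laxe i k) (laxe_linear i k).

Definition lax i k x := pact (laxc i) (fun m => laxe i m x) k.
Lemma lax_linear i k : linear (lax i k).
Proof.
move=> c x y; rewrite /lax /pact scaler_sumr -big_split; apply: eq_bigr => j _ /=.
by rewrite !linearP.
Qed.
HB.instance Definition _ i k := GRing.isLinear.Build K F F _ (lax i k) (lax_linear i k).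

Definition tmono l x := foldr (fun i g => pact (lax i) g) (seq0 x) l.

Lemma lax_comm (Z : {linear F -> F}) i k x : (forall j x, d j (Z x) = Z (d j x)) ->
  (forall j x, P j (Z x) = Z (P j x)) -> lax i k (Z x) = Z (lax i k x).
Proof.
move=> dZ PZ; rewrite /lax /pact raddf_sum; apply: eq_bigr => j _ /=.
have eZ m y : laxe i m (Z y) = Z (laxe i m y).
  by rewrite /laxe invs_comm // PZ linearD linearZ; case: eqP => // _; rewrite linear0.
have cZ m y : laxc i m (Z y) = Z (laxc i m y).
  rewrite /laxc invs_comm ?linearD ?linearZ; first by case: eqP => // _; rewrite linear0.
  by move=> z; rewrite /= /shiftd dZ !(lin Z) /=.
by rewrite eZ cZ.
Qed.

Lemma tmono_comm (Z : {linear F -> F}) l x k : (forall j x, d j (Z x) = Z (d j x)) ->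
  (forall j x, P j (Z x) = Z (P j x)) -> tmono l (Z x) k = Z (tmono l x k).
Proof.
move=> dZ PZ; elim: l k => [|i l IH] k /=.
  by rewrite /seq0; case: eqP => // _; rewrite linear0.
by rewrite /pact raddf_sum; apply: eq_bigr => j _ /=; rewrite IH lax_comm.
Qed.

(** The denominator of the first Lax factor cancels and its numerator [1 + d_i z] remains. *)
Lemma mulz_laxc i g : mulz (shiftd i) (pact (laxc i) g) = mulz (d i) g.
Proof.
have h k : pact (laxc i) g k = g k + lam *: pact (invs (shiftd i)) g k.
  rewrite /pact /laxc big_split /= scaler_sumr; congr (_ + _).
  by rewrite big_ord_recl /= subn0 big1 ?addr0.
apply/funext => -[|k]; rewrite /mulz !h ?pact_invs0 ?scaler0 ?addr0 //.
rewrite (pact_invsS (shiftd i)) /= /shiftd !linearD !linearZ /=; by_ev.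
Qed.

(** The numerator left by the first factor is the denominator of the second; it passes [P i] because
    [d i] commutes with it. *)
Lemma mulz_laxe i g : mulz (d i) (pact (laxe i) g) = mulz (laxA i) g.
Proof.
have h k : pact (laxe i) g k = g k - lam *: P i (pact (invs (d i)) g k).
  rewrite /pact /laxe big_split /= raddf_sum scaler_sumr -sumrN; congr (_ + _).
    by rewrite big_ord_recl /= subn0 big1 ?addr0.
  by apply: eq_bigr => j _; rewrite scaleNr.
apply/funext => -[|k]; rewrite /mulz !h.
  by rewrite (pact_invs0 (d i)) linear0 scaler0 subr0.
rewrite (pact_invsS (d i)) !linearB !linearZ /= /laxA dP; by_ev.
Qed.

(** Every [d_j - lam] commutes with every Lax operator, so each denominator can be moved next to the
    factor that it cancels. *)
Lemma mulzs_tmono l x :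
  mulzs shiftd l (tmono l x) = mulzs laxA l (seq0 x).
Proof.
have sP i j y : shiftd i (P j y) = P j (shiftd i y).
  by rewrite /shiftd dP !(lin (P j)).
have sd i j y : d i (shiftd j y) = shiftd j (d i y).
  by rewrite /shiftd !(lin (d i)) /= dC.
elim: l => [//|i l IH] /=; rewrite -IH.
have -> : mulzs shiftd l (pact (lax i) (tmono l x)) =
          pact (lax i) (mulzs shiftd l (tmono l x)).
  elim: (l) (tmono l x) => [//|j l' IH'] g /=; rewrite IH'.
  by apply: mulz_pact => k y; apply/esym; apply: (lax_comm (Z := shiftd j)) => a c;
    [exact: sd | exact/esym/sP].
move: (mulzs _ _ _) => g.
have -> : pact (lax i) g = pact (laxc i) (pact (laxe i) g).
  by apply/funext => k; exact: (pact_assoc (laxc i) (laxe i)).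
by rewrite mulz_laxc mulz_laxe.
Qed.

(** * Exchange of two neighbouring particles *)

Section Adjacent.
Variables (i i' : 'I_N) (S p : {linear F -> F}) (b tau : K).
Hypothesis ii' : i' = i.+1 :> nat.
Hypothesis Sd : forall x, S (d i x) = d i' (S x) + b *: x.
Hypothesis Sd' : forall x, S (d i' x) = d i (S x) - b *: x.
Hypothesis Sfar : forall j x, j != i -> j != i' -> S (d j x) = d j (S x).
Hypothesis SP : forall j x, S (P j x) = P j (S x).
Hypothesis Sp : forall x, S (p x) = p (S x).
Hypothesis pp : forall x, p (p x) = x.
Hypothesis pd : forall j x, p (d j x) = d j (p x).
Hypothesis pP : forall x, p (P i x) = P i' (p x).
Hypothesis pP' : forall x, p (P i' x) = P i (p x).
Hypothesis pPfar : forall j x, j != i -> j != i' -> p (P j x) = P j (p x).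
Hypothesis PP : forall x, P i (P i' x) = P i' (p x).
Hypothesis PP' : forall x, P i' (P i x) = P i (p x).
Hypothesis tau2 : tau * tau = 1.
Hypothesis btau : b = tau * lam.

(** All factors but the two neighbouring ones commute with [S], and those two enter only through
    [d_i + d_i'] and [d_i d_i'], which also commute with [S]. The shift [c] is [- lam] for the
    denominators of the monodromy and [0] for the integrals. *)
Lemma hecke_central c l (f : nat -> F) : l = enum 'I_N ->
  mulzs (fun j x => d j x + c *: x) l (fun k => S (f k)) =
  fun k => S (mulzs (fun j x => d j x + c *: x) l f k).
Proof.
move=> ->; have [l1 [l2 [-> hl]]] := enum_ord_split ii'.
have far l' (g : nat -> F) : {subset l' <= l1 ++ l2} ->
   mulzs (fun j x => d j x + c *: x) l' (fun k => S (g k)) =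
   fun k => S (mulzs (fun j x => d j x + c *: x) l' g k).
  move=> sl; apply: (mulzs_comp (Z := S)) => j x /sl/hl/andP[h1 h2].
  by rewrite !(lin S) /= Sfar.
rewrite !mulzs_cat /= far; last by move=> j jl; rewrite mem_cat jl orbT.
rewrite -(far l1 (mulz _ (mulz _ (mulzs _ l2 f)))); last by move=> j jl; rewrite mem_cat jl.
congr (mulzs _ _ _); move: (mulzs _ l2 f) => g.
apply/funext => -[|[|k]]; rewrite /mulz /= ?addr0 //.
  by rewrite !(lin p, lin S, lin (d i), lin (d i'), lin (P i), lin (P i')) /= Sd Sd'; by_ev.
rewrite !(lin p, lin S, lin (d i), lin (d i'), lin (P i), lin (P i')) /= !(Sd, Sd').
rewrite !(lin p, lin S, lin (d i), lin (d i'), lin (P i), lin (P i')) /= (dC i i'); by_ev.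
Qed.

(** The coefficients of [(1 + B z)(1 + B' z)] are [1], [B + B'] and [B B']; neither factor has to
    preserve the symmetry by itself. *)
Lemma mulz2_sym (B B' : {linear F -> F}) (g : nat -> F) :
  (forall y, p (S y) = tau *: y -> p (S (B' y)) + p (S (B y)) = tau *: (B' y + B y)) ->
  (forall y, p (S y) = tau *: y -> p (S (B (B' y))) = tau *: B (B' y)) ->
  (forall k, p (S (g k)) = tau *: g k) ->
  forall k, p (S (mulz B (mulz B' g) k)) = tau *: mulz B (mulz B' g) k.
Proof.
move=> h1 h2 gs -[|[|k]] /=; rewrite /mulz /= ?addr0 //.
- by rewrite !(linD S) !(linD p) gs -!addrA h1 // -scalerDr.
- rewrite (linD B) !(linD S) !(linD p) gs h2 // -addrA (addrA (p (S (B' _)))) h1 //.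
  by rewrite -!scalerDr !addrA.
Qed.

(** Here [S] permutes positions and [p] spins. On symmetric vectors [S] acts as [tau p], so
    corrections from the Hecke relations can cancel against spin permutations. *)
Lemma laxA_sym l (f : nat -> F) : l = enum 'I_N ->
  (forall k, p (S (f k)) = tau *: f k) ->
  forall k, p (S (mulzs laxA l f k)) = tau *: mulzs laxA l f k.
Proof.
move=> ->; have [l1 [l2 [-> hl]]] := enum_ord_split ii'.
have far l' (g : nat -> F) : {subset l' <= l1 ++ l2} ->
  (forall k, p (S (g k)) = tau *: g k) ->
  forall k, p (S (mulzs laxA l' g k)) = tau *: mulzs laxA l' g k.
  move=> sl gs; elim: l' sl => [//|j l' IH] sl.
  have {}IH : forall k, p (S (mulzs laxA l' g k)) = tau *: mulzs laxA l' g k.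
    by apply: IH => x hx; apply: sl; rewrite inE hx orbT.
  have /hl/andP[h1 h2] := sl j (mem_head _ _).
  move=> /= -[|k]; rewrite /mulz ?addr0 // !(lin S, lin p) IH scalerDr; congr (_ + _).
  rewrite /= /laxA Sfar // SP pd pPfar // IH (linZ (d j)) (linZ (P j)); by_ev.
move=> fs; rewrite mulzs_cat; apply: (far l1); first by move=> j jl; rewrite mem_cat jl.
rewrite /=; have {}fs k : p (S (mulzs laxA l2 f k)) = tau *: mulzs laxA l2 f k.
  by apply: far => // j jl; rewrite mem_cat jl orbT.
move: (mulzs _ l2 f) fs => g gs.
have Klin y : p (S y) = tau *: y ->
  p (S (laxA i' y)) + p (S (laxA i y)) = tau *: (laxA i' y + laxA i y).
  move=> ys; rewrite /laxA !(lin p, lin S, lin (d i), lin (d i'), lin (P i), lin (P i')) /= Sd Sd' !SP !(lin p, lin S, lin (d i), lin (d i'), lin (P i), lin (P i')) /= !pd pP pP' ys.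
  by rewrite !(lin p, lin S, lin (d i), lin (d i'), lin (P i), lin (P i')) /=; by_ev.
have quad y : p (S y) = tau *: y ->
  p (S (laxA i (laxA i' y))) = tau *: laxA i (laxA i' y).
  move=> ys; have Sy : S y = tau *: p y by rewrite -[S y]pp ys linearZ.
  (* What does not match directly is the Hecke correction [b] and the commutator of [P i] and
     [P i']; they cancel because [b = tau lam]. *)
  rewrite /laxA !(lin p, lin S, lin (d i), lin (d i'), lin (P i), lin (P i'),
    Sd, Sd', SP, pd, pP, pP', Sy, pp, dP, PP, PP') (dC i i') btau.
  apply: ev_inj => e; rewrite !(raddfD, raddfN, raddfB, evZ) /=.
  have t2 : tau ^+ 2 = 1 by rewrite expr2.
  by ring: t2.
exact: (mulz2_sym (B := laxA i) (B' := laxA i') Klin quad gs).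
Qed.

(** The claim is multiplied by the denominators, which commute with [p] and, as a product, with [S];
    the cleared product is handled by [laxA_sym], and [mulzs_eq0] undoes the multiplication. *)
Lemma tmono_sym x k : p (S x) = tau *: x ->
  p (S (tmono (enum 'I_N) x k)) = tau *: tmono (enum 'I_N) x k.
Proof.
move=> xs; set T := tmono _ _.
have shE : (fun j x => d j x + (- lam) *: x) = shiftd.
  by apply/funext => j; apply/funext => y; rewrite /shiftd scaleNr.
have h1 : mulzs shiftd (enum 'I_N) (fun k => p (S (T k))) =
   fun k => p (S (mulzs shiftd (enum 'I_N) T k)).
  rewrite (mulzs_comp (Z := p)); last by move=> j y _; rewrite /= /shiftd !(lin p) /= pd.
  by rewrite -shE hecke_central.
have h2 : mulzs shiftd (enum 'I_N) (fun k => tau *: T k) =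
   fun k => tau *: mulzs shiftd (enum 'I_N) T k.
  by apply: (mulzs_comp (Z := *:%R tau)) => j y _; rewrite linearZ.
have := @mulzs_eq0 _ shiftd (enum 'I_N) (fun k => p (S (T k)) - tau *: T k).
rewrite mulzs_sub h1 h2 mulzs_tmono => /(_ _ k) H.
apply/eqP; rewrite -subr_eq0; apply/eqP/H => m.
rewrite laxA_sym ?subrr // => m'; rewrite /seq0.
by case: eqP => // _; rewrite !linear0.
Qed.

End Adjacent.
End Yangian.
End Separated.

(** * Elementary symmetric polynomials and leading symbols *)

Section ElementarySymmetric.

Fixpoint esy (K : comNzRingType) (J : Type) (y : J -> K) (l : seq J) (k : nat) : K :=
  if k is k'.+1 then
    if l is i :: l' then esy y l' k + y i * esy y l' k' else 0
  else 1.

Lemma esy_map (K : comNzRingType) (J J' : Type) (f : J -> J') (y : J' -> K) l k :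
  esy y (map f l) k = esy (fun j => y (f j)) l k.
Proof. by elim: l k => [|i l IH] [|k] //=; rewrite !IH. Qed.

Lemma esy_eq (K : comNzRingType) (J : Type) (y y' : J -> K) l k : (forall j, y j = y' j) ->
  esy y l k = esy y' l k.
Proof. by move=> e; elim: l k => [|i l IH] [|k] //=; rewrite !IH e. Qed.

Lemma esy_horner (K : comNzRingType) (J : Type) (p : J -> {poly K}) l k t :
  (esy p l k).[t] = esy (fun j => (p j).[t]) l k.
Proof.
elim: l k => [|i l IH] [|k] /=; rewrite ?hornerC ?horner0 //.
by rewrite hornerD hornerM !IH.
Qed.

Variable K : fieldType.
Implicit Types (p q : {poly K}).

(** Since the exponents increase, the product of the first [k] weights is the only term of lowest
    degree, and its coefficient is 1. *)
Lemma esy_low (b : nat -> nat) m r k : (forall i j, (i < j)%N -> (b i < b j)%N) ->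
  (k <= r)%N -> exists2 q : {poly K}, q.[0] = 1 &
  esy (fun i => 'X^(b i)) (iota m r) k = 'X^(\sum_(m <= j < m + k) b j) * q.
Proof.
move=> bmono; elim: r m k => [|r IH] m [|k] //= kr.
- by exists 1; rewrite ?hornerC // addn0 big_geq // expr0 mulr1.
- by exists 1; rewrite ?hornerC // addn0 big_geq // expr0 mulr1.
have [q2 q20 e2] := IH m.+1 k kr.
have se : (\sum_(m <= j < m + k.+1) b j = b m + \sum_(m.+1 <= j < m.+1 + k) b j)%N.
  by rewrite big_ltn ?addSnnS //; lia.
case: (leqP k.+1 r) => kr'.
- have [q1 q10 e1] := IH m.+1 k.+1 kr'.
  (* Without the weight of index [m], the lowest term must use index [m + k + 1] instead, which
     raises the degree by this positive difference. *)
  exists (q2 + 'X^(b (m.+1 + k)%N - b m) * q1).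
    rewrite hornerD hornerM hornerXn q20 expr0n subn_eq0 leqNgt bmono ?mul0r ?addr0 //.
    lia.
  rewrite e1 e2 se exprD -mulrA mulrDr mulrDr addrC; congr (_ + _).
  rewrite addnS big_nat_recr /=; last lia.
  rewrite exprD -!mulrA [in RHS]mulrCA; congr (_ * _).
  by rewrite mulrA -exprD subnKC // ltnW // bmono; lia.
exists q2 => //; rewrite e2 se exprD -mulrA.
(* There are fewer than [k + 1] variables left. *)
suff -> : esy (fun i => 'X^(b i) : {poly K}) (iota m.+1 r) k.+1 = 0 by rewrite add0r.
move: kr'; rewrite ltnS; clear; elim: r m k => [|r IH] m [|k] //= kr.
by rewrite !IH ?mulr0 ?addr0 //; lia.
Qed.

Lemma digits_inj (G n : nat) (x y : nat -> nat) :
  (forall i, (x i < G)%N) -> (forall i, (y i < G)%N) ->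
  (\sum_(i < n) x i * G ^ i = \sum_(i < n) y i * G ^ i)%N ->
  forall i, (i < n)%N -> x i = y i.
Proof.
elim: n x y => [//|n IH] x y hx hy.
rewrite !big_ord_recl !expn0 !muln1.
have e (z : nat -> nat) : (\sum_(i < n) z (bump 0 i) * G ^ bump 0 i =
    (\sum_(i < n) z i.+1 * G ^ i) * G)%N.
  by rewrite big_distrl; apply: eq_bigr => i _; rewrite /= /bump add1n expnSr mulnA.
rewrite !e => E.
have G0 : (0 < G)%N by apply: leq_ltn_trans (hx 0%N).
have e0 : x 0%N = y 0%N.
  by have := congr1 (modn^~ G) E; rewrite /= !(addnC _ (_ * _)%N) !modnMDl !modn_small.
have e1 : (\sum_(i < n) x i.+1 * G ^ i = \sum_(i < n) y i.+1 * G ^ i)%N.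
  by move/eqP: E; rewrite e0 eqn_add2l eqn_pmul2r // => /eqP.
by case=> [//|i] hi; apply: (IH (fun i => x i.+1) (fun i => y i.+1)).
Qed.

Lemma poly_roots0 p (f : nat -> K) : injective f -> (forall n, p.[f n] = 0) -> p = 0.
Proof.
move=> fi fr; apply/eqP/negPn/negP => p0.
have := max_poly_roots p0 (rs := map f (iota 0 (size p))).
rewrite size_map size_iota ltnn map_inj_uniq // iota_uniq => /(_ _ isT).
move=> H; suff: false by []. apply: H; apply/allP => _ /mapP[n _ ->]; exact/rootP.
Qed.

(* Weights [y_i = X^(b i)] for which the lowest-order term of the [k]-th
   elementary symmetric polynomial is [X^(G^k)]. *)
Definition bexp (G i : nat) : nat := if i == 0%N then G else (G ^ i.+1 - G ^ i)%N.

Lemma bexp_mono G i j : (2 < G)%N -> (i < j)%N -> (bexp G i < bexp G j)%N.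
Proof.
move=> G2; have step n : (bexp G n < bexp G n.+1)%N.
  rewrite /bexp /=; case: n => [|n] /=; first by rewrite expnS expn1; nia.
  have : (0 < G ^ n.+1)%N by rewrite expn_gt0; lia.
  by rewrite !(expnS G n.+2) !(expnS G n.+1); move: (G ^ n.+1)%N => h; nia.
elim: j => [//|j IH]; rewrite ltnS leq_eqVlt => /orP[/eqP ->//|/IH].
by move/ltn_trans; apply.
Qed.

Lemma bexp_sum G k : (0 < G)%N -> (\sum_(0 <= j < k.+1) bexp G j = G ^ k.+1)%N.
Proof.
move=> G0; elim: k => [|k IH]; first by rewrite big_nat1 /bexp expn1.
rewrite big_nat_recr //= IH /bexp /= subnKC // leq_pexp2l //.
Qed.

(** The lowest exponent of the monomial [al] is [G] times the number with base-[G] digits [al k], so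
    distinct monomials have distinct lowest exponents. In [G], the term [D] bounds the digits and 3
    keeps [bexp] strictly increasing: [G = 2] would give [bexp 0 = bexp 1]. *)
Lemma esy_monomials_free N D (c : {ffun 'I_N -> 'I_D} -> K) (P : pred {ffun 'I_N -> 'I_D})
    (G := maxn D 3) :
  \sum_(al | P al) c al *: \prod_(k < N)
     esy (fun i : 'I_N => 'X^(bexp G i)) (enum 'I_N) k.+1 ^+ al k = 0 ->
  forall al, P al -> c al = 0.
Proof.
move=> H; have G2 : (2 < G)%N by rewrite /G leq_max orbT.
pose m (al : {ffun 'I_N -> 'I_D}) := (\sum_(k < N) al k * G ^ k.+1)%N.
have mono (al : {ffun 'I_N -> 'I_D}) : exists2 q : {poly K}, q.[0] = 1 &
   \prod_(k < N) esy (fun i : 'I_N => 'X^(bexp G i)) (enum 'I_N) k.+1 ^+ al k =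
   'X^(m al) * q.
  rewrite /m; elim/big_ind2: _ => [|p1 n1 p2 n2 [q1 h1 ->] [q2 h2 ->]|k _].
  - by exists 1; rewrite ?hornerC // expr0 mulr1.
  - by exists (q1 * q2); rewrite ?hornerM ?h1 ?h2 ?mulr1 // exprD mulrACA.
  - have [|q q0 e] := @esy_low (bexp G) 0 N k.+1 _ (ltn_ord k).
      by move=> i j; exact: bexp_mono.
    exists (q ^+ al k); first by rewrite horner_exp q0 expr1n.
    rewrite -(esy_map val (fun i => 'X^(bexp G i))) val_enum_ord e add0n bexp_sum ?(ltn_trans _ G2) //.
    by rewrite exprMn -exprM mulnC.
have m_inj : injective m.
  move=> al al' E; apply/ffunP => k; apply: val_inj => /=.
  pose x (al : {ffun 'I_N -> 'I_D}) (i : nat) : nat :=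
    if insub i is Some k then al k else 0%N.
  have xE al0 (i : 'I_N) : x al0 i = al0 i by rewrite /x valK.
  rewrite -!xE; apply: (@digits_inj G N) => [i|i||//].
  + by rewrite /x; case: insub => [j|]; rewrite ?(leq_trans (ltn_ord _)) ?leq_maxl // (ltn_trans _ G2).
  + by rewrite /x; case: insub => [j|]; rewrite ?(leq_trans (ltn_ord _)) ?leq_maxl // (ltn_trans _ G2).
  + have mE al0 : m al0 = (G * \sum_(i < N) x al0 i * G ^ i)%N.
      by rewrite big_distrr; apply: eq_bigr => i _ /=; rewrite xE expnS mulnCA.
    move/eqP: E; rewrite !mE eqn_pmul2l ?(ltn_trans _ G2) // => /eqP.
    by move=> ->.
move=> al0 P0; apply/eqP/negPn/negP => c0.
pose Q al := P al && (c al != 0).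
have Q0 : Q al0 by rewrite /Q P0.
(* At the smallest lowest exponent among the terms with nonzero coefficient, no other term
   contributes. *)
case: (arg_minnP m Q0) => al /andP[Pal cal] almin.
have Z al' : P al' && (al' != al) -> (c al' *: \prod_(k < N)
     esy (fun i : 'I_N => 'X^(bexp G i)) (enum 'I_N) k.+1 ^+ al' k)`_(m al) = 0.
  case/andP=> Pal' ne; rewrite coefZ; have [->|cal'] := eqVneq (c al') 0; first by rewrite mul0r.
  have [q q0 ->] := mono al'; rewrite coefXnM.
  have -> : (m al < m al')%N; last by rewrite mulr0.
  rewrite ltn_neqAle almin /Q ?Pal' ?cal' // andbT.
  by apply: contra ne => /eqP/m_inj ->.
have := congr1 (fun p : {poly K} => p`_(m al)) H; rewrite coef_sum coef0 (bigD1 al) //=.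
rewrite [X in _ + X]big1; [rewrite addr0 coefZ|exact: Z]; have [q q0 ->] := mono al.
by rewrite coefXnM ltnn subnn -horner_coef0 q0 mulr1 => h; rewrite h eqxx in cal.
Qed.

End ElementarySymmetric.

(** * Polynomial dependence on a parameter and leading symbols *)

Section Symbols.
Variables (K : numFieldType) (F : lmodType K).

(* [u : K -> F] is polynomial of degree at most [w] with coefficient [a] in
   degree [w]. *)
Fixpoint polyfun (w : nat) (u : K -> F) (a : F) : Prop :=
  if w is w'.+1 then
    exists h u', (forall t, u t = h + t *: u' t) /\ polyfun w' u' a
  else forall t, u t = a.

Lemma polyfun_linear (X : {linear F -> F}) w u a : polyfun w u a ->
  polyfun w (fun t => X (u t)) (X a).
Proof.
elim: w u => [|w IH] u /=; first by move=> h t; rewrite h.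
move=> [h [u' [e p]]]; exists (X h), (fun t => X (u' t)); split; last exact: IH.
by move=> t; rewrite e linearD linearZ.
Qed.

Lemma polyfunD w u v a b : polyfun w u a -> polyfun w v b ->
  polyfun w (fun t => u t + v t) (a + b).
Proof.
elim: w u v => [|w IH] u v /=; first by move=> h1 h2 t; rewrite h1 h2.
move=> [h [u' [e p]]] [h' [v' [e' p']]].
exists (h + h'), (fun t => u' t + v' t); split; last exact: IH.
by move=> t; rewrite e e' scalerDr addrACA.
Qed.

Lemma polyfun0 w : polyfun w (fun=> 0) 0.
Proof.
elim: w => [//|w IH] /=; exists 0, (fun=> 0); split=> // t.
by rewrite scaler0 addr0.
Qed.

Lemma polyfun_up w u a : polyfun w u a -> polyfun w.+1 u 0.
Proof.
elim: w u => [|w IH] u /=.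
  by move=> h; exists a, (fun=> 0); split=> // t; rewrite h scaler0 addr0.
by move=> [h [u' [e p]]]; exists h, u'; split=> //; exact: IH.
Qed.

Lemma polyfun_shift w u a : polyfun w u a -> polyfun w.+1 (fun t => t *: u t) a.
Proof. by move=> h; exists 0, u; split=> // t; rewrite add0r. Qed.

Lemma polyfun_eval (e : {additive F -> K}) w u a :
  (forall c x, e (c *: x) = c * e x) -> polyfun w u a ->
  exists2 p : {poly K}, p`_w = e a & forall t, p.[t] = e (u t).
Proof.
move=> eZ; elim: w u => [|w IH] u /=.
  by move=> h; exists (e a)%:P; [rewrite coefC | move=> t; rewrite hornerC h].
move=> [h [u' [eq /IH[p pw pe]]]]; exists ((e h)%:P + 'X * p).
  by rewrite coefD coefC coefXM /= add0r.
by move=> t; rewrite hornerD hornerC hornerM hornerX pe eq raddfD eZ.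
Qed.

Variable M : K -> {linear F -> F}.

(* [X] has order at most [w] and symbol [s]; [M t] is to be thought of as
   multiplication by [exp (t f)]. *)
Definition symbol (w : nat) (X s : F -> F) : Prop := forall w' u a, polyfun w' u a ->
  exists2 v, (forall t, X (M t (u t)) = M t (v t)) & polyfun (w + w') v (s a).

Lemma symbol_id : symbol 0 id id.
Proof. by move=> w' u a p; exists u. Qed.

Lemma symbol_comp w1 w2 X1 X2 s1 s2 : symbol w1 X1 s1 -> symbol w2 X2 s2 ->
  symbol (w1 + w2) (fun x => X1 (X2 x)) (fun x => s1 (s2 x)).
Proof.
move=> h1 h2 w' u a /h2[v e /h1[v' e' p]]; exists v'; last by rewrite -addnA.
by move=> t; rewrite e e'.
Qed.

Lemma symbolD w X1 X2 s1 s2 : symbol w X1 s1 -> symbol w X2 s2 ->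
  symbol w (fun x => X1 x + X2 x) (fun x => s1 x + s2 x).
Proof.
move=> h1 h2 w' u a p; have [v1 e1 p1] := h1 _ _ _ p; have [v2 e2 p2] := h2 _ _ _ p.
exists (fun t => v1 t + v2 t); last exact: polyfunD.
by move=> t; rewrite e1 e2 linearD.
Qed.

Lemma symbol0 w : symbol w (fun=> 0) (fun=> 0).
Proof.
move=> w' u a _; exists (fun=> 0); last exact: polyfun0.
by move=> t; rewrite linear0.
Qed.

Lemma symbol_sum w (I : Type) (r : seq I) (P : pred I) (X s : I -> F -> F) :
  (forall i, P i -> symbol w (X i) (s i)) ->
  symbol w (fun x => \sum_(i <- r | P i) X i x) (fun x => \sum_(i <- r | P i) s i x).
Proof.
move=> h; elim: r => [|i r IH].
  rewrite (_ : (fun x => _) = (fun=> 0)); last by apply/funext => x; rewrite big_nil.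
  rewrite [X in symbol _ _ X](_ : _ = (fun=> 0)); last by apply/funext => x; rewrite big_nil.
  exact: symbol0.
rewrite (_ : (fun x => _) = (fun x => (if P i then X i else fun=> 0) x + \sum_(j <- r | P j) X j x));
  last by apply/funext => x; rewrite big_cons; case: ifP => _; rewrite ?add0r.
rewrite [X in symbol _ _ X](_ : _ = (fun x => (if P i then s i else fun=> 0) x + \sum_(j <- r | P j) s j x));
  last by apply/funext => x; rewrite big_cons; case: ifP => _; rewrite ?add0r.
by apply: symbolD => //; case: ifP => [/h//|_]; exact: symbol0.
Qed.

Lemma symbolZ w (c : K) X s : symbol w X s ->
  symbol w (fun x => c *: X x) (fun x => c *: s x).
Proof.
move=> h w' u a /h[v e p]; exists (fun t => c *: v t); last exact: (polyfun_linear ( *:%R c) p).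
by move=> t; rewrite e linearZ.
Qed.

Lemma symbol_lt w w2 X s : (w < w2)%N -> symbol w X s -> symbol w2 X (fun=> 0).
Proof.
move=> ww h w' u a /h[v e p]; exists v => //.
elim: w2 ww => [//|w2 IH]; rewrite ltnS leq_eqVlt => /orP[/eqP <-|/IH].
  by rewrite addSn; exact: polyfun_up p.
by rewrite addSn; exact: polyfun_up.
Qed.

(** Conjugation by [M t] adds [t *: G], which raises the degree in [t] by one, while [X] itself does
    not raise it. *)
Lemma symbol1 (X G : {linear F -> F}) :
  (forall t x, X (M t x) = M t (X x + t *: G x)) -> symbol 1 X G.
Proof.
move=> h w' u a p; exists (fun t => X (u t) + t *: G (u t)); first by move=> t; rewrite h.
rewrite add1n -[G a]add0r; apply: polyfunD.
  by apply: polyfun_up; exact: polyfun_linear p.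
by apply: polyfun_shift; exact: polyfun_linear.
Qed.

Lemma symbol_iter w m X s : symbol w X s -> symbol (m * w) (iter m X) (iter m s).
Proof.
move=> h; elim: m => [|m IH]; first by rewrite mul0n; exact: symbol_id.
by rewrite mulSn; exact: symbol_comp h IH.
Qed.

Lemma symbol_mulzs (J : Type) (X G : J -> {linear F -> F}) l k :
  (forall j, symbol 1 (X j) (G j)) ->
  symbol k (fun x => mulzs X l (seq0 x) k) (fun x => mulzs G l (seq0 x) k).
Proof.
move=> h; elim: l k => [|j l IH] k /=.
  by case: k => [|k]; [exact: symbol_id | exact: symbol0].
rewrite /mulz; case: k => [|k].
  by apply: symbolD; [exact: IH | exact: symbol0].
by apply: symbolD; [exact: IH | rewrite -add1n; exact: (symbol_comp (h j) (IH k))].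
Qed.

(** The value [e (v t)] is a polynomial in [t] that vanishes at every natural number, and [e (s x)]
    is its coefficient in degree [w]. *)
Lemma symbol_eq0 (e : {additive F -> K}) w X s x :
  (forall c x, e (c *: x) = c * e x) ->
  (forall t x, e (M t x) = 0 -> e x = 0) ->
  symbol w X s -> (forall t, X (M t x) = 0) -> e (s x) = 0.
Proof.
move=> eZ eM h X0; have [//|v ev p] := h 0%N (fun=> x) x.
have [p' p'w pe] := polyfun_eval eZ p.
suff p0 : p' = 0 by rewrite -p'w p0 coef0.
apply: (@poly_roots0 _ _ (fun n : nat => n%:R)).
  by move=> m n /eqP; rewrite eqr_nat => /eqP.
by move=> n; rewrite pe; apply: (eM n%:R); rewrite -ev X0 raddf0.
Qed.

End Symbols.

(** * The wave functions of the model *)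

(** Openness is bundled with the set so that the module structure of [smf] can be declared for a
    single parameter. *)
Structure openset (R : realType) (N : nat) :=
  OpenSet { oset :> set 'rV[R]_N; oset_open : open oset }.

Section SmoothFunctions.
Variables (R : realType) (N : nat) (U : openset R N).

(* Smooth functions on [U] modulo equality on [U], represented by their
   extension by [0]. *)
Definition smp : {pred 'rV[R]_N -> R[i]} :=
  fun f => `[< smooth1 U f /\ forall q, ~ oset U q -> f q = 0 >].

Lemma smpE f : (f \in smp) = `[< smooth1 U f /\ forall q, ~ oset U q -> f q = 0 >].
Proof. by []. Qed.

Lemma smp_submod : submod_closed smp.
Proof.
have oU := @oset_open _ _ U; split=> [|c f g]; rewrite !smpE.
  apply/asboolP; split; last by [].
  exact: (smooth1_cst oU 0).
move=> /asboolP[sf f0] /asboolP[sg g0]; apply/asboolP; split=> [|q Uq].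
  by apply: (smooth1D oU) => //; apply: (smooth1M oU) => //; exact: smooth1_cst.
by rewrite -[LHS]/(c *: f q + g q) f0 // g0 // scaler0 addr0.
Qed.

HB.instance Definition _ := GRing.isSubmodClosed.Build R[i] ('rV[R]_N -> R[i]) smp smp_submod.

Record smf := Smf { smf_val :> 'rV[R]_N -> R[i]; smf_in : smf_val \in smp }.
HB.instance Definition _ := [isSub for smf_val].
HB.instance Definition _ := [Choice of smf by <:].
HB.instance Definition _ := [SubChoice_isSubLmodule of smf by <:].

Implicit Types (x y : smf) (q : 'rV[R]_N) (f : 'rV[R]_N -> R[i]).

Lemma smf_smooth x : smooth1 U x.
Proof. by case: x => f /=; rewrite smpE => /asboolP[]. Qed.

Lemma smf_out x q : ~ oset U q -> x q = 0.
Proof. by case: x => f /=; rewrite smpE => /asboolP[_]; apply. Qed.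

Lemma smf_eq x y : (forall q, oset U q -> x q = y q) -> x = y.
Proof.
move=> e; apply/val_inj/funext => q /=.
by have [/e//|nU] := pselect (oset U q); rewrite !smf_out.
Qed.

Definition smf_ev q x : R[i] := x q.
Lemma smf_ev_additive q : zmod_morphism (smf_ev q).
Proof. by []. Qed.
HB.instance Definition _ q := GRing.isZmodMorphism.Build smf R[i] (smf_ev q) (smf_ev_additive q).

Lemma smf_evZ q (c : R[i]) x : smf_ev q (c *: x) = c * smf_ev q x.
Proof. by []. Qed.

Lemma smf_ev_inj x y : (forall q, smf_ev q x = smf_ev q y) -> x = y.
Proof. by move=> e; apply: smf_eq => q _; exact: e. Qed.

Lemma smfD x y q : (x + y) q = x q + y q. Proof. by []. Qed.
Lemma smfN x q : (- x) q = - x q. Proof. by []. Qed.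
Lemma smfZ c x q : (c *: x) q = c * x q. Proof. by []. Qed.
Lemma smf0 q : (0 : smf) q = 0. Proof. by []. Qed.
Lemma smf_sum (I : Type) (r : seq I) (P : pred I) (F : I -> smf) q :
  (\sum_(i <- r | P i) F i) q = \sum_(i <- r | P i) F i q.
Proof. exact: (raddf_sum (smf_ev q)). Qed.

(** The default value 0 for functions that are not smooth makes this total; its use rests on
    [mksmE]. *)
Definition mksm f : smf := insubd 0 (fun q => if `[< oset U q >] then f q else 0).

Lemma mksmE f q : smooth1 U f -> oset U q -> mksm f q = f q.
Proof.
move=> sf Uq; rewrite /mksm insubdK; first by rewrite asboolT.
rewrite -[X in is_true X]/(_ \in smp) smpE; apply/asboolP; split; last by move=> p Up; rewrite asboolF.
by apply: smooth1_eq sf; [exact: oset_open | move=> p Up; rewrite asboolT].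
Qed.

End SmoothFunctions.

(** Here [u], [v], [w] stand for [x_l], [x_k], [x_m], and the flags for the comparisons [k < l],
    [m < l], [m < k]. The last two hypotheses exclude the cyclic patterns, which three distinct
    numbers cannot produce. *)
Lemma potential_cyc (K : fieldType) (b u v w : K) (kl ml mk : bool) :
  u - v != 0 -> u - w != 0 -> v - w != 0 ->
  ~~ [&& kl, mk & ~~ ml] -> ~~ [&& ~~ kl, ~~ mk & ml] ->
  (if kl then b * v / (u - v) else - (b * u / (v - u))) *
  (if ml then b * w / (v - w) else - (b * v / (w - v))) +
  (if mk then b * w / (v - w) else - (b * v / (w - v))) *
  (if ~~ kl then b * u / (w - u) else - (b * w / (u - w))) +
  (if ~~ ml then b * u / (w - u) else - (b * w / (u - w))) *
  (if ~~ mk then b * v / (u - v) else - (b * u / (v - u))) = 0.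
Proof.
move=> n1 n2 n3.
have n1' : v - u != 0 by rewrite -opprB oppr_eq0.
have n2' : w - u != 0 by rewrite -opprB oppr_eq0.
have n3' : w - v != 0 by rewrite -opprB oppr_eq0.
by case: kl; case: ml; case: mk => //= _ _; field; rewrite ?n1 ?n2 ?n3 ?n1' ?n2' ?n3'.
Qed.

(** * The concrete operators on the regular set *)

Section Model.
Variables (R : realType) (N : nat) (lam gam tau : R[i]) (a A : R -> R).
Hypothesis ha : cinf a.
Hypothesis a0 : forall x, a x != 0.
Hypothesis hA : forall x : R, is_derive x (1 : R) A ((a x)^-1).

Local Notation RN := 'rV[R]_N.

Implicit Types (q : RN).

Lemma regular_open : open (regular gam A : set RN).
Proof.
rewrite openE => q Uq.
have h (ij : 'I_N * 'I_N) : nbhs (q : RN) (fun x : RN => ij.1 != ij.2 ->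
    cexp (- (2%:R) * gam * RtoC (A (x 0 ij.1) - A (x 0 ij.2))) != 1).
  case: ij => i j /=; have [->|ij] := eqVneq i j; first by near=> x.
  pose f (x : RN) := cexp (- (2%:R) * gam * RtoC (A (x 0 i) - A (x 0 j))) - 1.
  have cA k : contC (fun x : RN => RtoC (A (x 0 k))) q.
    by apply: contC_real; apply: ex_derive.
  have cf : contC f q.
    apply: contCD (contC_cst _ _); apply: contC_cexp.
    apply: contCM; first exact: contC_cst.
    rewrite (_ : (fun x => _) = (fun x : RN => RtoC (A (x 0 i)) + (-1) * RtoC (A (x 0 j)))).
      by apply: contCD => //; apply: contCM => //; exact: contC_cst.
    by apply/funext => x; rewrite RtoCB mulN1r.
  have nf : Re (f q) ^+ 2 + Im (f q) ^+ 2 != 0.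
    by apply: norm2_neq0; rewrite subr_eq0; exact: Uq.
  have cn : {for q, continuous (fun x => Re (f x) ^+ 2 + Im (f x) ^+ 2)}.
    by case: cf => c1 c2; apply: continuousD; apply: continuousM.
  have : \forall x \near q, Re (f x) ^+ 2 + Im (f x) ^+ 2 != 0.
    by apply: (@cvgr_neq0 _ _ _ (nbhs q) _ _ (Re (f q) ^+ 2 + Im (f q) ^+ 2)) nf; exact: cn.
  apply: filterS => x + _.
  by apply: contra => /eqP h; rewrite /f h subrr /= expr0n addr0.
have hh := filter_forall (nbhs_filter (q : RN)) h; apply: filterS hh => x hx i j ij.
exact: (hx (i, j)).
Unshelve. all: by end_near. Qed.

Definition regset := OpenSet regular_open.
Local Notation F := (smf regset).
Local Notation oU := (@oset_open _ _ regset).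

Lemma regular_swq i j q : regular gam A q -> regular gam A (swq i j q).
Proof.
by move=> Uq k l kl; rewrite !swqE; apply: Uq; rewrite (inj_eq (@perm_inj _ _)).
Qed.

Let gensm (f : RN -> R[i]) : gen regset A f -> smooth1 regset f.
Proof. exact: (gen_smooth1 oU ha a0 hA). Qed.

Lemma smooth1_op_D (l : 'I_N) (x : F) :
  smooth1 regset (fun q => RtoC (a (q 0 l)) * pds l x q).
Proof.
apply: gensm; apply: genM; first exact: gen_real.
apply: gen_smooth; apply: smooth1_pds; exact: smf_smooth.
Qed.

(* The operators are sealed behind opaque existence proofs, so that unification
   never unfolds them. *)
Lemma Dop_ex : {D : 'I_N -> F -> F | forall l (x : F) q, regular gam A q ->
  D l x q = RtoC (a (q 0 l)) * pds l x q}.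
Proof.
exists (fun l x => mksm regset (fun q => RtoC (a (q 0 l)) * pds l x q)) => l x q Uq.
by rewrite mksmE //; exact: smooth1_op_D.
Qed.
Definition Dop : 'I_N -> F -> F := sval Dop_ex.

Lemma DopE l x q : regular gam A q -> Dop l x q = RtoC (a (q 0 l)) * pds l x q.
Proof. exact: (svalP Dop_ex). Qed.

Lemma Dop_linear l : linear (Dop l).
Proof.
move=> c x y; apply: smf_eq => q Uq; rewrite smfD smfZ !DopE //.
have hx := pdsP l (@smf_smooth _ _ _ x) Uq; have hy := pdsP l (@smf_smooth _ _ _ y) Uq.
have -> : pds l (c *: x + y) q = c * pds l x q + pds l y q; last by ring.
apply: pds_val; apply: is_dCD hy; have := is_dCM (is_dC_cst c _) hx.
by rewrite mul0r add0r.
Qed.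
HB.instance Definition _ l := GRing.isLinear.Build R[i] F F _ (Dop l) (Dop_linear l).

Definition ex (q : RN) (i : 'I_N) : R[i] := cexp (- (2%:R) * gam * RtoC (A (q 0 i))).

Lemma ex_neq0 q i : ex q i != 0.
Proof. exact: cexp_neq0. Qed.

Lemma ex_swq i j q k : ex (swq i j q) k = ex q (tperm i j k).
Proof. by rewrite /ex swqE. Qed.

Lemma ex_sub q i j :
  cexp (- (2%:R) * gam * RtoC (A (q 0 i) - A (q 0 j))) = ex q i / ex q j.
Proof. by rewrite RtoCB mulrBr cexpD cexpN. Qed.

Lemma ex_neq q i j : regular gam A q -> i != j -> ex q i - ex q j != 0.
Proof.
move=> Uq ij; rewrite subr_eq0; apply: contra (Uq i j ij) => /eqP e.
by rewrite ex_sub e divff // ex_neq0.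
Qed.

Local Notation beta := (beta lam tau).

Lemma vpotE q i j : regular gam A q -> i != j ->
  vpot lam gam tau A (q 0 i) (q 0 j) = beta * ex q j / (ex q i - ex q j).
Proof.
move=> Uq ij; rewrite /vpot ex_sub.
have n1 := ex_neq0 q j; have n2 := ex_neq Uq ij.
by field; rewrite n1 n2.
Qed.

Definition Vc (l k : 'I_N) (q : RN) : R[i] :=
  if (k < l)%N then vpot lam gam tau A (q 0 l) (q 0 k)
  else - vpot lam gam tau A (q 0 k) (q 0 l).

(** Coefficient of the swap in [d_l], sign included, as a rational function of the
    [x_i = ex q i]. *)
Definition Ve (l k : 'I_N) (q : RN) : R[i] :=
  if (k < l)%N then beta * ex q k / (ex q l - ex q k)
  else - (beta * ex q l / (ex q k - ex q l)).

Lemma VcE l k q : regular gam A q -> l != k -> Vc l k q = Ve l k q.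
Proof. by move=> Uq lk; rewrite /Vc /Ve !vpotE // eq_sym. Qed.

Lemma gen_ex i : gen regset A (fun q => ex q i).
Proof. by apply: gen_cexp; apply: genM; [exact: gen_cst | exact: gen_A]. Qed.

Lemma gen_sub f g : gen regset A f -> gen regset A g -> gen regset A (fun q => f q - g q).
Proof.
move=> gf gg; rewrite (_ : (fun q => _) = (fun q => f q + (-1) * g q)).
  by apply: genD => //; apply: genM => //; exact: gen_cst.
by apply/funext => q; rewrite mulN1r.
Qed.

Lemma gen_Ve l k : l != k -> gen regset A (Ve l k).
Proof.
move=> lk; have kl : k != l by rewrite eq_sym.
have h i j : i != j -> gen regset A (fun q => beta * ex q j / (ex q i - ex q j)).
  move=> ij; apply: genM; first by apply: genM; [exact: gen_cst | exact: gen_ex].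
  by apply: genV; [move=> q Uq; exact: ex_neq | apply: gen_sub; exact: gen_ex].
rewrite /Ve; case: (k < l)%N; first exact: h.
rewrite (_ : (fun q => _) = (fun q => 0 - beta * ex q l / (ex q k - ex q l))).
  by apply: gen_sub; [exact: gen_cst | exact: h].
by apply/funext => q; rewrite sub0r.
Qed.

Lemma smooth1_op_Y (l k : 'I_N) (x : F) : l != k ->
  smooth1 regset (fun q => Ve l k q * x (swq l k q)).
Proof.
move=> lk; apply: gensm; apply: genM; first exact: gen_Ve.
by apply: gen_smooth; apply: smooth1_swq; [exact: regular_swq | exact: smf_smooth].
Qed.

Lemma Yop_ex : {Y : 'I_N -> 'I_N -> F -> F |
  (forall l (x : F), Y l l x = 0) /\ forall l k (x : F) q, l != k -> regular gam A q ->
  Y l k x q = Ve l k q * x (swq l k q)}.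
Proof.
(* On the diagonal the denominator vanishes identically; the value 0 keeps [Yop l k] linear for all
   index pairs. *)
exists (fun l k x => if l == k then 0 else mksm regset (fun q => Ve l k q * x (swq l k q))).
split=> [l x|l k x q lk Uq]; first by rewrite eqxx.
by rewrite (negPf lk) mksmE //; exact: smooth1_op_Y.
Qed.
Definition Yop : 'I_N -> 'I_N -> F -> F := sval Yop_ex.

Lemma Yopxx l (x : F) : Yop l l x = 0.
Proof. exact: (svalP Yop_ex).1. Qed.

Lemma YopE l k x q : l != k -> regular gam A q ->
  Yop l k x q = Ve l k q * x (swq l k q).
Proof. exact: (svalP Yop_ex).2. Qed.

Lemma Yop_linear l k : linear (Yop l k).
Proof.
move=> c x y; have [->|lk] := eqVneq l k.
  by rewrite !Yopxx scaler0 addr0.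
apply: smf_eq => q Uq; rewrite smfD smfZ !YopE // smfD smfZ; ring.
Qed.
HB.instance Definition _ l k := GRing.isLinear.Build R[i] F F _ (Yop l k) (Yop_linear l k).

Lemma Sop_ex : {S : 'I_N -> 'I_N -> F -> F | forall i j (x : F) q,
  regular gam A q -> S i j x q = x (swq i j q)}.
Proof.
exists (fun i j x => mksm regset (fun q => x (swq i j q))) => i j x q Uq.
by rewrite mksmE //; apply: smooth1_swq; [exact: regular_swq | exact: smf_smooth].
Qed.
Definition Sop : 'I_N -> 'I_N -> F -> F := sval Sop_ex.

Lemma SopE i j x q : regular gam A q -> Sop i j x q = x (swq i j q).
Proof. exact: (svalP Sop_ex). Qed.

Lemma Sop_linear i j : linear (Sop i j).
Proof.
by move=> c x y; apply: smf_eq => q Uq; rewrite smfD smfZ !SopE.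
Qed.
HB.instance Definition _ i j := GRing.isLinear.Build R[i] F F _ (Sop i j) (Sop_linear i j).

(* [thV i l k] is [a(q_i) d/dq_i] of the potential [Ve l k]. *)
Definition Wc (l k : 'I_N) (q : RN) : R[i] :=
  2%:R * gam * beta * ex q l * ex q k / (ex q l - ex q k) ^+ 2.
Definition thV (i l k : 'I_N) (q : RN) : R[i] :=
  if i == l then Wc l k q else if i == k then - Wc l k q else 0.

Lemma pdC_ex i j q : pdC i (fun q => ex q j) q
  ((RtoC (a (q 0 i)))^-1 * (if i == j then - (2%:R) * gam * ex q j else 0)).
Proof.
have h := @pdC_real R N A (fun x => (a x)^-1) i j q hA.
have := is_dC_cexp (is_dCM (is_dC_cst (- (2%:R) * gam) _) h).
rewrite !mul0r !add0r upd_id eq_sym; move/is_dC_eq; apply; rewrite /ex.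
case: eqP => [->|_]; last by rewrite mulr0 mul0r mulr0.
by rewrite RtoCV; ring.
Qed.

Lemma pdC_Ve i l k q : l != k -> regular gam A q ->
  pdC i (Ve l k) q ((RtoC (a (q 0 i)))^-1 * thV i l k q).
Proof.
move=> lk Uq; have kl : k != l by rewrite eq_sym.
have core u v : u != v -> pdC i (fun q => beta * ex q v / (ex q u - ex q v)) q
  ((RtoC (a (q 0 i)))^-1 * thV i u v q).
  move=> uv; have n := ex_neq Uq uv.
  have hu := pdC_ex i u q; have hv := pdC_ex i v q.
  have hs := is_dCD hu (is_dCM (is_dC_cst (-1) _) hv).
  have hs' : pdC i (fun q => ex q u - ex q v) q
    ((RtoC (a (q 0 i)))^-1 * ((if i == u then - (2%:R) * gam * ex q u else 0) -
       (if i == v then - (2%:R) * gam * ex q v else 0))).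
    have e : (fun q => ex q u - ex q v) = (fun q => ex q u + (-1) * ex q v).
      by apply/funext => z; rewrite mulN1r.
    rewrite e; move: hs; move/is_dC_eq; apply.
    rewrite mul0r add0r; ring.
  have := is_dCM (is_dCM (is_dC_cst beta _) hv) (is_dCV _ hs').
  rewrite !upd_id => /(_ n); move/is_dC_eq; apply.
  rewrite /thV /Wc; have an : RtoC (a (q 0 i)) != 0 by rewrite RtoC_eq0.
  case: (eqVneq i u) => [iu|iu]; case: (eqVneq i v) => [iv|iv].
  - by move: uv; rewrite -iu -iv eqxx.
  - by field; rewrite n an.
  - by field; rewrite n an.
  - by field; rewrite n an.
rewrite /Ve; case: (k < l)%N; first exact: core.
have := is_dCM (is_dC_cst (-1) _) (core k l kl).
rewrite mul0r add0r /pdC.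
under [X in is_dC X]eq_fun do rewrite mulN1r.
move/is_dC_eq; apply; rewrite /thV.
have n := ex_neq Uq lk; have n' := ex_neq Uq kl.
have -> : Wc k l q = Wc l k q by rewrite /Wc; field; rewrite n n'.
case: (eqVneq i l) => [->|il]; first by rewrite (negPf lk); ring.
by case: eqP => _; ring.
Qed.

(** Leibniz rule: the derivative hits the coefficient or passes through the swap with its index
    transposed. *)
Lemma DYE i l k x q : l != k -> regular gam A q ->
  Dop i (Yop l k x) q = thV i l k q * x (swq l k q)
    + Ve l k q * Dop (tperm l k i) x (swq l k q).
Proof.
move=> lk Uq; have Usq := regular_swq l k Uq.
rewrite !DopE // swqE tpermK.
have hx := pdC_swq (pdsP (tperm l k i) (@smf_smooth _ _ _ x) Usq).
have := is_dCM (pdC_Ve i lk Uq) hx; rewrite !upd_id => H.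
have e : \forall p \near q, Ve l k p * x (swq l k p) = Yop l k x p.
  by apply: (near_eqU oU Uq) => p Up; rewrite YopE.
rewrite (pds_val (pdC_near e H)).
have an : RtoC (a (q 0 i)) != 0 by rewrite RtoC_eq0.
by field.
Qed.

Lemma DD i j (x : F) : Dop i (Dop j x) = Dop j (Dop i x).
Proof.
have [->//|ij] := eqVneq i j; apply: smf_eq => q Uq.
have half u v : u != v -> Dop u (Dop v x) q =
   RtoC (a (q 0 u)) * RtoC (a (q 0 v)) * pds u (pds v x) q.
  move=> uv; rewrite DopE //.
  have e : nbhs q (fun p : RN => RtoC (a (p 0 v)) * pds v x p = Dop v x p).
    by apply: (near_eqU oU Uq) => p Up; rewrite DopE.
  have hx := pdsP u (smooth1_pds v (@smf_smooth _ _ _ x)) Uq.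
  have hr : pdC u (fun q : RN => RtoC (a (q 0 v))) q 0.
    have := @pdC_real R N a (derive1 a) u v q; rewrite eq_sym (negPf uv); apply.
    by move=> z; rewrite derive1E; have h : derivable a z 1 := @ha 0%N z; exact: (derivableP h).
  have := is_dCM hr hx; rewrite !upd_id mul0r add0r => H.
  by rewrite (pds_val (pdC_near e H)) mulrA.
have ji : j != i by rewrite eq_sym.
rewrite (half i j ij) (half j i ji) (pds_comm oU i j (@smf_smooth _ _ _ x) Uq).
by congr (_ * _); rewrite mulrC.
Qed.

Lemma DDE i (x : F) q : regular gam A q -> Dop i (Dop i x) q =
  RtoC (a (q 0 i) ^+ 2) * pds i (pds i x) q + RtoC (a (q 0 i) * derive1 a (q 0 i)) * pds i x q.
Proof.
move=> Uq; rewrite DopE //.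
have e : nbhs q (fun p : RN => RtoC (a (p 0 i)) * pds i x p = Dop i x p).
  by apply: (near_eqU oU Uq) => p Up; rewrite DopE.
have hx := pdsP i (smooth1_pds i (@smf_smooth _ _ _ x)) Uq.
have hr : pdC i (fun q : RN => RtoC (a (q 0 i))) q (RtoC (derive1 a (q 0 i))).
  have := @pdC_real R N a (derive1 a) i i q; rewrite eqxx; apply.
  by move=> z; rewrite derive1E; have h : derivable a z 1 := @ha 0%N z; exact: (derivableP h).
have := is_dCM hr hx; rewrite !upd_id => H.
by rewrite (pds_val (pdC_near e H)) expr2 !RtoCM; ring.
Qed.

Lemma Ve_anti l k q : l != k -> Ve k l q = - Ve l k q.
Proof.
move=> lk; rewrite /Ve; case: (ltngtP k l) => h; rewrite ?opprK //.
by move/val_inj: h lk => ->; rewrite eqxx.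
Qed.

Lemma swqC l k q : swq k l q = swq l k q.
Proof. by rewrite /swq tpermC. Qed.

Lemma Yanti l k x : l != k -> Yop k l x = - Yop l k x.
Proof.
move=> lk; have kl : k != l by rewrite eq_sym.
by apply: smf_eq => q Uq; rewrite smfN !YopE // Ve_anti // swqC mulNr.
Qed.

Lemma DYfar l m k x : l != m -> l != k -> m != k -> Dop l (Yop m k x) = Yop m k (Dop l x).
Proof.
move=> lm lk mk; apply: smf_eq => q Uq.
rewrite DYE // YopE // /thV (negPf lm) (negPf lk) mul0r add0r tpermD //.
  by rewrite eq_sym.
by rewrite eq_sym.
Qed.

(** The potential depends only on [A(q_l) - A(q_m)], so [Dop l + Dop m] annihilates it, and the swap
    merely exchanges the two summands. *)
Lemma DYnear l m x : l != m ->
  Dop l (Yop l m x) + Dop m (Yop l m x) = Yop l m (Dop l x) + Yop l m (Dop m x).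
Proof.
move=> lm; apply: smf_eq => q Uq; rewrite [LHS]smfD [RHS]smfD.
have e1 := DYE l x lm Uq; have e2 := DYE m x lm Uq; rewrite tpermL in e1; rewrite tpermR in e2.
rewrite e1 e2 (YopE (Dop l x) lm Uq) (YopE (Dop m x) lm Uq).
by rewrite /thV eqxx (eq_sym m) (negPf lm) eqxx; ring.
Qed.

Lemma Ve_swq_far l k m k' q : uniq [:: l; k; m; k'] -> Ve m k' (swq l k q) = Ve m k' q.
Proof.
rewrite /= !inE !negb_or => /andP[/and3P[lk lm lk'] /andP[/andP[km kk'] _]].
by rewrite /Ve !ex_swq !tpermD.
Qed.

Lemma swq_far l k m k' q : uniq [:: l; k; m; k'] ->
  swq m k' (swq l k q) = swq l k (swq m k' q).
Proof.
rewrite /= !inE !negb_or => /andP[/and3P[lk lm lk'] /andP[/andP[km kk'] _]].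
apply/rowP => j; rewrite !swqE; congr (q 0 _).
case: (tpermP m k' j) => [->|->|/eqP jm /eqP jk'].
- by rewrite tpermD // (tpermD lm km) tpermL.
- by rewrite tpermD // (tpermD lk' kk') tpermR.
- by case: (tpermP l k j) => [_|_|_ _]; rewrite tpermD // eq_sym //.
Qed.

Lemma YYfar l k m k' x : uniq [:: l; k; m; k'] ->
  Yop l k (Yop m k' x) = Yop m k' (Yop l k x).
Proof.
move=> un; have un' : uniq [:: m; k'; l; k] by rewrite -(rot_uniq 2).
have lk : l != k by move: un; rewrite /= inE negb_or => /andP[/andP[]].
have mk : m != k' by move: un'; rewrite /= inE negb_or => /andP[/andP[]].
apply: smf_eq => q Uq; rewrite !YopE //; try exact: regular_swq.
by rewrite (Ve_swq_far _ un) (Ve_swq_far _ un') (swq_far _ un) mulrCA.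
Qed.

Lemma YYcyc l k m x : uniq [:: l; k; m] ->
  Yop l k (Yop l m x) + Yop k m (Yop k l x) + Yop m l (Yop m k x) = 0.
Proof.
rewrite /= !inE negb_or => /andP[/andP[lk lm] /andP[km _]].
have kl : k != l by rewrite eq_sym. have ml : m != l by rewrite eq_sym.
have mk : m != k by rewrite eq_sym.
apply: smf_eq => q Uq; rewrite !smfD smf0 !YopE //; try exact: regular_swq.
(* The three products of swaps are one and the same 3-cycle, which leaves an identity between
   coefficients. *)
have e1 : swq k l (swq k m q) = swq l m (swq l k q).
  apply/rowP => j; rewrite !swqE; congr (q 0 _).
  case: (tpermP k l j) => [->|->|/eqP jk /eqP jl].
  - by rewrite tpermD // (tpermD lk mk) tpermR.
  - by rewrite !tpermL tpermD.
  - case: (eqVneq j m) => [->|jm]; first by rewrite !tpermR tpermL.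
    by rewrite !tpermD // eq_sym.
have e2 : swq m k (swq m l q) = swq l m (swq l k q).
  apply/rowP => j; rewrite !swqE; congr (q 0 _).
  case: (tpermP m k j) => [->|->|/eqP jm /eqP jk].
  - by rewrite (tpermD mk lk) tpermR tpermL.
  - by rewrite tpermL (tpermD lk mk) tpermR.
  - case: (eqVneq j l) => [->|jl]; first by rewrite tpermR tpermL tpermD.
    by rewrite !tpermD // eq_sym.
rewrite e1 e2 !mulrA -!mulrDl.
suff -> : Ve l k q * Ve l m (swq l k q) + Ve k m q * Ve k l (swq k m q)
   + Ve m l q * Ve m k (swq m l q) = 0 by rewrite mul0r.
rewrite /Ve !ex_swq !(tpermL, tpermR, tpermD lk mk, tpermD kl ml, tpermD km lm, tpermD lm km, tpermD mk lk, tpermD ml kl).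
have := ex_neq Uq lk; have := ex_neq Uq lm; have := ex_neq Uq km.
have := ex_neq Uq kl; have := ex_neq Uq ml; have := ex_neq Uq mk.
move: (ex q l) (ex q k) (ex q m) => u v w n1 n2 n3 n4 n5 n6.
have lk' : (l : nat) != k by []. have lm' : (l : nat) != m by [].
have km' : (k : nat) != m by [].
have := @potential_cyc _ beta u v w (k < l)%N (m < l)%N (m < k)%N n6 n5 n4.
rewrite -!leqNgt !(leq_eqVlt l) !(leq_eqVlt k) !val_eqE (negPf lk) (negPf lm) (negPf km) /=.
by apply; clear; lia.
Qed.

Lemma Sinv i j x : Sop i j (Sop i j x) = x.
Proof.
apply: smf_eq => q Uq; rewrite !SopE //; last exact: regular_swq.
by congr (smf_val x _); apply/rowP => k; rewrite !swqE tpermK.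
Qed.

Lemma SD i j k x : Sop i j (Dop k x) = Dop (tperm i j k) (Sop i j x).
Proof.
apply: smf_eq => q Uq; have Usq := regular_swq i j Uq.
rewrite (SopE _ _ _ Uq) (DopE _ _ Usq) (DopE _ _ Uq) swqE; congr (_ * _).
have hx : pdC (tperm i j (tperm i j k)) x (swq i j q) (pds k x (swq i j q)).
  by rewrite tpermK; exact: (pdsP k (@smf_smooth _ _ _ x) Usq).
have e : nbhs q (fun p : RN => x (swq i j p) = Sop i j x p).
  by apply: (near_eqU oU Uq) => p Up; rewrite SopE.
by rewrite (pds_val (pdC_near e (pdC_swq hx))).
Qed.

Lemma swq_conj i j l k q : swq l k (swq i j q) = swq i j (swq (tperm i j l) (tperm i j k) q).
Proof.
apply/rowP => m; rewrite !swqE; congr (q 0 _).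
case: (tpermP l k m) => [->|->|/eqP ml /eqP mk].
- by rewrite tpermL.
- by rewrite tpermR.
- by rewrite [RHS]tpermD // (inj_eq (@perm_inj _ _)) eq_sym.
Qed.

Section AdjacentSwap.
Variables (i i' : 'I_N).
Hypothesis ii' : i' = i.+1 :> nat.

(** No index lies strictly between neighbours, so exchanging them reverses the order of that pair
    only. *)
Lemma ltn_adj j k : j != k -> (j, k) != (i, i') -> (j, k) != (i', i) ->
  (tperm i i' k < tperm i i' j)%N = (k < j)%N.
Proof.
move=> jk h1 h2.
have n0 : (j : nat) != k by [].
have n1 : ~ ((j : nat) = i /\ (k : nat) = i').
  by case=> /val_inj e1 /val_inj e2; move: h1; rewrite e1 e2 eqxx.
have n2 : ~ ((j : nat) = i' /\ (k : nat) = i).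
  by case=> /val_inj e1 /val_inj e2; move: h2; rewrite e1 e2 eqxx.
clear jk h1 h2.
case: (tpermP i i' k) => [/(congr1 val)/= e1|/(congr1 val)/= e1|/eqP e1 /eqP f1];
case: (tpermP i i' j) => [/(congr1 val)/= e2|/(congr1 val)/= e2|/eqP e2 /eqP f2];
rewrite -?val_eqE /= in e1 e2; try rewrite -val_eqE /= in f1;
try rewrite -val_eqE /= in f2; lia.
Qed.

Lemma SY j k x : j != k -> (j, k) != (i, i') -> (j, k) != (i', i) ->
  Sop i i' (Yop j k x) = Yop (tperm i i' j) (tperm i i' k) (Sop i i' x).
Proof.
move=> jk h1 h2; apply: smf_eq => q Uq; have Usq := regular_swq i i' Uq.
have jk' : tperm i i' j != tperm i i' k by rewrite (inj_eq (@perm_inj _ _)).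
have Uq' := regular_swq (tperm i i' j) (tperm i i' k) Uq.
rewrite (SopE _ _ _ Uq) (YopE _ jk Usq) (YopE _ jk' Uq) (SopE _ _ _ Uq') -swq_conj.
by rewrite /Ve !ex_swq ltn_adj.
Qed.

(** The exchange leads to the other branch of the potential, and the two branches differ by
    [-(v(x, y) + v(y, x)) = beta]. *)
Lemma SYii' x : Sop i i' (Yop i i' x) = Yop i' i (Sop i i' x) + beta *: x.
Proof.
have ne : i != i' by rewrite -val_eqE /= ii'; lia.
have en : i' != i by rewrite eq_sym.
apply: smf_eq => q Uq; have Usq := regular_swq i i' Uq.
rewrite smfD smfZ (SopE _ _ _ Uq) (YopE _ ne Usq) (YopE _ en Uq).
rewrite (SopE _ _ _ (regular_swq _ _ Uq)) (swqC i i').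
have -> : swq i i' (swq i i' q) = q by apply/rowP => k; rewrite !swqE tpermK.
rewrite /Ve !ex_swq tpermL tpermR ii' ltnSn ltnNge leqnSn /=.
have n := ex_neq Uq ne; have n' := ex_neq Uq en.
by field; rewrite ?n ?n'.
Qed.

End AdjacentSwap.

Lemma csinh2E i j q : (csinh (gam * RtoC (A (q 0 i) - A (q 0 j)))) ^+ 2 =
  (ex q i - ex q j) ^+ 2 / (4%:R * ex q i * ex q j).
Proof.
have e : cexp (gam * RtoC (A (q 0 i) - A (q 0 j))) ^+ 2 = ex q j / ex q i.
  rewrite expr2 -cexpD -ex_sub; congr cexp.
  by rewrite !RtoCB; ring.
rewrite /csinh cexpN; set z := cexp _ in e *.
have z0 : z != 0 by exact: cexp_neq0.
have -> : ((z - z^-1) / 2) ^+ 2 = (z ^+ 2 - 2 + (z ^+ 2)^-1) / 4%:R by field.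
rewrite e; have n1 := ex_neq0 q i; have n2 := ex_neq0 q j.
by field; rewrite n1 n2.
Qed.

(* The two terms carrying [a d/dq] cancel between [(l, k)] and [(k, l)]. *)
Lemma pair_sum l k x q : l != k -> regular gam A q ->
  (Dop l (Yop l k x) + Yop l k (Dop l x) + Yop l k (Yop l k x)
   + (Dop k (Yop k l x) + Yop k l (Dop k x) + Yop k l (Yop k l x))) q =
  (gam * beta * x (swq l k q) - beta ^+ 2 / 2 * x q)
   / (csinh (gam * RtoC (A (q 0 l) - A (q 0 k)))) ^+ 2.
Proof.
move=> lk Uq; have kl : k != l by rewrite eq_sym.
have Usq := regular_swq l k Uq.
have sw2 : swq l k (swq l k q) = q by apply/rowP => j; rewrite !swqE tpermK.
have e1 := DYE l x lk Uq; have e2 := DYE k x kl Uq.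
rewrite tpermL in e1; rewrite tpermL (swqC l k) in e2.
have e3 : Yop l k (Yop l k x) q = Ve l k q * (Ve l k (swq l k q) * x q).
  by rewrite (YopE _ lk Uq) (YopE _ lk Usq) sw2.
have e4 : Yop k l (Yop k l x) q = Ve l k q * (Ve l k (swq l k q) * x q).
  rewrite (YopE _ kl Uq) (swqC l k) (YopE _ kl Usq) (swqC l k) sw2 !(Ve_anti _ lk); ring.
rewrite !smfD e1 e2 e3 e4 (YopE _ lk Uq) (YopE _ kl Uq) (swqC l k) (Ve_anti _ lk).
have -> : thV k k l q = Wc l k q.
  by rewrite /thV eqxx /Wc; have := ex_neq Uq lk; have := ex_neq Uq kl => n n'; field; rewrite n n'.
have -> : thV l l k q = Wc l k q by rewrite /thV eqxx.
have -> : Ve l k q * (Ve l k (swq l k q) * x q) =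
   - beta ^+ 2 * ex q l * ex q k / (ex q l - ex q k) ^+ 2 * x q.
  rewrite /Ve !ex_swq tpermL tpermR; have := ex_neq Uq lk; have := ex_neq Uq kl => n n'.
  by case: (k < l)%N; field; rewrite n n'.
rewrite csinh2E /Wc; have := ex_neq Uq lk => n; have n1 := ex_neq0 q l; have n2 := ex_neq0 q k.
by field; rewrite n n1 n2.
Qed.

(** * Abstract results applied to the model: the Hamiltonian and the integrals *)

Local Notation ev := (@smf_ev R N regset).
Let Dl (l : 'I_N) : {linear F -> F} := Dop l.
Let Yl (l k : 'I_N) : {linear F -> F} := Yop l k.
Local Notation dk := (dunkl Dl Yl).
Let evZ : forall q c (x : F), ev q (c *: x) = c * ev q x := @smf_evZ R N regset.
Let ev_inj : forall x y : F, (forall q, ev q x = ev q y) -> x = y := @smf_ev_inj R N regset.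

Lemma dkC l m x : dk l (dk m x) = dk m (dk l x).
Proof. apply: (@dunkl_comm _ _ _ (fun q => ev q : {additive F -> R[i]}) ev_inj N Dl Yl).
- exact: DD.
- exact: Yanti.
- exact: DYfar.
- exact: DYnear.
- exact: YYfar.
- exact: YYcyc. Qed.

Lemma sum_dk2 x : \sum_l dk l (dk l x) = \sum_l Dop l (Dop l x) +
  \sum_l \sum_(k | k != l) (Dop l (Yop l k x) + Yop l k (Dop l x) + Yop l k (Yop l k x)).
Proof. apply: (@sum_dunkl2 _ _ _ (fun q => ev q : {additive F -> R[i]}) ev_inj N Dl Yl).
exact: YYcyc. Qed.

Lemma dk_hecke (i i' : 'I_N) x : i' = i.+1 :> nat ->
  Sop i i' (dk i x) = dk i' (Sop i i' x) + beta *: x.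
Proof.
move=> ii'; have ne : i != i' by rewrite -val_eqE /= ii'; lia.
exact: (dunkl_hecke (S := Sop i i' : {linear F -> F}) ne (SD i i') (SY ii') (SYii' ii')).
Qed.

Lemma dk_hecke' (i i' : 'I_N) x : i' = i.+1 :> nat ->
  Sop i i' (dk i' x) = dk i (Sop i i' x) - beta *: x.
Proof.
move=> ii'; have ne : i != i' by rewrite -val_eqE /= ii'; lia.
exact: (dunkl_hecke' (S := Sop i i' : {linear F -> F}) ne (Sinv i i') (SD i i') (SY ii') (SYii' ii')).
Qed.

Lemma dk_far (i i' j : 'I_N) x : i' = i.+1 :> nat -> j != i -> j != i' ->
  Sop i i' (dk j x) = dk j (Sop i i' x).
Proof.
move=> ii'.
exact: (dunkl_far (S := Sop i i' : {linear F -> F}) (SD i i') (SY ii')).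
Qed.

Definition Hop (x : F) : F := \sum_l dk l (dk l x).

Lemma Hop_linear : linear Hop.
Proof.
move=> c x y; rewrite /Hop scaler_sumr -big_split; apply: eq_bigr => l _ /=.
by rewrite !linearP.
Qed.
HB.instance Definition _ := GRing.isLinear.Build R[i] F F _ Hop Hop_linear.

Lemma Hop_dk l x : Hop (dk l x) = dk l (Hop x).
Proof.
rewrite /Hop raddf_sum; apply: eq_bigr => m _ /=.
by rewrite (dkC m l) (dkC m l).
Qed.

(** The two neighbouring squares acquire the corrections [beta (d_i + d_i')] and
    [- beta (d_i + d_i')], which cancel. *)
Lemma Hop_S (i i' : 'I_N) x : i' = i.+1 :> nat -> Sop i i' (Hop x) = Hop (Sop i i' x).
Proof.
move=> ii'; have ne : i' != i by rewrite -val_eqE /= ii'; lia.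
rewrite /Hop (raddf_sum (Sop i i')) /= (bigD1 i) //= (bigD1 i') //= [RHS](bigD1 i) //=.
rewrite [X in _ = _ + X](bigD1 i') //= !addrA; congr (_ + _); last first.
  by apply: eq_bigr => j /andP[h1 h2]; rewrite !dk_far.
rewrite !dk_hecke // !dk_hecke' // (linearD (dk i')) (linearB (dk i)) /= !linearZ /=.
apply: ev_inj => q; rewrite !(raddfD, raddfN, raddfB, evZ) /=; ring.
Qed.

(* The [k.+1]-st elementary symmetric polynomial in the Dunkl operators. *)
Definition ek (k : 'I_N) (x : F) : F := mulzs (fun i => dk i) (enum 'I_N) (seq0 x) k.+1.

Lemma ek_linear k : linear (ek k).
Proof.
move=> c x y.
exact: (mulzs_linear (fun i => dk i : {linear F -> F}) (enum 'I_N) c x y k.+1).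
Qed.
HB.instance Definition _ k := GRing.isLinear.Build R[i] F F _ (ek k) (ek_linear k).

Lemma seq0_comp (Z : {linear F -> F}) x : seq0 (Z x) = (fun k => Z (seq0 x k)).
Proof. by apply/funext => -[|k]; rewrite /seq0 //= linear0. Qed.

Lemma ek_comm (Z : {linear F -> F}) k x : (forall l x, dk l (Z x) = Z (dk l x)) ->
  ek k (Z x) = Z (ek k x).
Proof.
move=> dZ; rewrite /ek seq0_comp.
by rewrite (mulzs_comp (Z := Z)) // => i y _; exact: dZ.
Qed.

Lemma ek_dk k l x : ek k (dk l x) = dk l (ek k x).
Proof. by apply: (ek_comm (Z := dk l)) => m y; exact: dkC. Qed.

Lemma ek_ek k l x : ek k (ek l x) = ek l (ek k x).
Proof. by apply: (ek_comm (Z := ek l)) => m y; rewrite /= ek_dk. Qed.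

Lemma ek_Hop k x : ek k (Hop x) = Hop (ek k x).
Proof. by apply: (ek_comm (Z := Hop)) => m y; rewrite /= Hop_dk. Qed.

Lemma ek_S (i i' : 'I_N) k x : i' = i.+1 :> nat -> ek k (Sop i i' x) = Sop i i' (ek k x).
Proof.
move=> ii'.
have := @hecke_central _ _ _ (fun q => ev q : {additive F -> R[i]}) evZ ev_inj N (fun i => dk i : {linear F -> F}) dkC i i'
  (Sop i i' : {linear F -> F}) beta ii' (fun x => dk_hecke x ii') (fun x => dk_hecke' x ii')
  (fun j x => @dk_far i i' j x ii') 0 (enum 'I_N) (seq0 x) erefl.
rewrite -(seq0_comp (Sop i i')) => /(congr1 (fun f => f k.+1)).
have -> : (fun (j : 'I_N) (y : F) => (dk j : {linear F -> F}) y + 0 *: y) = (fun j => dk j).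
  by apply/funext => j; apply/funext => y; rewrite scale0r addr0.
by [].
Qed.

(** * Wave functions with spin and their representatives *)

Variable n : nat.
Hypothesis tau2 : tau * tau = 1.
Local Notation spins := ('I_N -> 'I_n).
Local Notation V := (spins -> F).
Local Notation wfn := (wf R N n).

(** Links wave functions, defined everywhere but compared on the regular set only, to spin-indexed
    families in the module. *)
Definition rep (phi : wfn) (Phi : V) : Prop :=
  forall s q, regular gam A q -> phi q s = Phi s q.

Lemma rep_eqU phi psi Phi : eqU gam A phi psi -> rep phi Phi -> rep psi Phi.
Proof. by move=> e h s q Uq; rewrite -e // h. Qed.

Lemma rep_eqU2 phi psi Phi : rep phi Phi -> rep psi Phi -> eqU gam A phi psi.
Proof. by move=> h1 h2 q Uq s; rewrite h1 // h2. Qed.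

Lemma iter_pdE (l : seq 'I_N) (phi : wfn) s q :
  iter_pd l phi q s = foldr (@pds R N) (fun x => phi x s) l q.
Proof.
elim: l q => [//|i l IH] q.
have E : (fun t => iter_pd l phi (upd q i t) s) =
   (fun t => foldr (@pds R N) (fun x => phi x s) l (upd q i t)).
  by apply/funext => t; rewrite IH.
exact: (congr1 (fun c : R -> R[i] => Complex (derive1 (fun t => Re (c t)) (q 0 i))
  (derive1 (fun t => Im (c t)) (q 0 i))) E).
Qed.

Lemma smooth_onP (phi : wfn) :
  smooth_on (regular gam A) phi <-> forall s, smooth1 regset (fun q => phi q s).
Proof.
have e l s : (fun q => iter_pd l phi q s) = foldr (@pds R N) (fun x => phi x s) l.
  by apply/funext => q; exact: iter_pdE.
split=> [h s l q Uq | h l s q Uq].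
  have [c1 [c2 d]] := h l s q Uq; split.
    by split; [move: c1 | move: c2]; rewrite -e.
  move=> i; have [d1 d2] := d i; rewrite -e.
  by exists (Complex (derive1 (fun t => Re (iter_pd l phi (upd q i t) s)) (q 0 i))
     (derive1 (fun t => Im (iter_pd l phi (upd q i t) s)) (q 0 i))); exact: is_dC_ex.
have [[c1 c2] d] := h s l q Uq; rewrite -e in c1 c2 d.
split=> //; split=> // i; have [c [d1 d2]] := d i.
by split; apply: ex_derive.
Qed.

Lemma smooth_rep (phi : wfn) : smooth_on (regular gam A) phi ->
  rep phi (fun s => mksm regset (fun q => phi q s)).
Proof. by move=> /smooth_onP sm s q Uq; rewrite mksmE. Qed.

Lemma rep_mksm phi Phi s : rep phi Phi -> mksm regset (fun q => phi q s) = Phi s.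
Proof.
move=> h; apply: smf_eq => q Uq; rewrite mksmE ?h //.
apply: (smooth1_eq oU _ (@smf_smooth _ _ _ (Phi s))) => p Up.
by rewrite h.
Qed.

(** The regular set is open, so the derivative at one of its points sees only values where [phi] and
    [Phi] agree. *)
Lemma rep_pd i phi Phi s q : rep phi Phi -> regular gam A q ->
  pd i phi q s = pds i (Phi s) q.
Proof.
move=> h Uq.
have e : nbhs q (fun p : RN => Phi s p = phi p s).
  by apply: (near_eqU oU Uq) => p Up; rewrite h.
rewrite -[LHS]/(pds i (fun x => phi x s) q).
by rewrite (pds_val (pdC_near e (pdsP i (@smf_smooth _ _ _ (Phi s)) Uq))).
Qed.

Lemma dkE l x q : regular gam A q ->
  dk l x q = Dop l x q + \sum_(k | k != l) Ve l k q * x (swq l k q).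
Proof.
move=> Uq; rewrite /dunkl smfD smf_sum; congr (_ + _).
by apply: eq_bigr => k kl; rewrite YopE // eq_sym.
Qed.

Lemma rep_dop l phi Phi : rep phi Phi -> rep (dop lam gam tau a A l phi) (fun s => dk l (Phi s)).
Proof.
move=> h s q Uq; rewrite dkE // /dop (rep_pd l s h Uq) -addrA DopE //; congr (_ + _).
rewrite [RHS](bigID (fun k : 'I_N => (k < l)%N)) /=; congr (_ + _).
  apply: eq_big => [k|k kl].
    by rewrite -val_eqE /=; case: ltngtP.
  have lk : l != k by rewrite -val_eqE /=; lia.
  rewrite -(VcE Uq lk) /Vc kl; congr (_ * _); rewrite /Ppos -h; last exact: regular_swq.
  by rewrite -/(swq k l q) swqC.
rewrite -sumrN; apply: eq_big => [k|k kl].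
  by rewrite -val_eqE /=; case: ltngtP.
have lk : l != k by rewrite -val_eqE /=; lia.
rewrite -(VcE Uq lk) /Vc ltnNge ltnW // mulNr; congr (- (_ * _)).
by rewrite /Ppos -h //; exact: regular_swq.
Qed.

(** * Simultaneous exchanges and the symmetrizer *)

Definition Kop (i j : 'I_N) (Phi : V) : V :=
  fun s => Sop i j (Phi (fun k => s (tperm i j k))).

Lemma rep_K i j phi Phi : rep phi Phi -> rep (Pspin i j (Ppos i j phi)) (Kop i j Phi).
Proof.
move=> h s q Uq; rewrite /Kop SopE // /Pspin /Ppos -/(swq i j q) h //.
exact: regular_swq.
Qed.

Lemma Kop_linear i j : linear (Kop i j).
Proof. by move=> c x y; apply/funext => s; rewrite /Kop linearP. Qed.
HB.instance Definition _ i j := GRing.isLinear.Build R[i] V V _ (Kop i j) (Kop_linear i j).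

Lemma tperm_comp (i j l k m : 'I_N) :
  tperm i j (tperm l k m) = tperm (tperm i j l) (tperm i j k) (tperm i j m).
Proof.
case: (tpermP l k m) => [->|->|/eqP ml /eqP mk].
- by rewrite tpermL.
- by rewrite tpermR.
- by rewrite [RHS]tpermD // (inj_eq (@perm_inj _ _)) eq_sym.
Qed.

Lemma SopC i j l k x :
  Sop i j (Sop l k x) = Sop (tperm i j l) (tperm i j k) (Sop i j x).
Proof.
apply: smf_eq => q Uq; rewrite !SopE //; try exact: regular_swq.
by rewrite swq_conj.
Qed.

Lemma KopC i j l k Phi :
  Kop i j (Kop l k Phi) = Kop (tperm i j l) (tperm i j k) (Kop i j Phi).
Proof.
apply/funext => s; rewrite /Kop SopC; congr (Sop _ _ (Sop _ _ (Phi _))).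
by apply/funext => m; rewrite tperm_comp.
Qed.

Lemma KopK i j Phi : Kop i j (Kop i j Phi) = Phi.
Proof.
apply/funext => s; rewrite /Kop Sinv; congr Phi.
by apply/funext => m; rewrite tpermK.
Qed.

Lemma Kop_sym i j Phi : Kop i j Phi = Kop j i Phi.
Proof.
apply/funext => s; rewrite /Kop tpermC.
by apply: smf_eq => q Uq; rewrite !SopE // swqC.
Qed.

Definition symV (Phi : V) : Prop := forall i j, i != j -> Kop i j Phi = tau *: Phi.

(** Conjugating the exchange of [i] and [j] by that of [j] and [j + 1] gives the exchange of [i] and
    [j + 1]; the extra factors disappear because [tau^2 = 1]. *)
Lemma symV_adj Phi :
  (forall i i' : 'I_N, i' = i.+1 :> nat -> Kop i i' Phi = tau *: Phi) -> symV Phi.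
Proof.
move=> h.
have lt (i : 'I_N) m (hm : (m < N)%N) : (i < m)%N -> Kop i (Ordinal hm) Phi = tau *: Phi.
  elim: m hm => [//|m IH] hm; rewrite ltnS leq_eqVlt => /orP[/eqP e|im].
    by apply: h; rewrite /= e.
  have hm' : (m < N)%N by apply: ltnW.
  pose j := Ordinal hm'; pose j' := Ordinal hm.
  have jj' : Kop j j' Phi = tau *: Phi by apply: h.
  have E := KopC j j' i j Phi.
  have ij : j != i by rewrite -val_eqE /=; lia.
  have ij' : j' != i by rewrite -val_eqE /=; lia.
  rewrite (tpermD ij ij') tpermL (IH hm' im) jj' !(linZ (Kop _ _)) /= jj' in E.
  have := congr1 ( *:%R tau) E; rewrite !scalerA tau2 scale1r => <-.
  by rewrite mul1r.
move=> i j ij; case: (ltngtP i j) => [|ji|/val_inj e]; last by rewrite e eqxx in ij.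
  by case: j {ij} => m hm; exact: lt.
by rewrite Kop_sym; case: i ji {ij} => m hm; exact: lt.
Qed.

Definition Xop (j : 'I_N) (Phi : V) : V := Phi + tau *: \sum_(i < N | (i < j)%N) Kop i j Phi.

Lemma Xop_linear j : linear (Xop j).
Proof.
move=> c x y; rewrite /Xop.
have -> : \sum_(i < N | (i < j)%N) Kop i j (c *: x + y) =
   c *: (\sum_(i < N | (i < j)%N) Kop i j x) + \sum_(i < N | (i < j)%N) Kop i j y.
  by rewrite scaler_sumr -big_split; apply: eq_bigr => i _; rewrite linearP.
by rewrite !scalerDr !scalerA (mulrC tau) addrACA.
Qed.
HB.instance Definition _ j := GRing.isLinear.Build R[i] V V _ (Xop j) (Xop_linear j).

Definition Slist (l : seq 'I_N) (Phi : V) : V := foldr Xop Phi [seq j : 'I_N <- l | (0 < j)%N].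
Definition LamV (Phi : V) : V := (N`!%:R)^-1 *: Slist (enum 'I_N) Phi.

Lemma rep_Lam1 phi Phi : rep phi Phi -> rep (Lam1 tau phi) (LamV Phi).
Proof.
move=> h s q Uq; rewrite /Lam1 /LamV; congr (_ * _).
rewrite /Slist; elim: [seq j <- _ | _] s q Uq => [|j l IH] s q Uq /=; first exact: h.
rewrite /sym_factor /Xop -[RHS]/((foldr Xop Phi l s) q + tau * ((\sum_(i < N | (i < j)%N) Kop i j (foldr Xop Phi l)) s) q).
rewrite IH //; congr (_ + _ * _); rewrite fct_sumE smf_sum; apply: eq_bigr => i _.
by rewrite (rep_K i j IH).
Qed.

(** An exchange below [j] only permutes the summands of [Xop j]. *)
Lemma Xop_comm (j k l : 'I_N) Phi : (k < j)%N -> (l < j)%N ->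
  Xop j (Kop k l Phi) = Kop k l (Xop j Phi).
Proof.
move=> kj lj; rewrite /Xop (linD (Kop k l)) (linZ (Kop k l)) (raddf_sum (Kop k l)); congr (_ + _ *: _).
have nk : k != j by rewrite -val_eqE /= neq_ltn kj.
have nl : l != j by rewrite -val_eqE /= neq_ltn lj.
rewrite [LHS](reindex_inj (@perm_inj _ (tperm k l))) /=; apply: eq_big => [i|i _].
  by case: (tpermP k l i) => [->|->|//]; rewrite kj lj.
by rewrite /= [RHS]KopC (tpermD nk nl).
Qed.

Lemma Slist_comm (j : 'I_N) (l : seq 'I_N) Phi : (forall i, i \in l -> (i < j)%N) ->
  Slist l (Xop j Phi) = Xop j (Slist l Phi).
Proof.
rewrite /Slist; elim: l => [//|i l IH] hl.
have il : (i < j)%N by apply: hl; rewrite mem_head.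
have {}IH : foldr Xop (Xop j Phi) [seq j0 : 'I_N <- l | (0 < j0)%N] =
   Xop j (foldr Xop Phi [seq j0 : 'I_N <- l | (0 < j0)%N]).
  by apply: IH => k kl; apply: hl; rewrite inE kl orbT.
rewrite /=; case: ifP => _ //=; rewrite IH.
move: (foldr Xop Phi _) => Psi.
rewrite [LHS]/(Xop j Psi + tau *: \sum_(k < N | (k < i)%N) Kop k i (Xop j Psi)).
rewrite [X in _ = Xop j X]/(Psi + tau *: \sum_(k < N | (k < i)%N) Kop k i Psi).
rewrite (linD (Xop j)) (linZ (Xop j)) (raddf_sum (Xop j)).
congr (_ + _ *: _); apply: eq_bigr => k ki; rewrite /= Xop_comm //.
exact: ltn_trans il.
Qed.

(** Induction on the number of factors. By commutation the new factor can stand innermost, which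
    settles the exchanges among earlier indices, or outermost, which settles those with the new
    index [o]. *)
Lemma Slist_sym m Phi : (m <= N)%N -> forall k l : 'I_N, k != l -> (k < m)%N -> (l < m)%N ->
  Kop k l (Slist (take m (enum 'I_N)) Phi) = tau *: Slist (take m (enum 'I_N)) Phi.
Proof.
elim: m Phi => [//|m IH] Phi hm.
pose o := Ordinal hm.
have tk : take m.+1 (enum 'I_N) = rcons (take m (enum 'I_N)) o.
  rewrite (take_nth o) ?size_enum_ord //; congr rcons; apply: val_inj.
  by rewrite /= nth_enum_ord.
have [m0|m0] := posnP m.
  move=> k l kl; rewrite m0 !ltnS !leqn0 => /eqP k0 /eqP l0.
  by case/eqP: kl; apply: val_inj; rewrite /= k0 l0.
have sE : Slist (take m.+1 (enum 'I_N)) Phi = Slist (take m (enum 'I_N)) (Xop o Phi).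
  by rewrite tk /Slist filter_rcons /= m0 foldr_rcons.
have sE' : Slist (take m.+1 (enum 'I_N)) Phi = Xop o (Slist (take m (enum 'I_N)) Phi).
  rewrite sE Slist_comm // => i /(nthP o)[x]; rewrite size_take size_enum_ord hm => xm <-.
  by rewrite nth_take // nth_enum_ord // (ltn_trans xm).
have key (k : 'I_N) : (k < m)%N ->
  Kop k o (Slist (take m.+1 (enum 'I_N)) Phi) = tau *: Slist (take m.+1 (enum 'I_N)) Phi.
  move=> km; rewrite sE'; have {}IH := IH Phi (ltnW hm).
  move: (Slist _ Phi) IH => Psi IH.
  have ko : k != o by rewrite -val_eqE /= neq_ltn km.
  rewrite /Xop (linD (Kop k o)) (linZ (Kop k o)) (raddf_sum (Kop k o)) (bigD1 k) //= KopK.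
  rewrite [X in _ = _ *: (_ + _ *: X)](bigD1 k) //=.
  have -> : \sum_(i < N | (i < m)%N && (i != k)) Kop k o (Kop i o Psi) =
      tau *: \sum_(i < N | (i < m)%N && (i != k)) Kop i o Psi.
    rewrite scaler_sumr; apply: eq_bigr => i /andP[im ik].
    have io : i != o by rewrite -val_eqE /= neq_ltn im.
    have ki : k != i by rewrite eq_sym.
    (* Moved to the right, [Kop k o] becomes an exchange below [o], on which the induction
       hypothesis yields [tau]. *)
    have -> : Kop k o (Kop i o Psi) = Kop i o (Kop i k Psi).
      by rewrite [RHS]KopC tpermL tpermD 1?eq_sym // 1?eq_sym // Kop_sym.
    by rewrite IH // (linZ (Kop i o)) /=.
  by rewrite !scalerDr !scalerA tau2 !scale1r addrCA.
move=> k l kl; rewrite ltnS (leq_eqVlt k) ltnS (leq_eqVlt l) => /orP[/eqP ek|km] /orP[/eqP el|lm].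
- by case/eqP: kl; apply: val_inj; rewrite /= ek el.
- by rewrite Kop_sym (_ : k = o) ?key //; apply: val_inj.
- by rewrite (_ : l = o) ?key //; apply: val_inj.
- by rewrite sE IH // ltnW.
Qed.

Lemma LamV_sym Phi : symV (LamV Phi).
Proof.
move=> i j ij; rewrite /LamV (linZ (Kop i j)) /=.
have := Slist_sym Phi (leqnn N) ij (ltn_ord i) (ltn_ord j).
by rewrite take_oversize ?size_enum_ord //= => ->; rewrite !scalerA mulrC.
Qed.

(** On a symmetric vector [Xop j] acts as [1 + j tau^2 = j + 1], and these numbers multiply to the
    factorial of [N]. *)
Lemma LamV_id Phi : symV Phi -> LamV Phi = Phi.
Proof.
move=> sP.
have h l : foldr Xop Phi l = (\prod_(j <- l) (j : nat).+1)%:R *: Phi.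
  elim: l => [|j l IH] /=; first by rewrite big_nil scale1r.
  rewrite IH (linZ (Xop j)) /= big_cons; have -> : Xop j Phi = (j : nat).+1%:R *: Phi.
    rewrite /Xop (eq_bigr (fun=> tau *: Phi)); last first.
      by move=> i ij; rewrite sP // -val_eqE /= neq_ltn ij.
    rewrite sumr_const -scaler_nat scalerA scalerA -mulrA mulrCA tau2 mulr1.
    have -> : #|[pred i : 'I_N | (i < j)%N]| = j.
      by rewrite -sum1_card (big_ord_narrow (F := fun=> 1%N) (ltnW (ltn_ord j))) sum1_card card_ord.
    by rewrite [in RHS]mulrS scalerDl scale1r.
  by rewrite scalerA -natrM mulnC.
rewrite /LamV /Slist h scalerA big_filter big_enum_cond /=.
have -> : (\prod_(j < N | (0 < j)%N) j.+1 = N`!)%N.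
  rewrite fact_prod big_add1 big_mkord [RHS](bigID (fun j : 'I_N => (0 < j)%N)) /=.
  rewrite [X in (_ * X)%N]big1 ?muln1 // => j; rewrite -leqNgt leqn0 => /eqP -> //.
by rewrite mulVf ?scale1r // pnatr_eq0 -lt0n fact_gt0.
Qed.

(** The symmetrizer maps into the symmetric vectors by [LamV_sym] and fixes them by [LamV_id]. *)
Lemma inL1P (phi : wfn) : inL1 gam tau A phi <-> exists2 Phi, rep phi Phi & symV Phi.
Proof.
split=> [[psi [sm e]]|[Phi rP sP]].
  exists (LamV (fun s => mksm regset (fun q => psi q s))); last exact: LamV_sym.
  move=> s q Uq; rewrite e //; apply: rep_Lam1 => //; exact: smooth_rep.
exists (fun q s => Phi s q); split.
  by apply/smooth_onP => s; exact: smf_smooth.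
move=> q Uq s; rewrite rP // -{1}(LamV_id sP); apply/esym.
exact: (rep_Lam1 (phi := fun q s => Phi s q)).
Qed.

Lemma rep_Htilde phi Phi : rep phi Phi ->
  rep (Htilde lam gam tau a A phi) (fun s => Hop (LamV Phi s)).
Proof.
move=> h s q Uq; rewrite /Htilde /Hop smf_sum; apply: eq_bigr => l _.
by apply: (rep_dop l (rep_dop l (rep_Lam1 h))).
Qed.

Lemma symV_map (Z : {linear F -> F}) Phi :
  (forall (i i' : 'I_N) x, i' = i.+1 :> nat -> Z (Sop i i' x) = Sop i i' (Z x)) ->
  symV Phi -> symV (fun s => Z (Phi s)).
Proof.
move=> ZS sP; apply: symV_adj => i i' ii'; apply/funext => s.
rewrite /Kop -ZS //; have ne : i != i' by rewrite -val_eqE /= ii'; lia.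
have := congr1 (fun f => f s) (sP i i' ne); rewrite /Kop => ->.
by rewrite -[(tau *: Phi) s]/(tau *: Phi s) (linZ Z).
Qed.

Lemma symV_Hop Phi : symV Phi -> symV (fun s => Hop (Phi s)).
Proof. by apply: (symV_map (Z := Hop)) => i i' x ii'; rewrite /= Hop_S. Qed.

Lemma symV_ek k Phi : symV Phi -> symV (fun s => ek k (Phi s)).
Proof. by apply: (symV_map (Z := ek k)) => i i' x ii'; rewrite /= ek_S. Qed.

(** * The explicit form of the Hamiltonian *)

Hypothesis gam0 : gam != 0.

Lemma sum_pairs (W : zmodType) (G : 'I_N -> 'I_N -> W) :
  \sum_(l < N) \sum_(k | k != l) G l k = \sum_(l < N) \sum_(k < N | (l < k)%N) (G l k + G k l).
Proof.
have -> : \sum_(l < N) \sum_(k | k != l) G l k =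
    \sum_(l < N) \sum_(k < N | (l < k)%N) G l k + \sum_(l < N) \sum_(k < N | (k < l)%N) G l k.
  rewrite -big_split; apply: eq_bigr => l _; rewrite (bigID (fun k : 'I_N => (l < k)%N)) /=.
  by congr (_ + _); apply: eq_bigl => k; rewrite -val_eqE /=; case: ltngtP.
rewrite [X in _ + X](exchange_big_dep predT) //= -big_split; apply: eq_bigr => l _.
by rewrite -big_split.
Qed.

(** Source of the spin exchange [P_ij] in the Hamiltonian: by symmetry it can replace the swap of
    positions. *)
Lemma symVE Phi l k s q : symV Phi -> l != k -> regular gam A q ->
  Phi s (swq l k q) = tau * Phi (fun m => s (tperm l k m)) q.
Proof.
move=> sP lk Uq.
have := congr1 (fun f : V => (f (fun m => s (tperm l k m)) : F) q) (sP l k lk).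
rewrite /Kop SopE // => E; rewrite -[RHS]/(((tau *: Phi) (fun m => s (tperm l k m)) : F) q) -E.
by congr (Phi _ _); apply/funext => m; rewrite tpermK.
Qed.

Lemma rep_Hexplicit phi Phi : symV Phi -> rep phi Phi ->
  rep (Hexplicit lam gam a A phi) (fun s => Hop (Phi s)).
Proof.
move=> sP h s q Uq; rewrite /Hop sum_dk2 sum_pairs smfD !smf_sum /Hexplicit.
congr (_ + _); apply: eq_bigr => l _.
  rewrite DDE // (rep_pd l s h Uq) -[pd l (pd l phi) q s]/(pds l (fun p => pd l phi p s) q).
  have e : nbhs q (fun p : RN => pds l (Phi s) p = pd l phi p s).
    by apply: (near_eqU oU Uq) => p Up; rewrite (rep_pd l s h Up).
  by rewrite (pds_val (pdC_near e (pdsP l (smooth1_pds l (@smf_smooth _ _ _ (Phi s))) Uq))).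
rewrite smf_sum; apply: eq_bigr => k lk.
have ne : l != k by rewrite -val_eqE /= neq_ltn lk.
rewrite pair_sum // csinh2E /Pspin !h //.
rewrite (symVE s sP ne Uq); have nz := ex_neq Uq ne.
have n1 := ex_neq0 q l; have n2 := ex_neq0 q k.
rewrite /Defs.beta exprMn [tau ^+ 2]expr2 tau2 mul1r.
(* One [tau] comes from [beta] and the other from trading positions for spins. *)
have -> : gam * (tau * lam) * (tau * Phi (fun m => s (tperm l k m)) q) =
  gam * lam * Phi (fun m => s (tperm l k m)) q * (tau * tau) by ring.
rewrite tau2; field.
by rewrite gam0 nz n1 n2.
Qed.

(** * The auxiliary space and Yangian symmetry *)

Local Notation V0 := ('I_n -> V).

Definition dV (i : 'I_N) (X : V0) : V0 := fun s0 s => dk i (X s0 s).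
Definition SV (i j : 'I_N) (X : V0) : V0 := fun s0 s => Sop i j (X s0 s).
Definition HV (X : V0) : V0 := fun s0 s => Hop (X s0 s).
Definition pV (i j : 'I_N) (X : V0) : V0 := fun s0 s => X s0 (fun k => s (tperm i j k)).
Definition PV (i : 'I_N) (X : V0) : V0 :=
  fun s0 s => X (s i) (fun k => if k == i then s0 else s k).

Lemma lift_linear (Z : {linear F -> F}) : linear (fun (X : V0) s0 s => Z (X s0 s)).
Proof. by move=> c X Y; apply/funext => s0; apply/funext => s; exact: (linearP Z). Qed.
HB.instance Definition _ i := GRing.isLinear.Build R[i] V0 V0 _ (dV i) (lift_linear (dk i)).
HB.instance Definition _ i j := GRing.isLinear.Build R[i] V0 V0 _ (SV i j) (lift_linear (Sop i j)).
HB.instance Definition _ := GRing.isLinear.Build R[i] V0 V0 _ HV (lift_linear Hop).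

Lemma pV_linear i j : linear (pV i j). Proof. by []. Qed.
HB.instance Definition _ i j := GRing.isLinear.Build R[i] V0 V0 _ (pV i j) (pV_linear i j).
Lemma PV_linear i : linear (PV i). Proof. by []. Qed.
HB.instance Definition _ i := GRing.isLinear.Build R[i] V0 V0 _ (PV i) (PV_linear i).

Definition ev0 (z : 'I_n * spins * RN) (X : V0) : R[i] := X z.1.1 z.1.2 z.2.
Lemma ev0_additive z : zmod_morphism (ev0 z). Proof. by []. Qed.
HB.instance Definition _ z := GRing.isZmodMorphism.Build V0 R[i] (ev0 z) (ev0_additive z).

Lemma ev0Z z (c : R[i]) X : ev0 z (c *: X) = c * ev0 z X. Proof. by []. Qed.

Lemma ev0_inj X Y : (forall z, ev0 z X = ev0 z Y) -> X = Y.
Proof.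
move=> h; apply/funext => s0; apply/funext => s; apply: smf_eq => q _.
exact: (h (s0, s, q)).
Qed.

Local Notation T0 := (tmono (fun i => dV i : {linear V0 -> V0}) (fun i => PV i : {linear V0 -> V0}) lam).

(** A neighbouring exchange factors as [pV] after [SV]; the Hecke relations for [SV] and the
    permutation rules for [pV] and [PV] are what [tmono_sym] asks for. *)
Lemma T0_sym (X : V0) k : (forall s0, symV (X s0)) -> forall s0, symV (T0 (enum 'I_N) X k s0).
Proof.
move=> sX s0; apply: symV_adj => i i' ii'.
have ne : i != i' by rewrite -val_eqE /= ii'; lia.
have ne' : i' != i by rewrite eq_sym.
have tE (m j : 'I_N) : (tperm i i' m == j) = (m == tperm i i' j).
  by rewrite -(inj_eq (@perm_inj _ (tperm i i'))) tpermK.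
suff : pV i i' (SV i i' (T0 (enum 'I_N) X k)) = tau *: T0 (enum 'I_N) X k.
  by move/(congr1 (fun f : V0 => f s0)).
apply: (@tmono_sym _ _ _ (fun z => ev0 z : {additive V0 -> R[i]}) ev0Z ev0_inj N
  (fun i => dV i : {linear V0 -> V0}) (fun i => PV i : {linear V0 -> V0}) lam _ _ i i'
  (SV i i' : {linear V0 -> V0}) (pV i i' : {linear V0 -> V0}) beta tau ii') => //=.
- by move=> j l Y; apply/funext => ?; apply/funext => ?; rewrite /dV dkC.
- by move=> Y; apply/funext => ?; apply/funext => ?; rewrite /SV /dV dk_hecke.
- by move=> Y; apply/funext => ?; apply/funext => ?; rewrite /SV /dV dk_hecke'.
- by move=> j Y h1 h2; apply/funext => ?; apply/funext => ?; rewrite /SV /dV dk_far.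
- move=> Y; apply/funext => ?; apply/funext => s; rewrite /pV; congr (Y _ _).
  by apply/funext => m; rewrite tpermK.
- move=> Y; apply/funext => t; apply/funext => s; rewrite /pV /PV tpermL; congr (Y _ _).
  by apply/funext => m; rewrite tE tpermR.
- move=> Y; apply/funext => t; apply/funext => s; rewrite /pV /PV tpermR; congr (Y _ _).
  by apply/funext => m; rewrite tE tpermL.
- move=> j Y h1 h2; apply/funext => t; apply/funext => s; rewrite /pV /PV.
  have tj : tperm i i' j = j by rewrite tpermD // eq_sym.
  by rewrite tj; congr (Y _ _); apply/funext => m; rewrite tE tj.
- move=> Y; apply/funext => t; apply/funext => s; rewrite /pV /PV (negPf ne') //.
  congr (Y _ _); apply/funext => m; rewrite tE tpermR.
  case: (tpermP i i' m) => [->|->|/eqP mi /eqP mi'].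
  + by rewrite (negPf ne) eqxx.
  + by rewrite eqxx (negPf ne').
  + by rewrite (negPf mi) (negPf mi').
- move=> Y; apply/funext => t; apply/funext => s; rewrite /pV /PV (negPf ne) //.
  congr (Y _ _); apply/funext => m; rewrite tE tpermL.
  case: (tpermP i i' m) => [->|->|/eqP mi /eqP mi'].
  + by rewrite eqxx (negPf ne).
  + by rewrite (negPf ne') eqxx.
  + by rewrite (negPf mi) (negPf mi').
- apply/funext => t; exact: (sX t i i' ne).
Qed.

Lemma T0_HV (X : V0) k : T0 (enum 'I_N) (HV X) k = HV (T0 (enum 'I_N) X k).
Proof.
apply: (@tmono_comm _ _ _ (fun z => ev0 z : {additive V0 -> R[i]}) ev0Z ev0_inj N
  (fun i => dV i : {linear V0 -> V0}) (fun i => PV i : {linear V0 -> V0}) lam HV) => // j Y.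
by apply/funext => s0; apply/funext => s; rewrite /= /dV /HV Hop_dk.
Qed.

Definition rep0 (phi : wf0 R N n) (X : V0) : Prop := forall s0, rep (phi s0) (X s0).
(** A simulation relation: it is checked for each combinator, so that the whole monodromy can be
    transported to the module. *)
Definition rep_op (T : op0 R N n) (Z : V0 -> V0) : Prop :=
  forall phi X, rep0 phi X -> rep0 (T phi) (Z X).

Lemma rep_dop0 i : rep_op (dop0 lam gam tau a A i) (dV i).
Proof. by move=> phi X h s0; exact: rep_dop (h s0). Qed.

Lemma rep_P0 i : rep_op (@P0 R N n i) (PV i).
Proof. by move=> phi X h s0 s q Uq; rewrite /P0 h. Qed.

Lemma rep_op_add S T Y Z : rep_op S Y -> rep_op T Z ->
  rep_op (op0_add S T) (fun X => Y X + Z X).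
Proof. by move=> hS hT phi X h s0 s q Uq; rewrite /op0_add (hS _ _ h) // (hT _ _ h). Qed.

Lemma rep_op_scale c T Z : rep_op T Z -> rep_op (op0_scale c T) (fun X => c *: Z X).
Proof. by move=> hT phi X h s0 s q Uq; rewrite /op0_scale (hT _ _ h). Qed.

Lemma rep_op_comp S T Y Z : rep_op S Y -> rep_op T Z ->
  rep_op (op0_comp S T) (fun X => Y (Z X)).
Proof. by move=> hS hT phi X h; apply: hS; apply: hT. Qed.

Lemma rep_op_iter k T Z : rep_op T Z -> rep_op (iter k T) (iter k Z).
Proof. by move=> hT; elim: k => // k IH phi X h /=; apply: hT; apply: IH. Qed.

Lemma rep_op_one k : rep_op (@ps_one R N n k) (fun X => if k == 0%N then X else 0).
Proof. by rewrite /ps_one; case: (k == 0%N). Qed.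

Lemma rep_op_inv T Z k : rep_op T Z -> rep_op (ps_inv_shift T k) (invs Z k).
Proof.
case: k => // k hT; exact: rep_op_scale (rep_op_iter k hT).
Qed.

Lemma rep_op_mul S T Y (Z : nat -> V0 -> V0) k : (forall j, rep_op (S j) (Y j)) ->
  (forall j, rep_op (T j) (Z j)) ->
  rep_op (ps_mul S T k) (fun X => pact Y (fun j => Z j X) k).
Proof.
move=> hS hT phi X h s0 s q Uq; rewrite /ps_mul /pact !fct_sumE smf_sum.
by apply: eq_bigr => j _; rewrite (hS _ _ _ (hT _ _ _ h)).
Qed.

Lemma rep_Lax i k : rep_op (Lax lam gam tau a A i k)
  (lax (fun i => dV i : {linear V0 -> V0}) (fun i => PV i : {linear V0 -> V0}) lam i k).
Proof.
apply: (rep_op_mul (Y := laxc _ lam i) (Z := laxe _ _ lam i)) => j.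
- apply: rep_op_add; first exact: rep_op_one.
  apply: rep_op_scale; apply: rep_op_inv.
  have := rep_op_add (rep_dop0 i) (rep_op_scale (- lam) (Z := fun X => X) (T := @op0_id R N n) _).
  rewrite (_ : (fun X : V0 => dV i X + _) = shiftd (fun i => dV i : {linear V0 -> V0}) lam i).
    by apply.
  by apply/funext => X; rewrite /shiftd scaleNr.
- apply: rep_op_add; first exact: rep_op_one.
  apply: rep_op_scale; apply: rep_op_comp; first exact: rep_P0.
  exact: rep_op_inv (rep_dop0 i).
Qed.

Lemma rep_Tmono k : rep_op (Tmono lam gam tau a A k) (fun X => T0 (enum 'I_N) X k).
Proof.
rewrite /Tmono /tmono; elim: (enum 'I_N) k => [|i l IH] k; first exact: rep_op_one.
by apply: rep_op_mul => // j; exact: rep_Lax.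
Qed.

Lemma rep_TLam k ai bi phi Phi : rep phi Phi ->
  rep (TLam_entry lam gam tau a A k ai bi phi)
    (T0 (enum 'I_N) (fun s0 => if s0 == bi then LamV Phi else 0) k ai).
Proof.
move=> h; rewrite /TLam_entry; apply: rep_Tmono => s0.
by case: (s0 == bi) => //; exact: rep_Lam1.
Qed.

(** On either side the outer symmetrizer meets a vector that is already symmetric and acts as the
    identity; there remains the commutation of [Hop] with the monodromy. *)
Lemma TLam_Htilde k ai bi phi Phi : rep phi Phi ->
  eqU gam A (Htilde lam gam tau a A (TLam_entry lam gam tau a A k ai bi phi))
    (TLam_entry lam gam tau a A k ai bi (Htilde lam gam tau a A phi)).
Proof.
move=> h; apply: rep_eqU2 (rep_Htilde (rep_TLam k ai bi h)) _.
have := rep_TLam k ai bi (rep_Htilde h).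
rewrite (LamV_id (symV_Hop (LamV_sym Phi))).
have -> : (fun s0 => if s0 == bi then fun s => Hop (LamV Phi s) else 0) =
  HV (fun s0 => if s0 == bi then LamV Phi else 0).
  apply/funext => s0; apply/funext => s; rewrite /HV; case: (s0 == bi) => //.
  by rewrite -[RHS]/(Hop 0) (raddf0 Hop).
set X := fun s0 => if s0 == bi then LamV Phi else 0.
have sX : symV (T0 (enum 'I_N) X k ai).
  apply: T0_sym => s0; rewrite /X; case: (s0 == bi); first exact: LamV_sym.
  by move=> i j _; rewrite (raddf0 (Kop i j)) scaler0.
by rewrite T0_HV (LamV_id sX).
Qed.

(** * Independence of the integrals *)

Lemma cexp_real_neq1 : exists2 e : R, 0 < e & forall r : R, r != 0 -> `|r| <= e ->
  cexp (- (2%:R) * gam * RtoC r) != 1.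
Proof.
have dpos : 0 < 2 * `|Im gam| + 1 by rewrite ltr_wpDl // mulr_ge0.
(* This radius keeps [|Im z| <= pi], below the period of the exponential; the [+ 1] covers real
   [gam]. *)
exists (pi / (2 * `|Im gam| + 1)); first by rewrite divr_gt0 // pi_gt0.
move=> r r0 re; apply: contra r0 => /eqP; set z := _ * RtoC r => e1.
have zi : `|Im z| <= pi.
  have -> : Im z = - (2 * Im gam * r).
    rewrite /z; case: gam => x y; rewrite /RtoC /=; ring.
  rewrite normrN !normrM (ger0_norm (ler0n _ 2)).
  apply: (@le_trans _ _ ((2 * `|Im gam|) * (pi / (2 * `|Im gam| + 1)))).
    by rewrite ler_wpM2l // mulr_ge0.
  rewrite mulrCA ler_piMr ?pi_ge0 // ler_pdivrMr // mul1r lerDl.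
  exact: ler01.
have := congr1 (@complex.Re R) e1; have := congr1 (@complex.Im R) e1; rewrite /cexp /=.
move=> /eqP; rewrite mulf_eq0 gt_eqF ?expR_gt0 //= => /eqP s0 c1.
(* As the sine vanishes, a positive cosine must be 1, and injectivity of [cos] on [[0, pi]] gives
   [Im z = 0]. *)
have cp : 0 < cos (Im z).
  by rewrite -(pmulr_rgt0 _ (expR_gt0 (Re z))) c1.
have c2 : cos (Im z) = 1.
  have := cos2Dsin2 (Im z); rewrite s0 expr0n addr0 => /eqP.
  by rewrite sqrf_eq1 => /orP[/eqP //|/eqP h]; move: cp; rewrite h oppr_gt0 ltr10.
have i0 : Im z = 0.
  apply/eqP; rewrite -normr_eq0; apply/eqP; apply: cos_inj.
  - by rewrite in_itv /= normr_ge0.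
  - by rewrite in_itv /= lexx pi_ge0.
  - by rewrite cos_norm cos0.
have rr0 : Re z = 0 by apply: expR_inj; rewrite expR0 -c1 c2 mulr1.
have : z = 0 by apply: eq_ReIm.
move/eqP; rewrite /z !mulf_eq0 oppr_eq0 pnatr_eq0 /= (negPf gam0) /=.
by rewrite RtoC_eq0.
Qed.

Lemma mul_ex : {m : {f : RN -> R[i] | gen regset A f} -> F -> F | forall f x q,
  regular gam A q -> m f x q = sval f q * x q}.
Proof.
exists (fun f x => mksm regset (fun q => sval f q * x q)) => f x q Uq.
rewrite mksmE //; apply: gensm; apply: genM; first exact: (svalP f).
by apply: gen_smooth; exact: smf_smooth.
Qed.
Definition mulF (f : RN -> R[i]) (gf : gen regset A f) : F -> F :=
  sval mul_ex (exist _ f gf).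

Lemma mulFE f (gf : gen regset A f) x q : regular gam A q -> mulF gf x q = f q * x q.
Proof. exact: (svalP mul_ex). Qed.

Lemma mulF_linear f (gf : gen regset A f) : linear (mulF gf).
Proof.
move=> c x y; apply: smf_eq => q Uq; rewrite smfD smfZ !mulFE // smfD smfZ; ring.
Qed.
HB.instance Definition _ f (gf : gen regset A f) :=
  GRing.isLinear.Build R[i] F F _ (mulF gf) (mulF_linear gf).

Local Notation delta := (A 1 - A 0).
(** Affine normalisation of [A], equal to 0 at position 0 and to 1 at position 1, so that every
    value in between is attained. *)
Definition gfun (i : 'I_N) (q : RN) : R[i] :=
  (RtoC (A (q 0 i)) + (- RtoC (A 0))) * (RtoC delta)^-1.
(** The prefactor is chosen so that [a(q_i) d/dq_i] of the phase is exactly [gfun i]. *)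
Definition phase (q : RN) : R[i] :=
  (RtoC delta / 2) * \sum_i gfun i q * gfun i q.
Definition gauss (t : R[i]) (q : RN) : R[i] := cexp (t * phase q).

Lemma gen_gfun i : gen regset A (gfun i).
Proof.
apply: genM; last exact: gen_cst.
by apply: genD; [exact: gen_A | exact: gen_cst].
Qed.

Lemma gen_phase : gen regset A phase.
Proof.
apply: genM; first exact: gen_cst.
elim: (index_enum _) => [|i l IH].
  by under eq_fun do rewrite big_nil; exact: gen_cst.
under eq_fun do rewrite big_cons; apply: genD => //.
by apply: genM; exact: gen_gfun.
Qed.

Lemma gen_gauss t : gen regset A (gauss t).
Proof. by apply: gen_cexp; apply: genM; [exact: gen_cst | exact: gen_phase]. Qed.

Local Notation Mop t := (mulF (gen_gauss t)).
Local Notation Gop i := (mulF (gen_gfun i)).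

Lemma gauss_swq t i j q : gauss t (swq i j q) = gauss t q.
Proof.
rewrite /gauss /phase; congr (cexp (_ * (_ * _))).
rewrite [RHS](reindex_inj (@perm_inj _ (tperm i j))) /=.
by apply: eq_bigr => k _; rewrite /gfun swqE.
Qed.

Hypothesis delta0 : delta != 0.

Lemma pdC_gauss t i q : pdC i (gauss t) q
  (t * (gfun i q * (RtoC (a (q 0 i)))^-1) * gauss t q).
Proof.
have dn : RtoC delta != 0 by rewrite RtoC_eq0.
have hg j : pdC i (gfun j) q (if j == i then (RtoC delta)^-1 * (RtoC (a (q 0 i)))^-1 else 0).
  have h := @pdC_real R N A (fun x => (a x)^-1) i j q hA.
  have := is_dCM (is_dCD h (is_dC_cst (- RtoC (A 0)) _)) (is_dC_cst (RtoC delta)^-1 _).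
  move/is_dC_eq; apply; rewrite mulr0 !addr0; case: eqP => [->|_]; last by rewrite mul0r.
  by rewrite RtoCV mulrC.
have hs (l : seq 'I_N) : pdC i (fun q => \sum_(j <- l) gfun j q * gfun j q) q
  (\sum_(j <- l) if j == i then 2 * gfun i q * ((RtoC delta)^-1 * (RtoC (a (q 0 i)))^-1) else 0).
  elim: l => [|j l IH].
    rewrite /pdC; under eq_fun do rewrite big_nil.
    by rewrite big_nil; exact: is_dC_cst.
  rewrite /pdC; under eq_fun do rewrite big_cons.
  rewrite big_cons; apply: is_dCD => //.
  have := is_dCM (hg j) (hg j); move/is_dC_eq; apply; rewrite upd_id.
  by case: eqP => [->|_]; ring.
have := is_dC_cexp (is_dCM (is_dC_cst t _) (is_dCM (is_dC_cst (RtoC delta / 2) _) (hs (index_enum _)))).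
move/is_dC_eq; apply; rewrite upd_id -big_mkcond big_pred1_eq /gauss; congr (_ * _).
rewrite !mul0r !add0r; congr (_ * _).
by field; rewrite dn RtoC_eq0 a0.
Qed.

Lemma Dop_Mop t i x : Dop i (Mop t x) = Mop t (Dop i x + t *: Gop i x).
Proof.
apply: smf_eq => q Uq; rewrite (DopE _ _ Uq) (mulFE _ _ Uq) smfD smfZ (DopE _ _ Uq) (mulFE _ _ Uq).
have hx := pdsP i (@smf_smooth _ _ _ x) Uq.
have e : nbhs q (fun p : RN => gauss t p * x p = Mop t x p).
  by apply: (near_eqU oU Uq) => p Up; rewrite mulFE.
rewrite (pds_val (pdC_near e (is_dCM (pdC_gauss t i q) hx))) !upd_id.
by field; rewrite RtoC_eq0 a0.
Qed.

Lemma Yop_Mop t l k x : l != k -> Yop l k (Mop t x) = Mop t (Yop l k x).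
Proof.
move=> lk; apply: smf_eq => q Uq.
rewrite (YopE _ lk Uq) !mulFE //; last exact: regular_swq.
by rewrite (YopE _ lk Uq) gauss_swq mulrCA.
Qed.

(** The symmetric factor [gauss t] passes through the swaps, so the shift comes from the derivative
    alone. *)
Lemma dk_Mop t i x : dk i (Mop t x) = Mop t (dk i x + t *: Gop i x).
Proof.
rewrite -[LHS]/(Dop i (Mop t x) + \sum_(k | k != i) Yop i k (Mop t x)).
rewrite -[dk i x]/(Dop i x + \sum_(k | k != i) Yop i k x).
rewrite Dop_Mop !(linD (Mop t)) [RHS]addrAC; congr (_ + _).
rewrite (raddf_sum (Mop t)); apply: eq_bigr => k ki /=.
by rewrite Yop_Mop // eq_sym.
Qed.

Lemma Sop_Mop t i j x : Sop i j (Mop t x) = Mop t (Sop i j x).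
Proof.
apply: smf_eq => q Uq; rewrite (SopE _ _ _ Uq) !mulFE //; last exact: regular_swq.
by rewrite (SopE _ _ _ Uq) gauss_swq.
Qed.

Definition mon (D : nat) (al : {ffun 'I_N -> 'I_D}) (x : F) : F :=
  foldr (fun k acc => iter (al k) (ek k) acc) x (enum 'I_N).

Definition gk (k : 'I_N) (x : F) : F :=
  mulzs (fun i => Gop i) (enum 'I_N) (seq0 x) k.+1.

(** The order of [mon al], as [ek k] has order [k + 1] in the [d_i]. *)
Definition weight (D : nat) (al : {ffun 'I_N -> 'I_D}) : nat :=
  foldr (fun k w => (al k * k.+1 + w)%N) 0%N (enum 'I_N).

Local Notation Mt := (fun t => Mop t : {linear F -> F}).

Lemma symbol_mon D (al : {ffun 'I_N -> 'I_D}) : symbol Mt (weight al) (mon al)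
  (fun x => foldr (fun k acc => iter (al k) (gk k) acc) x (enum 'I_N)).
Proof.
rewrite /weight /mon; elim: (enum 'I_N) => [|k l IH] /=; first exact: symbol_id.
apply: symbol_comp IH; apply: symbol_iter.
apply: (symbol_mulzs (X := fun i => dk i : {linear F -> F})
  (G := fun i => Gop i : {linear F -> F})) => i.
by apply: symbol1 => t x; exact: dk_Mop.
Qed.

Lemma gkE k x q : regular gam A q ->
  gk k x q = esy (fun i => gfun i q) (enum 'I_N) k.+1 * x q.
Proof.
move=> Uq; rewrite /gk; elim: (enum 'I_N) (k.+1) => [|i l IH] m.
  by rewrite /seq0 /=; case: m => [|m] /=; rewrite ?mul1r // mul0r.
set g := mulzs _ l _ in IH; case: m => [|m].
  rewrite -[mulzs _ _ _ _]/(g 0%N + 0) addr0 IH; by case: (l).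
rewrite -[mulzs _ _ _ _]/(g m.+1 + Gop i (g m)) smfD (mulFE _ _ Uq) !IH /=; ring.
Qed.

Lemma gk_monE D (al : {ffun 'I_N -> 'I_D}) x q : regular gam A q ->
  foldr (fun k acc => iter (al k) (gk k) acc) x (enum 'I_N) q =
  (\prod_(k < N) esy (fun i => gfun i q) (enum 'I_N) k.+1 ^+ al k) * x q.
Proof.
move=> Uq; pose E k := esy (fun i => gfun i q) (enum 'I_N) (k : 'I_N).+1.
have gE k y : gk k y q = E k * y q by exact: gkE.
rewrite -[X in X * _]/(\prod_(k < N) E k ^+ al k) -big_enum /=.
elim: (enum 'I_N) => [|k l IH] /=; first by rewrite big_nil mul1r.
rewrite big_cons -mulrA -IH; elim: (al k : nat) => [|m IHm] /=; first by rewrite mul1r.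
by rewrite gE IHm exprS mulrA.
Qed.

(** A relation between the integrals is known on symmetric functions only; a symmetric function
    without zeros can be divided out at every regular configuration. *)
Lemma antisym_ex : tau = 1 \/ tau = -1 -> exists2 x : F,
  (forall i j, i != j -> Sop i j x = tau *: x) & (forall q, regular gam A q -> x q != 0).
Proof.
move=> [t1|t1].
  exists (mksm regset (fun => 1)).
    move=> i j ij; rewrite t1 scale1r; apply: smf_eq => q Uq; rewrite SopE //.
    by rewrite !mksmE //; [apply: gensm; exact: gen_cst | apply: gensm; exact: gen_cst | exact: regular_swq].
  by move=> q Uq; rewrite mksmE ?oner_eq0 //; apply: gensm; exact: gen_cst.
(* A swap of positions exchanges two columns of the Vandermonde matrix in the [x_i], and the
   determinant vanishes only where two [x_i] coincide. *)
pose r (q : RN) : 'rV[R[i]]_N := \row_i ex q i.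
pose f (q : RN) := \det (Vandermonde N (r q)).
have fE q : f q = \prod_(i < N) \prod_(j < N | (i < j)%N) (ex q j - ex q i).
  rewrite /f det_Vandermonde; apply: eq_bigr => i _; apply: eq_bigr => j _.
  by rewrite !mxE.
have gf : gen regset A f.
  rewrite (_ : f = fun q => \prod_(i < N) \prod_(j < N | (i < j)%N) (ex q j - ex q i)); last first.
    by apply/funext => q; exact: fE.
  have gp (P : pred 'I_N) (g : 'I_N -> RN -> R[i]) : (forall i, gen regset A (g i)) ->
    gen regset A (fun q => \prod_(i < N | P i) g i q).
    move=> gg; elim: (index_enum _) => [|i l IH].
      by under eq_fun do rewrite big_nil; exact: gen_cst.
    under eq_fun do rewrite big_cons; case: (P i) => //.
    exact: genM.
  apply: (gp) => i; apply: gp => j; apply: gen_sub; exact: gen_ex.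
exists (mksm regset f).
  move=> i j ij; apply: smf_eq => q Uq; rewrite smfZ SopE //.
  rewrite !mksmE; [|exact: gensm|by []|exact: gensm|exact: regular_swq].
  rewrite t1 /f (_ : Vandermonde N (r (swq i j q)) = Vandermonde N (r q) *m tperm_mx i j).
    by rewrite det_mulmx det_perm odd_tperm ij expr1 mulrC.
  rewrite -xcolE; apply/matrixP => k l; rewrite !mxE ex_swq.
  by rewrite ?mxE.
move=> q Uq; rewrite mksmE //; last exact: gensm.
rewrite fE; apply/prodf_neq0 => i _; apply/prodf_neq0 => j ij.
by rewrite ex_neq // -val_eqE /= gt_eqF.
Qed.

(** The positions come from the intermediate value theorem. Positive exponents keep the differences
    of [A] within the radius of [cexp_real_neq1], and distinct exponents keep them nonzero, so the
    configuration is regular. *)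
Lemma points_ex (b : 'I_N -> nat) : (forall i, 0 < b i)%N -> injective b ->
  exists2 e : R, 0 < e & forall t : R, 0 < t -> t < e ->
  exists2 q, regular gam A q & forall i, gfun i q = RtoC (t ^+ b i).
Proof.
move=> b0 binj; have [e e0 he] := cexp_real_neq1.
have dp : 0 < `|delta| by rewrite normr_gt0.
(* The bound 1 makes powers of [t] strictly decreasing in the exponent; the other one gives
   [|delta| t <= e]. *)
exists (Num.min 1 (e / `|delta|)); first by rewrite lt_min ltr01 divr_gt0.
move=> t t0; rewrite lt_min => /andP[t1 te].
have tb i : 0 < t ^+ b i <= t.
  rewrite exprn_gt0 //= -(prednK (b0 i)) exprS ger_pMr //.
  by rewrite exprn_ile1 // ltW.
have cA : continuous A.
  move=> x; apply: differentiable_continuous; apply/derivable1_diffP.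
  by have := hA x; case.
have sol i : exists x : R, A x = A 0 + delta * t ^+ b i.
  have /andP[u0 u1] := tb i.
  have v1 : t ^+ b i <= 1 by rewrite (le_trans u1) // ltW.
  have [||c _ hc] := @IVT R A 0 1 (A 0 + delta * t ^+ b i) ler01.
  - by apply: continuous_subspaceT.
  - rewrite ge_min le_max; case: (leP 0 delta) => d0.
      have h1 : 0 <= delta * t ^+ b i by rewrite mulr_ge0 // ltW.
      have h2 : delta * t ^+ b i <= delta by rewrite ler_piMr.
      apply/andP; split; apply/orP; [left|right]; lra.
    have h1 : delta * t ^+ b i <= 0 by rewrite mulr_le0_ge0 // ltW.
    have h2 : delta <= delta * t ^+ b i by rewrite ler_niMr // ltW.
    by apply/andP; split; apply/orP; [right|left]; lra.
  by exists c.
have [x hx] := choice sol.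
exists (\row_i x i); last first.
  move=> i; rewrite /gfun mxE hx RtoCD RtoCM.
  by field; rewrite RtoC_eq0.
move=> i j ij; rewrite !mxE !hx; apply: he.
  have -> : A 0 + delta * t ^+ b i - (A 0 + delta * t ^+ b j) =
    delta * (t ^+ b i - t ^+ b j) by ring.
  rewrite mulf_neq0 // subr_eq0; apply/eqP => E.
  have /binj/eqP : b i = b j; last by rewrite (negPf ij).
  have := E; case: (ltngtP (b i) (b j)) => // h; move/eqP.
    by rewrite gt_eqF // ltr_iXn2l.
  by rewrite lt_eqF // ltr_iXn2l.
have -> : A 0 + delta * t ^+ b i - (A 0 + delta * t ^+ b j) =
    delta * (t ^+ b i - t ^+ b j) by ring.
rewrite normrM -ler_pdivlMl // mulrC (le_trans _ (ltW te)) // ler_norml.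
have /andP[i0 i1] := tb i; have /andP[j0 j1] := tb j.
by apply/andP; split; lra.
Qed.

Lemma mon_free D (c : {ffun 'I_N -> 'I_D} -> R[i]) : tau = 1 \/ tau = -1 ->
  (forall x, (forall i j, i != j -> Sop i j x = tau *: x) -> \sum_al c al *: mon al x = 0) ->
  forall al, c al = 0.
Proof.
move=> tpm h0; apply: contrapT => /existsNP[al0 /eqP c0].
have [x0 sx x0n] := antisym_ex tpm.
(* Among the monomials with nonzero coefficient, those of maximal weight alone contribute to the
   symbol. *)
have [|als csn wmax] := @eq_bigmax_cond _ [pred al | c al != 0] (@weight D).
  by apply/card_gt0P; exists al0.
rewrite inE /= in csn; set w := \max_(_ in _) _ in wmax.
pose P al := (c al != 0) && (weight al == w).
have S : symbol Mt w (fun x => \sum_(al | c al != 0) c al *: mon al x)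
  (fun x => \sum_(al | c al != 0) if weight al == w then
     c al *: foldr (fun k acc => iter (al k) (gk k) acc) x (enum 'I_N) else 0).
  apply: (@symbol_sum _ _ _ _ _ _ (fun al => c al != 0) (fun al x => c al *: mon al x)
    (fun al x => if weight al == w then
     c al *: foldr (fun k acc => iter (al k) (gk k) acc) x (enum 'I_N) else 0)) => al cn.
  have := symbol_mon al; case: eqP => [->|/eqP ne] H.
    exact: (symbolZ (c al) H).
  apply: (symbol_lt _ (symbolZ (c al) H)).
  by rewrite ltn_neqAle ne /=; exact: (leq_bigmax_cond (P := [pred al | c al != 0])).
(* The relation applies to [Mop t x0], which is symmetric for every [t], so its symbol vanishes on
   [x0]; division by [x0 q] leaves a scalar identity. *)
have key q : regular gam A q ->
  \sum_(al | P al) c al * \prod_(k < N) esy (fun i => gfun i q) (enum 'I_N) k.+1 ^+ al k = 0.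
  move=> Uq; have := symbol_eq0 (e := ev q) (x := x0) (evZ q) _ S.
  rewrite raddf_sum /= => H; apply: (mulIf (x0n q Uq)); rewrite mul0r mulr_suml -[RHS]H.
  - rewrite big_mkcondr /=; apply: eq_bigr => al _.
    case: (weight al == w); last by rewrite raddf0.
    rewrite evZ -mulrA; congr (_ * _); exact/esym/gk_monE.
  - move=> t y; rewrite -[ev q (Mop t y)]/(Mop t y q) mulFE // => /eqP.
    by rewrite mulf_eq0 (negPf (cexp_neq0 _)) /= => /eqP.
  - move=> t; rewrite -[RHS](h0 (Mop t x0)).
      rewrite [RHS](bigID (fun al => c al != 0)) /= [X in _ + X]big1 ?addr0 //.
      by move=> al /negPn/eqP ->; rewrite scale0r.
    by move=> i j ij; rewrite Sop_Mop sx // (linZ (Mop t)).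
pose G := maxn D 3.
have G2 : (2 < G)%N by rewrite /G leq_max orbT.
have bm := bexp_mono G2.
have b0 (i : 'I_N) : (0 < bexp G i)%N.
  have h : (0 < bexp G 0)%N by rewrite /bexp /=; lia.
  by case: (posnP i) => [->//|/bm]; apply: ltn_trans.
have bi : injective (fun i : 'I_N => bexp G i).
  move=> i j E; apply: val_inj; case: (ltngtP i j) => // /bm; by rewrite /= E ltnn.
have [e e0 he] := points_ex b0 bi.
(* Infinitely many parameters in the open interval from 0 to [e]: enough to pass from values to an
   identity of polynomials. *)
pose tt (m : nat) : R := e / m.+2%:R.
have ttinj : injective (fun m => RtoC (tt m)).
  move=> m m' [] /(mulfI (lt0r_neq0 e0)) /invr_inj /eqP; rewrite eqr_nat => /eqP. by case.
have pz : \sum_(al | P al) c al *: \prod_(k < N)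
    esy (fun i : 'I_N => 'X^(bexp G i)) (enum 'I_N) k.+1 ^+ al k = 0 :> {poly R[i]}.
  apply: (poly_roots0 ttinj) => m.
  have t0 : 0 < tt m by rewrite divr_gt0 // ltr0n.
  have te : tt m < e by rewrite ltr_pdivrMr ?ltr0n // ltr_pMr // ltr1n.
  have [q Uq gq] := he _ t0 te.
  rewrite -(key q Uq) horner_sum; apply: eq_bigr => al _.
  rewrite hornerZ horner_prod; congr (_ * _); apply: eq_bigr => k _.
  rewrite horner_exp esy_horner; congr (_ ^+ _); apply: esy_eq => i.
  rewrite hornerXn gq; elim: (bexp G i) => [|b IH]; first by rewrite !expr0.
  by rewrite !exprS RtoCM IH.
have := esy_monomials_free pz (al := als); rewrite /P csn wmax eqxx => /(_ erefl) /eqP.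
by rewrite (negPf csn).
Qed.

(** [mksm] makes the operator total on raw wave functions; by [rep_mksm] only the values on the
    regular set matter. *)
Definition esym_op (k : 'I_N) (phi : wfn) : wfn := fun q s => ek k (mksm regset (fun q => phi q s)) q.

Lemma rep_esym_op k phi Phi : rep phi Phi -> rep (esym_op k phi) (fun s => ek k (Phi s)).
Proof. by move=> h s q Uq; rewrite /esym_op (rep_mksm s h). Qed.

Lemma rep_op_monomial D (al : {ffun 'I_N -> 'I_D}) phi Phi : rep phi Phi ->
  rep (op_monomial esym_op al phi) (fun s => mon al (Phi s)).
Proof.
move=> h; rewrite /op_monomial /mon; elim: (enum 'I_N) => [//|k l IH] /=.
by elim: (al k : nat) => [//|m IHm] /=; exact: rep_esym_op.
Qed.

(** Wave functions constant in the spins already detect independence; [n > 0] provides a spin state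
    at which to evaluate them. *)
Lemma op_monomial_free D (c : {ffun 'I_N -> 'I_D} -> R[i]) : tau = 1 \/ tau = -1 -> (0 < n)%N ->
  (forall phi : wfn, inL1 gam tau A phi ->
     eqU gam A (fun q s => \sum_al c al * op_monomial esym_op al phi q s) (fun _ _ => 0)) ->
  forall al, c al = 0.
Proof.
move=> tpm n0 h; apply: mon_free => // x sx; apply: smf_eq => q Uq.
pose phi : wfn := fun q _ => x q.
have rP : rep phi (fun=> x) by [].
have /h/(_ q Uq (fun=> Ordinal n0)) : inL1 gam tau A phi.
  by apply/inL1P; exists (fun=> x) => // i j ij; apply/funext => s; exact: sx.
rewrite smf_sum smf0 => E; rewrite -[RHS]E; apply: eq_bigr => al _.
by rewrite smfZ (rep_op_monomial al rP).
Qed.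

End Model.

Theorem theorem8 (R : realType) (N n : nat) (lam gam tau : R[i]) (a A : R -> R) :
  (2 <= N)%N -> (1 <= n)%N ->
  (tau = 1 \/ tau = -1) ->
  gam != 0 ->
  (* a is C^infinity and nowhere zero *)
  (forall (k : nat) (x : R), derivable (iter k (fun f : R -> R => derive1 f) a) x (1 : R)) ->
  (forall x, a x != 0) ->
  (* A is an invertible antiderivative of 1/a *)
  (forall x : R, is_derive x (1 : R) A ((a x)^-1)) ->
  injective A ->
  (* (1) explicit form of \tilde H on L^(1) *)
  (forall phi : wf R N n, inL1 gam tau A phi ->
     eqU gam A (Htilde lam gam tau a A phi) (Hexplicit lam gam a A phi))
  /\
  (* (2) Yangian symmetry *)
  (forall (k : nat) (ai bi : 'I_n) (phi : wf R N n), inL1 gam tau A phi ->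
     eqU gam A (Htilde lam gam tau a A (TLam_entry lam gam tau a A k ai bi phi))
               (TLam_entry lam gam tau a A k ai bi (Htilde lam gam tau a A phi)))
  /\
  (* (3) integrability *)
  (exists I : 'I_N -> wf R N n -> wf R N n,
     (forall k (phi : wf R N n), inL1 gam tau A phi -> inL1 gam tau A (I k phi)) /\
     (forall k (phi psi : wf R N n), inL1 gam tau A phi -> inL1 gam tau A psi ->
        eqU gam A phi psi -> eqU gam A (I k phi) (I k psi)) /\
     (forall k (c : R[i]) (phi psi : wf R N n),
        inL1 gam tau A phi -> inL1 gam tau A psi ->
        eqU gam A (I k (fun q s => c * phi q s + psi q s))
                  (fun q s => c * I k phi q s + I k psi q s)) /\
     (forall k l (phi : wf R N n), inL1 gam tau A phi ->
        eqU gam A (I k (I l phi)) (I l (I k phi))) /\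
     (forall k (phi : wf R N n), inL1 gam tau A phi ->
        eqU gam A (I k (Htilde lam gam tau a A phi))
                  (Htilde lam gam tau a A (I k phi))) /\
     (forall (D : nat) (c : {ffun 'I_N -> 'I_D} -> R[i]),
        (forall phi : wf R N n, inL1 gam tau A phi ->
           eqU gam A (fun q s => \sum_(al : {ffun 'I_N -> 'I_D})
                                    c al * op_monomial I al phi q s)
                     (fun _ _ => 0)) ->
        forall al, c al = 0)).
Proof.
move=> _ n0 tpm gam0 ha a0 hA Ainj.
have tau2 : tau * tau = 1 by case: tpm => ->; rewrite ?mulr1 // mulrNN mulr1.
(* The normalising constant of [gfun] is nonzero by injectivity of [A]. *)
have delta0 : A 1 - A 0 != 0.
  by rewrite subr_eq0; apply/eqP => /Ainj/eqP; rewrite oner_eq0.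
have L1 (phi : wf R N n) := @inL1P R N gam tau a A hA n tau2 phi.
split; [|split].
- move=> phi /L1[Phi rP sP].
  apply: rep_eqU2 (rep_Htilde lam tau ha a0 rP) _.
  by rewrite (LamV_id tau2 sP); exact: rep_Hexplicit.
- by move=> k ai bi phi /L1[Phi rP _]; exact: (TLam_Htilde lam ha a0 tau2 gam0 k ai bi rP).
exists (@esym_op R N lam gam tau a A ha a0 hA n).
have repI := @rep_esym_op R N lam gam tau a A ha a0 hA n.
split; [|split; [|split; [|split; [|split]]]].
- move=> k phi /L1[Phi rP sP]; apply/L1; eexists; first exact: repI rP.
  exact: symV_ek.
- move=> k phi psi /L1[Phi rP _] _ e; apply: rep_eqU2 (repI _ _ _ rP) _.
  by apply: repI; exact: rep_eqU e rP.
- move=> k c phi psi /L1[Phi rP _] /L1[Psi rQ _].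
  have rL : rep (fun q s => c * phi q s + psi q s) (fun s => c *: Phi s + Psi s).
    by move=> s q Uq; rewrite smfD smfZ rP // rQ.
  apply: rep_eqU2 (repI k _ _ rL) _ => s q Uq.
  by rewrite (repI k _ _ rP) // (repI k _ _ rQ) // ek_linear.
- move=> k l phi /L1[Phi rP _]; apply: rep_eqU2 (repI k _ _ (repI l _ _ rP)) _ => s q Uq.
  by rewrite (repI l _ _ (repI k _ _ rP)) // ek_ek.
- move=> k phi /L1[Phi rP sP].
  apply: rep_eqU2 (repI k _ _ (rep_Htilde lam tau ha a0 rP)) _ => s q Uq.
  (* The symmetrizer inside [Htilde] is the identity both before and after applying the integral,
     which preserves symmetry. *)
  rewrite (rep_Htilde lam tau ha a0 (repI k _ _ rP)) // !LamV_id //.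
    by rewrite ek_Hop.
  exact: symV_ek.
- by move=> D c h; exact: (op_monomial_free tau2 gam0 delta0 tpm n0 h).
Qed.
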